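(* Suppose $\boldsymbol{\lambda}^n/\sqrt n\to\boldsymbol{\lambda}\ge0$ as $n\to\infty$ and the covariance matrix $C$ is positive definite. Then $\hat{\boldsymbol u}_n:=\sqrt n(\hat{\boldsymbol\beta}_n-\beta^0)$ converges in distribution to $\hat{\boldsymbol u}:=\operatorname{argmin}_{u\in\mathbb{R}^p}V(u)$, where $$V(u)=\tfrac12u^TCu-u^TW+J'_{\boldsymbol\lambda}(\beta^0;u),\qquad W\sim\mathcal N(0,\sigma^2C),$$ and $J'_{\boldsymbol\lambda}(\beta^0;u)$ is the directional derivative of $J_{\boldsymbol\lambda}$ at $\beta^0$ in direction $u$. Moreover, for every $u\in\mathbb{R}^p$ this directional derivative is given by $$J'_{\boldsymbol\lambda}(\beta^0;u)=\sum_{i=1}^p\lambda_{\pi(i)}\Big[u_i\,\mathrm{sgn}(\beta^0_i)\,\mathbb I[\beta^0_i\ne0]+|u_i|\,\mathbb I[\beta^0_i=0]\Big],$$ where $\pi$ is a permutation of $\{1,\dots,p\}$ (depending on $u$) which sorts $|\beta^0+u/\sqrt n|$ for all sufficiently large $n$, i.e. there is $M>0$ such that for all $n\ge M$ $$|(\beta^0+u/\sqrt n)_{\pi^{-1}(1)}|\ge\dots\ge|(\beta^0+u/\sqrt n)_{\pi^{-1}(p)}|.$$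
   Context: Linear model: $p$ is fixed, $\beta^0\in\mathbb{R}^p$ is fixed, $X_1,X_2,\dots$ are i.i.d. centered random vectors in $\mathbb{R}^p$ with covariance matrix $C$, and $\varepsilon_1,\varepsilon_2,\dots$ are i.i.d. centered real random variables with (finite) variance $\sigma^2$, independent of the $X_i$. For each $n$ put $X=(X_1,\dots,X_n)^T\in\mathbb{R}^{n\times p}$, $\varepsilon=(\varepsilon_1,\dots,\varepsilon_n)^T$ and $y=X\beta^0+\varepsilon$. SLOPE norm: for $\boldsymbol{\lambda}=(\lambda_1,\dots,\lambda_p)$ with $\lambda_1\ge\dots\ge\lambda_p\ge0$, $J_{\boldsymbol{\lambda}}(\beta)=\sum_{i=1}^p\lambda_i|\beta|_{(i)}$, where $|\beta|_{(1)}\ge\dots\ge|\beta|_{(p)}$ are the absolute values of the coordinates of $\beta$ in decreasing order. For each $n$, $\boldsymbol{\lambda}^n$ is a deterministic vector with $\lambda^n_1\ge\dots\ge\lambda^n_p\ge0$, and the SLOPE estimator is $$\hat{\boldsymbol\beta}_n=\operatorname{argmin}_{\beta\in\mathbb{R}^p}\ \tfrac12\|y-X\beta\|_2^2+J_{\boldsymbol{\lambda}^n}(\beta).$$ *)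

(* Defs.v *)
From mathcomp Require Export all_boot all_order all_algebra all_fingroup.
From mathcomp Require Export all_classical all_reals all_analysis.
Export Order.TTheory GRing.Theory Num.Theory.
Export numFieldNormedType.Exports.

Set Implicit Arguments.
Unset Strict Implicit.
Unset Printing Implicit Defensive.

Local Open Scope classical_set_scope.
Local Open Scope ring_scope.

(* R^p is represented by column vectors; borel_cV R p is a copy of 'cV[R]_p
   (convertible to it) carrying the Borel sigma-algebra. *)
Notation borel_cV R p := (g_sigma_algebraType (@open 'cV[R]_p)).

Definition coord (R : realType) (p : nat) (T : Type)
    (U : T -> borel_cV R p) (j : 'I_p) : T -> R :=
  fun w => (U w : 'cV[R]_p) j 0.

Section independence.
Context d (T : measurableType d) (R : realType) (P : probability T R).

Definition mutually_independent (I : eqType) (F : I -> set_system T) : Prop :=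
  forall (s : seq I) (E : I -> set T), uniq s ->
    (forall i, i \in s -> F i (E i)) ->
    P (\bigcap_(i in [set` s]) E i) = (\prod_(i <- s) P (E i))%E.

Definition independent2 (F G : set_system T) : Prop :=
  forall A B, F A -> G B -> P (A `&` B) = (P A * P B)%E.

Definition sigma_of d' (S : measurableType d') (X : T -> S) : set_system T :=
  preimage_set_system setT X measurable.

Definition sigma_of_seq d' (S : measurableType d') (X : nat -> T -> S) :
    set_system T :=
  <<s \bigcup_i sigma_of (X i) >>.

Definition iid d' (S : measurableType d') (X : nat -> {RV P >-> S}) : Prop :=
  mutually_independent (fun i => sigma_of (X i)) /\
  forall i (A : set S), measurable A ->
    distribution P (X i) A = distribution P (X 0%N) A.

End independence.

(* The univariate law N(m, v) with variance v; it is the point mass at m when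
   v = 0, whereas the library's normal_prob m 0 is a uniform law. *)
Definition normal_law (R : realType) (m v : R) (A : set R) : \bar R :=
  if v == 0 then \d_m A else normal_prob m (Num.sqrt v) A.

(* W ~ N(m, S): every linear functional t^T W has law N(t^T m, t^T S t). *)
Definition gaussian_vector (R : realType) (p : nat) d (T : measurableType d)
    (P : probability T R) (W : {RV P >-> borel_cV R p})
    (m : 'cV[R]_p) (S : 'M[R]_p) : Prop :=
  forall (t : 'cV[R]_p) (A : set R), measurable A ->
    P [set w | A ((t^T *m (W w : 'cV[R]_p)) 0 0)] =
    normal_law ((t^T *m m) 0 0) ((t^T *m S *m t) 0 0) A.

Definition cvg_in_distribution (R : realType) (p : nat)
    d (T : measurableType d) (P : probability T R)
    d' (T' : measurableType d') (Q : probability T' R)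
    (U : nat -> T -> 'cV[R]_p) (L : T' -> 'cV[R]_p) : Prop :=
  forall f : 'cV[R]_p -> R, continuous f ->
    (exists M : R, forall x, `|f x| <= M) ->
    ('E_P[f \o U n] @[n --> \oo] --> 'E_Q[f \o L])%E.

Definition pos_def (R : realType) (p : nat) (C : 'M[R]_p) : Prop :=
  C^T = C /\ forall v : 'cV[R]_p, v != 0 -> 0 < (v^T *m C *m v) 0 0.

Definition argmin (R : realType) (T : Type) (f : T -> R) : set T :=
  [set x | forall y, f x <= f y].

Definition sqnorm2 (R : realType) (n : nat) (v : 'cV[R]_n) : R :=
  \sum_(i < n) v i 0 ^+ 2.

Definition slope_weights (R : realType) (p : nat) (lam : 'cV[R]_p) : Prop :=
  (forall i j : 'I_p, (i <= j)%N -> lam j 0 <= lam i 0) /\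
  (forall i : 'I_p, 0 <= lam i 0).

Definition sorted_abs (R : realType) (p : nat) (b : 'cV[R]_p) : seq R :=
  sort (fun x y : R => y <= x) [seq `|b i 0| | i <- enum 'I_p].

Definition slope_norm (R : realType) (p : nat) (lam b : 'cV[R]_p) : R :=
  \sum_(i < p) lam i 0 * (sorted_abs b)`_i.

Definition slope_objective (R : realType) (n p : nat) (lam : 'cV[R]_p)
    (X : 'M[R]_(n, p)) (y : 'cV[R]_n) (b : 'cV[R]_p) : R :=
  2^-1 * sqnorm2 (y - X *m b) + slope_norm lam b.

Definition diff_quotient (R : realType) (p : nat) (f : 'cV[R]_p -> R)
    (b u : 'cV[R]_p) (t : R) : R :=
  (f (b + t *: u) - f b) / t.

(* One-sided directional derivative; the library's 'D_u f b is two-sided. *)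
Definition dir_deriv (R : realType) (p : nat) (f : 'cV[R]_p -> R)
    (b u : 'cV[R]_p) : R :=
  lim (diff_quotient f b u t @[t --> 0^'+]).

Definition limit_objective (R : realType) (p : nat) (C : 'M[R]_p)
    (lam b0 w u : 'cV[R]_p) : R :=
  2^-1 * (u^T *m C *m u) 0 0 - (u^T *m w) 0 0
  + dir_deriv (slope_norm lam) b0 u.

(* s sends an index to its rank: s^-1 i is the index of the i-th largest
   absolute value. *)
Definition sorts_abs (R : realType) (p : nat) (s : 'S_p) (v : 'cV[R]_p) : Prop :=
  forall i j : 'I_p, (i <= j)%N ->
    `|v ((s^-1)%g j) 0| <= `|v ((s^-1)%g i) 0|.

Definition eventually_sorts_abs (R : realType) (p : nat) (s : 'S_p)
    (b u : 'cV[R]_p) : Prop :=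
  exists2 M : nat, (0 < M)%N & forall n : nat, (M <= n)%N ->
    sorts_abs s (b + (Num.sqrt n%:R)^-1 *: u).

Definition slope_dir_formula (R : realType) (p : nat) (lam b u : 'cV[R]_p)
    (s : 'S_p) : R :=
  \sum_(i < p) lam (s i) 0 *
    (u i 0 * Num.sg (b i 0) * (b i 0 != 0)%:R + `|u i 0| * (b i 0 == 0)%:R).

Definition design (R : realType) (p : nat) (T : Type)
    (X : nat -> T -> borel_cV R p) (n : nat) (w : T) : 'M[R]_(n, p) :=
  \matrix_(i < n, j < p) coord (X i) j w.

Definition response (R : realType) (p : nat) (T : Type)
    (X : nat -> T -> borel_cV R p) (eps : nat -> T -> R) (b0 : 'cV[R]_p)
    (n : nat) (w : T) : 'cV[R]_n :=
  design X n w *m b0 + \col_(i < n) eps i w.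

(* Main.v *)
(* Write the estimator error as u_n = sqrt n (betahat_n - beta0): it minimizes
   V_n(u) = u^T C_n u / 2 - u^T W_n + G_n(u), where C_n = X^T X / n,
   W_n = X^T eps / sqrt n and G_n is an increment of the SLOPE norm.  The SLOPE
   norm is a maximum over permutations of weighted l1 norms, so it is a norm, and
   near beta0 its increments are exactly linear along rays; hence G_n converges
   to the directional derivative uniformly on bounded sets.  As C is positive
   definite, the limit objective with linear term w has a unique minimizer F(w),
   F is Lipschitz, and strong convexity forces u_n to be close to F(W_n) as soon
   as C_n is close to C and W_n is bounded.  The weak law of large numbers gives
   the former, a second moment bound the latter, and the central limit theorem
   together with continuity of F gives F(W_n) => F(W).

   Both limit theorems come from characteristic functions written with real sines
   and cosines.  To pass from characteristic functions to bounded continuous test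
   functions, such a function is approximated on a ball by lattice combinations
   of trigonometric polynomials, clipped so that they stay bounded outside it. *)
Require Import Defs.
From mathcomp Require Import measurable_realfun ring lra.
Import Num.Def.

Set Implicit Arguments.
Unset Strict Implicit.
Unset Printing Implicit Defensive.

Local Open Scope classical_set_scope.
Local Open Scope ring_scope.

(** * The SLOPE norm *)

(** Only minimality of [betahat] is given, and C_n may be singular for some samples, so no inverse
    or closed formula is at hand: everything rests on the gap c / 4 |u - u0|^2 between a strongly
    convex objective at u and its minimum at u0. Midpoint convexity of the penalty is enough for
    this gap. The comparison of u_n with F(W_n) is deterministic, so probability enters only through
    C_n and W_n. The data have second moments and nothing more. Entries of C_n average variables
    with only a first moment, out of reach of Chebyshev's inequality; this is why the law of large
    numbers goes through characteristic functions. In both limit theorems, n times a one-step Taylor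
    remainder tends to 0 by dominated convergence, which costs a first, respectively a second,
    moment. A trigonometric polynomial close to a test function on a ball is not close to it
    elsewhere. The global bound obtained by clipping, together with tightness, makes the remaining
    mass negligible. *)

Section slope_norm_theory.
Context {R : realType} {p : nat}.
Implicit Types (x y u lam mu : 'cV[R]_p) (s : 'S_p).

Lemma ler_coord_norm x (i : 'I_p) : `|x i 0| <= `|x|.
Proof.
rewrite [leRHS]/normr/= mx_normrE; apply/bigmax_geP; right => /=.
by exists (i, 0).
Qed.

Lemma norm_cV_le x (c : R) :
  0 <= c -> (forall i, `|x i 0| <= c) -> `|x| <= c.
Proof.
move=> c0 xc; rewrite [leLHS]/normr/= mx_normrE.
by apply/bigmax_leP; split => //= -[i j] _ /=; rewrite ord1.
Qed.

Lemma sorted_absE s x : sorts_abs s x ->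
  sorted_abs x = [seq `|x ((s^-1)%g i) 0| | i <- enum 'I_p].
Proof.
move=> sx; pose leT := fun a b : R => b <= a.
have leT_tr : transitive leT by move=> b a c ab bc; exact: le_trans bc ab.
have leT_anti : antisymmetric leT by move=> a b; rewrite /leT andbC => /le_anti.
apply: (sorted_eq leT_tr leT_anti).
- by apply: sort_sorted => a b; rewrite /leT le_total.
- case: (posnP p) => [p0|p0].
    by rewrite (_ : enum 'I_p = [::])//; apply: size0nil; rewrite size_enum_ord.
  apply/(sortedP 0) => i; rewrite size_map size_enum_ord => ip.
  have ip' := ltnW ip.
  rewrite !(nth_map (Ordinal p0)) -?enumT ?size_enum_ord// /leT.
  by apply: sx; rewrite !nth_enum_ord.
- rewrite (permPl (permEl (perm_sort _ _))).
  rewrite [X in perm_eq _ X](map_comp (fun i => `|x i 0|) (s^-1)%g).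
  apply: perm_map.
  apply: uniq_perm; rewrite ?enum_uniq//.
    by rewrite map_inj_uniq ?enum_uniq//; exact: perm_inj.
  move=> i; rewrite mem_enum inE; apply/esym/mapP.
  by exists (s i); rewrite ?mem_enum// permK.
Qed.

Lemma slope_normE lam s x : sorts_abs s x ->
  slope_norm lam x = \sum_(i < p) lam (s i) 0 * `|x i 0|.
Proof.
move=> sx; rewrite /slope_norm (sorted_absE sx).
rewrite (reindex_inj (@perm_inj _ s)); apply: eq_bigr => i _.
by rewrite (nth_map i) ?size_enum_ord// nth_ord_enum permK.
Qed.

Lemma ex_sorts_abs x : exists s, sorts_abs s x.
Proof.
pose leT := fun i j : 'I_p => `|x j 0| <= `|x i 0|.
pose l := sort leT (enum 'I_p).
have lU : uniq l by rewrite sort_uniq enum_uniq.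
have lS : size l = p by rewrite size_sort size_enum_ord.
have finj : injective (fun i : 'I_p => nth i l i).
  move=> i j; rewrite (set_nth_default i) ?lS// => /eqP.
  by rewrite nth_uniq ?lS// => /eqP/val_inj.
(* [finj] sends a rank to an index, while [sorts_abs] takes the map from index to rank. *)
exists (perm finj)^-1%g => i j ij; rewrite !invgK !permE.
have leT_tr : transitive leT by move=> b a c ab bc; exact: le_trans bc ab.
have srt : sorted leT l by apply: sort_sorted => a b; exact: le_total.
have := sorted_leq_nth leT_tr _ i srt.
move=> /(_ (fun=> lexx _) i j).
rewrite /leT !inE !lS !ltn_ord => /(_ isT isT ij).
by rewrite (set_nth_default j i) ?lS.
Qed.

(** Both index sets have k + 1 elements, so [b k] may be subtracted from every term. What remains is
    nonnegative up to k and nonpositive after k, and the initial segment collects all the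
    nonnegative terms. *)
Lemma sum_antitone_perm (b : 'I_p -> R) (t : 'S_p) (k : 'I_p) :
  (forall i j : 'I_p, (i <= j)%N -> b j <= b i) ->
  \sum_(i < p | (t i <= k)%N) b i <= \sum_(i < p | (i <= k)%N) b i.
Proof.
move=> bdec.
have E : \sum_(i < p | (t i <= k)%N) b k = \sum_(i < p | (i <= k)%N) b k.
  by rewrite [RHS](reindex_inj (@perm_inj _ t)).
rewrite -(lerD2r (- \sum_(i < p | (i <= k)%N) b k)) -{1}E -!sumrB.
rewrite big_mkcond [leRHS]big_mkcond; apply: ler_sum => i _.
case: (leqP i k) => ik; case: ifP => _ //.
  by rewrite subr_ge0 bdec.
by rewrite subr_le0 bdec// ltnW.
Qed.

(* Summation by parts, writing the weights as sums of their decrements. *)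
Lemma rearrangement (a b : 'I_p -> R) (t : 'S_p) :
  (forall i j : 'I_p, (i <= j)%N -> a j <= a i) -> (forall i, 0 <= a i) ->
  (forall i j : 'I_p, (i <= j)%N -> b j <= b i) ->
  \sum_(i < p) a (t i) * b i <= \sum_(i < p) a i * b i.
Proof.
move=> adec a0 bdec.
(* [a] is continued by 0 at p, so that the last decrement is the last weight, nonnegative by
   [a0]. *)
pose a' (k : nat) : R := if insub k is Some i then a i else 0.
have a'E (i : 'I_p) : a' i = a i by rewrite /a' valK.
have a'p : a' p = 0 by rewrite /a' insubF// ltnn.
pose d (k : 'I_p) := a' k - a' k.+1.
have d0 k : 0 <= d k.
  rewrite /d a'E subr_ge0 /a'; case: insubP => [j _ jk|_]; last exact: a0.
  by apply: adec; rewrite jk.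
have aE (j : 'I_p) : a j = \sum_(k < p | (j <= k)%N) d k.
  rewrite -(big_geq_mkord j p xpredT (fun k => a' k - a' k.+1)).
  rewrite -[LHS]opprK -[RHS]opprK -sumrN; congr (- _).
  under eq_bigr do rewrite opprB.
  by rewrite telescope_sumr ?a'p ?a'E ?sub0r// ltnW.
have ex (t' : 'S_p) : \sum_(i < p) a (t' i) * b i =
    \sum_(k < p) d k * \sum_(i < p | (t' i <= k)%N) b i.
  transitivity (\sum_(i < p) \sum_(k < p | (t' i <= k)%N) d k * b i).
    by apply: eq_bigr => i _; rewrite aE mulr_suml.
  rewrite (exchange_big_dep predT)//=; apply: eq_bigr => k _.
  by rewrite mulr_sumr.
rewrite (ex t); have -> : \sum_(i < p) a i * b i =
    \sum_(k < p) d k * \sum_(i < p | (i <= k)%N) b i.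
  have := ex 1%g; under eq_bigr do rewrite perm1; move=> ->.
  by apply: eq_bigr => k _; under eq_bigl do rewrite perm1.
by apply: ler_sum => k _; rewrite ler_wpM2l// sum_antitone_perm.
Qed.

(** After reindexing by the permutation that sorts [x] this is the rearrangement inequality. *)
Lemma slope_norm_ge_perm lam s x : slope_weights lam ->
  \sum_(i < p) lam (s i) 0 * `|x i 0| <= slope_norm lam x.
Proof.
move=> [ldec l0]; have [s0 s0x] := ex_sorts_abs x.
rewrite (slope_normE _ s0x).
rewrite (reindex_inj (@perm_inj _ s0^-1%g)) [leRHS](reindex_inj (@perm_inj _ s0^-1%g))/=.
under [leRHS]eq_bigr do rewrite permKV.
have := @rearrangement (fun i => lam i 0) (fun i => `|x (s0^-1%g i) 0|) (s0^-1 * s)%g ldec l0 s0x.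
by move=> /=; under eq_bigr do rewrite permM.
Qed.

(** The permutation that sorts [x + y] attains the norm on the left and is merely one candidate for
    each norm on the right. *)
Lemma slope_normD lam x y : slope_weights lam ->
  slope_norm lam (x + y) <= slope_norm lam x + slope_norm lam y.
Proof.
move=> lw; have [s sxy] := ex_sorts_abs (x + y).
rewrite (slope_normE _ sxy).
apply: le_trans (lerD (slope_norm_ge_perm s x lw) (slope_norm_ge_perm s y lw)).
rewrite -big_split/=; apply: ler_sum => i _.
by rewrite -mulrDr mxE ler_wpM2l ?ler_normD//; case: lw => _; exact.
Qed.

Lemma slope_normZ lam x (t : R) :
  slope_norm lam (t *: x) = `|t| * slope_norm lam x.
Proof.
have [s sx] := ex_sorts_abs x.
have stx : sorts_abs s (t *: x).
  by move=> i j ij; rewrite !mxE !normrM ler_wpM2l// sx.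
rewrite (slope_normE _ sx) (slope_normE _ stx) mulr_sumr.
by apply: eq_bigr => i _; rewrite mxE normrM mulrCA.
Qed.

Lemma slope_norm_weightsZ lam x (t : R) :
  slope_norm (t *: lam) x = t * slope_norm lam x.
Proof.
by rewrite /slope_norm mulr_sumr; apply: eq_bigr => i _; rewrite mxE mulrA.
Qed.

Lemma slope_norm_le lam x : slope_weights lam ->
  slope_norm lam x <= (\sum_(i < p) lam i 0) * `|x|.
Proof.
move=> [_ l0]; have [s sx] := ex_sorts_abs x.
rewrite (slope_normE _ sx) [X in _ <= X * _](reindex_inj (@perm_inj _ s))/=.
by rewrite mulr_suml ler_sum// => i _; rewrite ler_wpM2l// ler_coord_norm.
Qed.

Lemma slope_norm_lipschitz lam x y : slope_weights lam ->
  `|slope_norm lam x - slope_norm lam y| <= (\sum_(i < p) lam i 0) * `|x - y|.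
Proof.
move=> lw; rewrite ler_norml; apply/andP; split.
  rewrite lerNl opprB lerBlDr distrC.
  by rewrite -{1}(subrK x y) (le_trans (slope_normD _ _ lw))// lerD2r slope_norm_le.
rewrite lerBlDr -{1}(subrK y x).
by rewrite (le_trans (slope_normD _ _ lw))// lerD2r slope_norm_le.
Qed.

(** Starting the minimum at 1 covers a family without positive values, and halving it makes the
    bound strict. *)
Lemma ex_pos_lower_bound (I : finType) (v : I -> R) :
  exists2 g : R, 0 < g & forall i, 0 < v i -> g < v i.
Proof.
pose m := \big[Num.min/1]_(i | 0 < v i) v i.
have m0 : 0 < m by apply/bigmin_gtP; split.
exists (m / 2) => [|i vi]; first by rewrite divr_gt0.
have : m <= v i by rewrite /m (bigmin_le_cond _ _).
by apply: lt_le_trans; rewrite ltr_pdivrMr// ltr_pMr// ltr1n.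
Qed.

(** The right derivative at 0 of [t |-> |x_i + t u_i|]. *)
Definition abs_slope x u (i : 'I_p) : R :=
  u i 0 * Num.sg (x i 0) * (x i 0 != 0)%:R + `|u i 0| * (x i 0 == 0)%:R.

Lemma slope_dir_formulaE lam x u s :
  slope_dir_formula lam x u s = \sum_(i < p) lam (s i) 0 * abs_slope x u i.
Proof. by []. Qed.

Lemma slope_dir_formulaZ lam x u s (t : R) : 0 <= t ->
  slope_dir_formula lam x (t *: u) s = t * slope_dir_formula lam x u s.
Proof.
move=> t0; rewrite !slope_dir_formulaE mulr_sumr; apply: eq_bigr => i _.
by rewrite /abs_slope !mxE normrM (ger0_norm t0); ring.
Qed.

Lemma abs_slope_le x u i : `|abs_slope x u i| <= `|u i 0|.
Proof.
rewrite /abs_slope; have [_|x0] := eqVneq (x i 0) 0.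
  by rewrite mulr0 add0r mulr1 normr_id.
by rewrite mulr0 addr0 mulr1 normrM normr_sg x0 mulr1.
Qed.

(** The radius is below every nonzero |x_i|, so no coordinate changes sign on the segment, and below
    half of every positive gap between absolute values, so an order valid at x + u is already valid
    at x. Absolute values are then affine in t, and an inequality between two of them at t = 0 and t
    = 1 holds in between. *)
Lemma norm_sorted_line x : exists2 g : R, 0 < g &
  forall u s, `|u| <= g -> sorts_abs s (x + u) ->
  forall t : R, 0 <= t <= 1 ->
  sorts_abs s (x + t *: u) /\
  forall i, `|x i 0 + t * u i 0| = `|x i 0| + t * abs_slope x u i.
Proof.
have [g1 g10 g1P] := ex_pos_lower_bound (fun i => `|x i 0|).
have [g2 g20 g2P] :=
  ex_pos_lower_bound (fun ij : 'I_p * 'I_p => (`|x ij.1 0| - `|x ij.2 0|) / 2).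
exists (Num.min g1 g2); first by rewrite lt_min g10.
move=> u s; rewrite le_min => /andP[ug1 ug2] sxu.
have E (t : R) : 0 <= t <= 1 ->
    forall i, `|x i 0 + t * u i 0| = `|x i 0| + t * abs_slope x u i.
  move=> /andP[t0 t1] i; rewrite /abs_slope.
  have [->|x0] := eqVneq (x i 0) 0.
    by rewrite add0r normrM ger0_norm// normr0 add0r mulr0 add0r mulr1.
  rewrite mulr0 addr0 mulr1.
  have : `|t * u i 0| < `|x i 0|.
    apply: le_lt_trans (g1P i _); last by rewrite normr_gt0.
    apply: le_trans ug1; apply: le_trans (ler_coord_norm _ i).
    by rewrite normrM ger0_norm// ler_piMl.
  case: (ltrgt0P (x i 0)) x0 => // xi _; rewrite ltr_norml => /andP[h1 h2].
    by rewrite gtr0_sg// mulr1 ger0_norm//; lra.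
  by rewrite ltr0_sg// mulrN1 ler0_norm//; lra.
have s0 : sorts_abs s x.
  move=> i j ij; rewrite leNgt; apply/negP => lt_ij.
  have := g2P ((s^-1)%g j, (s^-1)%g i); rewrite /= => /(_ _).
  have h0 : 0 < (`|x ((s^-1)%g j) 0| - `|x ((s^-1)%g i) 0|) / 2.
    by rewrite divr_gt0// subr_gt0.
  move=> /(_ h0) h.
  have := sxu i j ij; apply/negP; rewrite -ltNge !mxE.
  have hi := le_trans (ler_coord_norm u ((s^-1)%g i)) ug2.
  have hj := le_trans (ler_coord_norm u ((s^-1)%g j)) ug2.
  have := ler_normD (x ((s^-1)%g i) 0) (u ((s^-1)%g i) 0).
  have := lerB_normD (x ((s^-1)%g j) 0) (u ((s^-1)%g j) 0).
  lra.
move=> t /[dup] t01 /andP[t0 t1]; split; last exact: E.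
move=> i j ij; have := s0 i j ij; have := sxu i j ij.
rewrite !mxE !E//.
have := E 1 _; rewrite ler01 lexx => /(_ isT) E1.
have := E1 ((s^-1)%g i); have := E1 ((s^-1)%g j); rewrite !mul1r => -> ->.
move: (`|_|) (`|_|) (abs_slope _ _ _) (abs_slope _ _ _) => a b c d h1 h2.
nra.
Qed.



(** The radius depends on [x] alone, so that it serves the weights of all sample sizes at once. *)
Lemma slope_norm_line x : exists2 g : R, 0 < g &
  forall u s, `|u| <= g -> sorts_abs s (x + u) -> forall t : R, 0 <= t <= 1 ->
  sorts_abs s (x + t *: u) /\ forall mu,
  slope_norm mu (x + t *: u) - slope_norm mu x = t * slope_dir_formula mu x u s.
Proof.
have [g g0 gP] := norm_sorted_line x; exists g => // u s ug sxu t t01.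
have [st Et] := gP u s ug sxu t t01; split => // mu.
have [] := gP u s ug sxu 0; first by rewrite lexx ler01.
rewrite scale0r addr0 => s0 _.
rewrite (slope_normE _ st) (slope_normE _ s0) slope_dir_formulaE -sumrB mulr_sumr.
by apply: eq_bigr => i _; rewrite !mxE Et; ring.
Qed.

End slope_norm_theory.

(** * Directional derivative of the SLOPE norm *)

Section slope_directional_derivative.
Context {R : realType} {p : nat}.
Implicit Types (b u lam mu : 'cV[R]_p) (s : 'S_p).

Lemma nat_sqrt_large (c : R) :
  exists2 N : nat, (0 < N)%N & forall n, (N <= n)%N -> c <= Num.sqrt n%:R.
Proof.
have [N cN] : exists N : nat, c ^+ 2 <= N%:R.
  exists (Num.bound (c ^+ 2)); apply: ltW.
  by apply: archi_boundP; exact: sqr_ge0.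
exists N.+1 => // n Nn.
rewrite (le_trans (ler_norm c))// -sqrtr_sqr ler_wsqrtr// (le_trans cN)//.
by rewrite ler_nat ltnW.
Qed.

Lemma norm_scaled_le u (r g : R) : 0 < r -> `|u| <= g * r -> `|r^-1 *: u| <= g.
Proof.
by move=> r0 ug; rewrite normrZ gtr0_norm ?invr_gt0// mulrC ler_pdivrMr.
Qed.

(** The quotient is constant for small t. Its value is found at a single n, large enough for the
    order and for u / sqrt n to lie in the ball of exact linearity. *)
Lemma diff_quotient_cvg lam b u s : eventually_sorts_abs s b u ->
  diff_quotient (slope_norm lam) b u t @[t --> 0^'+] -->
  slope_dir_formula lam b u s.
Proof.
move=> [M M0 sM]; have [g g0 gP] := slope_norm_line b.
have [N N0 NP] := nat_sqrt_large (g^-1 * `|u|).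
pose n := maxn M N.
have r0 : 0 < Num.sqrt n%:R :> R by rewrite sqrtr_gt0 ltr0n leq_max M0.
set r := Num.sqrt n%:R in r0.
have ur : `|r^-1 *: u| <= g.
  apply: norm_scaled_le => //; rewrite -ler_pdivrMl//.
  exact/NP/leq_maxr.
have sr : sorts_abs s (b + r^-1 *: u) by exact/sM/leq_maxl.
apply: cvg_near_cst; near=> t.
have t0 : 0 < t by [].
(* t u is the fraction t r of the vector u / r, on the segment once t <= 1 / r. *)
have tr : 0 <= t * r <= 1.
  rewrite (mulr_ge0 (ltW t0) (ltW r0))/= -ler_pdivlMr// mul1r.
  by near: t; apply: nbhs_right_le; rewrite invr_gt0.
have [_ /(_ lam)] := gP _ _ ur sr _ tr.
rewrite scalerA mulfK ?gt_eqF// slope_dir_formulaZ ?invr_ge0 ?ltW//.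
rewrite mulrA mulfK ?gt_eqF// /diff_quotient => ->.
by rewrite mulrAC mulfV ?gt_eqF// mul1r.
Unshelve. all: by end_near. Qed.

Lemma dir_derivE lam b u s : eventually_sorts_abs s b u ->
  dir_deriv (slope_norm lam) b u = slope_dir_formula lam b u s.
Proof. by move=> /(@diff_quotient_cvg lam) /cvg_lim; apply. Qed.

(** A permutation that sorts at one such n sorts at every k >= n, since u / sqrt k lies on the
    segment from 0 to u / sqrt n. *)
Lemma slope_increment b : exists2 g : R, 0 < g &
  forall u (n : nat), (0 < n)%N -> `|u| <= g * Num.sqrt n%:R ->
  exists2 s, eventually_sorts_abs s b u & forall mu,
  Num.sqrt n%:R * (slope_norm mu (b + (Num.sqrt n%:R)^-1 *: u) - slope_norm mu b)
    = slope_dir_formula mu b u s.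
Proof.
have [g g0 gP] := slope_norm_line b; exists g => // u n n0.
have r0 (k : nat) : (n <= k)%N -> 0 < Num.sqrt k%:R :> R.
  by move=> nk; rewrite sqrtr_gt0 ltr0n (leq_trans n0).
have rn0 := r0 n (leqnn n); have r0' := r0.
set r := Num.sqrt n%:R in rn0 *; move=> /(norm_scaled_le rn0) ug.
have [s sr] := ex_sorts_abs (b + r^-1 *: u); exists s.
  exists n => // k nk.
  have t01 : 0 <= r / Num.sqrt k%:R <= 1.
    rewrite divr_ge0 ?sqrtr_ge0//= ler_pdivrMr ?r0'// mul1r.
    by rewrite ler_wsqrtr// ler_nat.
  have [+ _] := gP _ _ ug sr _ t01.
  by rewrite scalerA mulrAC divff ?gt_eqF// mul1r.
move=> mu; have := gP _ _ ug sr 1; rewrite ler01 lexx => /(_ isT)[_ /(_ mu)].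
rewrite scale1r mul1r slope_dir_formulaZ ?invr_ge0 ?ltW// => ->.
by rewrite mulrA divff ?gt_eqF// mul1r.
Qed.

Lemma ex_eventually_sorts_abs b u : exists s, eventually_sorts_abs s b u.
Proof.
have [g g0 gP] := slope_increment b.
have [N N0 NP] := nat_sqrt_large (g^-1 * `|u|).
have [|s sE _] := gP u N N0; last by exists s.
by rewrite -ler_pdivrMl// NP.
Qed.

(** Increment and derivative use the same permutation, so the difference of the weights is the only
    source of error. *)
Lemma slope_increment_cvg b : exists2 g : R, 0 < g &
  forall lam mu u (n : nat), (0 < n)%N -> `|u| <= g * Num.sqrt n%:R ->
  `|Num.sqrt n%:R * (slope_norm mu (b + (Num.sqrt n%:R)^-1 *: u) - slope_norm mu b)
    - dir_deriv (slope_norm lam) b u| <= (\sum_(i < p) `|(mu - lam) i 0|) * `|u|.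
Proof.
have [g g0 gP] := slope_increment b; exists g => // lam mu u n n0 un.
have [s sE ->] := gP u n n0 un.
rewrite (dir_derivE lam sE) !slope_dir_formulaE -sumrB.
rewrite [X in _ <= X * _](reindex_inj (@perm_inj _ s)) mulr_suml/=.
apply: le_trans (ler_norm_sum _ _ _) _; apply: ler_sum => i _.
rewrite -mulrBl normrM !mxE ler_wpM2l//.
exact: le_trans (abs_slope_le _ _ _) (ler_coord_norm _ _).
Qed.

(** The derivative coincides with an increment at a large enough scale, so it inherits inequalities
    between finitely many points without a passage to the limit. *)
Lemma dir_deriv_near b : exists2 g : R, 0 < g &
  forall lam u (n : nat), (0 < n)%N -> `|u| <= g * Num.sqrt n%:R ->
  dir_deriv (slope_norm lam) b u =
  Num.sqrt n%:R * (slope_norm lam (b + (Num.sqrt n%:R)^-1 *: u) - slope_norm lam b).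
Proof.
have [g g0 gP] := slope_increment b; exists g => // lam u n n0 un.
by have [s sE ->] := gP u n n0 un; rewrite (dir_derivE lam sE).
Qed.

(** All that the minimization argument asks of a penalty; it holds for the increments at each n > 0
    and for the directional derivative alike. *)
Definition lipschitz_midconvex (L : R) (D : 'cV[R]_p -> R) :=
  [/\ 0 <= L, D 0 = 0, forall x y, `|D x - D y| <= L * `|x - y| &
   forall x y, D (2^-1 *: (x + y)) <= 2^-1 * (D x + D y)].

Lemma increment_lipschitz_midconvex lam b (r : R) : slope_weights lam -> 0 < r ->
  lipschitz_midconvex (\sum_(i < p) lam i 0)
    (fun u => r * (slope_norm lam (b + r^-1 *: u) - slope_norm lam b)).
Proof.
move=> lw r0; split.
- by apply: sumr_ge0 => i _; case: lw => _; exact.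
- by rewrite scaler0 addr0 subrr mulr0.
- move=> x y; rewrite -mulrBr opprB addrA subrK normrM gtr0_norm//.
  rewrite mulrC -ler_pdivlMr//.
  apply: le_trans (slope_norm_lipschitz _ _ lw) _.
  rewrite opprD addrACA subrr add0r -scalerBr normrZ gtr0_norm ?invr_gt0//.
  by rewrite mulrCA [leRHS]mulrC.
- move=> x y; rewrite -mulrDr mulrCA (ler_wpM2l (ltW r0))//.
  rewrite [leRHS](_ : _ = 2^-1 * (slope_norm lam (b + r^-1 *: x) +
    slope_norm lam (b + r^-1 *: y)) - slope_norm lam b); last by field.
  rewrite lerB//.
  rewrite (_ : b + _ = 2^-1 *: ((b + r^-1 *: x) + (b + r^-1 *: y))); last first.
    apply/matrixP => i j; rewrite !mxE; field.
    by rewrite gt_eqF.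
  by rewrite slope_normZ ger0_norm ?invr_ge0// ler_wpM2l ?invr_ge0// slope_normD.
Qed.

Lemma dir_deriv_lipschitz_midconvex lam b : slope_weights lam ->
  lipschitz_midconvex (\sum_(i < p) lam i 0) (dir_deriv (slope_norm lam) b).
Proof.
move=> lw; have [g g0 gP] := dir_deriv_near b.
have large (x y : 'cV[R]_p) : exists n : nat, [/\ (0 < n)%N,
    `|x| <= g * Num.sqrt n%:R & `|y| <= g * Num.sqrt n%:R].
  have [N1 N10 N1P] := nat_sqrt_large (g^-1 * `|x|).
  have [N2 N20 N2P] := nat_sqrt_large (g^-1 * `|y|).
  exists (maxn N1 N2); rewrite leq_max N10 -!ler_pdivrMl//; split => //.
    by apply: N1P; exact: leq_maxl.
  by apply: N2P; exact: leq_maxr.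
have pos (n : nat) : (0 < n)%N -> 0 < Num.sqrt n%:R :> R.
  by move=> n0; rewrite sqrtr_gt0 ltr0n.
split.
- by apply: sumr_ge0 => i _; case: lw => _; exact.
- have [n [n0 h _]] := large 0 0; rewrite (gP _ _ n n0 h).
  by case: (increment_lipschitz_midconvex b lw (pos n n0)).
- move=> x y; have [n [n0 hx hy]] := large x y; rewrite !(gP _ _ n n0)//.
  by case: (increment_lipschitz_midconvex b lw (pos n n0)).
- move=> x y; have [n [n0 hx hy]] := large x y; rewrite !(gP _ _ n n0)//.
    by case: (increment_lipschitz_midconvex b lw (pos n n0)).
  rewrite normrZ ger0_norm ?invr_ge0//.
  by have := ler_normD x y; lra.
Qed.

End slope_directional_derivative.

(** * Argmins of strongly convex objectives *)

Section quadratic_forms.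
Context {R : realType} {p : nat}.
Implicit Types (x y u v w : 'cV[R]_p) (M : 'M[R]_p).

Definition dot u w : R := (u^T *m w) 0 0.

Definition quad M u : R := (u^T *m M *m u) 0 0.

Lemma dotE u w : dot u w = \sum_(i < p) u i 0 * w i 0.
Proof. by rewrite /dot mxE; apply: eq_bigr => i _; rewrite mxE. Qed.

Lemma quadE M u : quad M u = \sum_(i < p) \sum_(j < p) u i 0 * M i j * u j 0.
Proof.
rewrite /quad -mulmxA mxE; apply: eq_bigr => i _.
by rewrite !mxE mulr_sumr; apply: eq_bigr => j _; rewrite mulrA.
Qed.

Lemma dotDl u v w : dot (u + v) w = dot u w + dot v w.
Proof. by rewrite !dotE -big_split; apply: eq_bigr => i _; rewrite mxE mulrDl. Qed.

Lemma dotZl (t : R) u w : dot (t *: u) w = t * dot u w.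
Proof. by rewrite !dotE mulr_sumr; apply: eq_bigr => i _; rewrite mxE mulrA. Qed.

Lemma dotBl u v w : dot (u - v) w = dot u w - dot v w.
Proof. by rewrite dotDl -scaleN1r dotZl mulN1r. Qed.

Lemma dotBr u v w : dot u (v - w) = dot u v - dot u w.
Proof. by rewrite !dotE -sumrB; apply: eq_bigr => i _; rewrite !mxE mulrBr. Qed.

Lemma dotZr (t : R) u w : dot u (t *: w) = t * dot u w.
Proof. by rewrite !dotE mulr_sumr; apply: eq_bigr => i _; rewrite mxE mulrCA. Qed.

Lemma dot0l w : dot 0 w = 0.
Proof. by rewrite -(scale0r 0) dotZl mul0r. Qed.

Lemma quad0 M : quad M 0 = 0.
Proof. by rewrite /quad trmx0 !mul0mx mxE. Qed.

Lemma quadZ (t : R) M u : quad M (t *: u) = t ^+ 2 * quad M u.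
Proof.
rewrite !quadE mulr_sumr; apply: eq_bigr => i _; rewrite mulr_sumr.
by apply: eq_bigr => j _; rewrite !mxE; ring.
Qed.

Lemma quad_midpoint M x y : quad M (2^-1 *: (x + y)) =
  2^-1 * (quad M x + quad M y) - 4^-1 * quad M (x - y).
Proof.
rewrite !quadE -big_split mulr_sumr mulr_sumr -sumrB; apply: eq_bigr => i _.
rewrite /= -big_split mulr_sumr mulr_sumr -sumrB; apply: eq_bigr => j _.
by rewrite /= !mxE; field.
Qed.

Lemma norm_dot_le u w : `|dot u w| <= p%:R * `|u| * `|w|.
Proof.
rewrite dotE (le_trans (ler_norm_sum _ _ _))// -mulrA -[p in p%:R]card_ord.
rewrite -sumr_const mulr_suml.
by apply: ler_sum => i _; rewrite mul1r normrM ler_pM ?ler_coord_norm.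
Qed.

Lemma norm_quad_le M u (e : R) : (forall i j, `|M i j| <= e) ->
  `|quad M u| <= p%:R ^+ 2 * e * `|u| ^+ 2.
Proof.
move=> Me; rewrite quadE (le_trans (ler_norm_sum _ _ _))//.
have -> : p%:R ^+ 2 * e * `|u| ^+ 2 = \sum_(i < p) \sum_(j < p) (`|u| * e * `|u|).
  rewrite !sumr_const card_ord -mulrnA -[RHS]mulr_natl natrM; ring.
apply: ler_sum => i _; rewrite (le_trans (ler_norm_sum _ _ _))//.
apply: ler_sum => j _; rewrite !normrM.
by rewrite !ler_pM ?mulr_ge0 ?ler_coord_norm.
Qed.

Lemma quadB M M' u : quad (M - M') u = quad M u - quad M' u.
Proof.
rewrite !quadE -sumrB; apply: eq_bigr => i _; rewrite -sumrB.
by apply: eq_bigr => j _; rewrite !mxE; ring.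
Qed.

Lemma continuous_dot w : continuous (dot ^~ w).
Proof.
rewrite (_ : dot ^~ w = (fun u => \sum_(i < p) u i 0 * w i 0)); last first.
  by apply/funext => u; rewrite dotE.
apply: continuous_big => [|i _ u]; first exact: add_continuous.
apply: (@continuousM R _ (fun v => v i 0) (fun=> w i 0)).
  exact: coord_continuous.
exact: cst_continuous.
Qed.

Lemma continuous_quad M : continuous (quad M).
Proof.
rewrite (_ : quad M = (fun u => \sum_(i < p) \sum_(j < p) u i 0 * M i j * u j 0)).
  apply: continuous_big => [|i _]; first exact: add_continuous.
  apply: continuous_big => [|j _ u]; first exact: add_continuous.
  apply: (@continuousM R _ (fun v => v i 0 * M i j) (fun v => v j 0)).
    apply: (@continuousM R _ (fun v => v i 0) (fun=> M i j)).
      exact: coord_continuous.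
    exact: cst_continuous.
  exact: coord_continuous.
by apply/funext => u; rewrite quadE.
Qed.

Lemma norm_trmx_le m n (x : 'M[R]_(m, n)) : `|x^T| <= `|x|.
Proof.
rewrite [leLHS]/normr [leRHS]/normr/= !mx_normrE.
apply/bigmax_leP; split => [|[i j] _]; first exact: bigmax_ge_id.
by rewrite mxE/=; apply/bigmax_geP; right; exists (j, i).
Qed.

Lemma lipschitz_continuous (V W : normedModType R) (f : V -> W) (L : R) :
  (forall a b : V, `|f a - f b| <= L * `|a - b|) -> continuous f.
Proof.
move=> fL x; apply/cvgrPdist_lt => e e0; near=> y.
rewrite (le_lt_trans (fL x y))//.
have L0 : 0 < `|L| + 1 by rewrite ltr_wpDl.
have xy : `|x - y| < e / (`|L| + 1).
  by near: y; apply: cvgr_dist_lt; rewrite ?divr_gt0.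
apply: le_lt_trans (_ : (`|L| + 1) * `|x - y| < _).
  by rewrite ler_wpM2r// (le_trans (ler_norm L))// lerDl.
by rewrite mulrC -ltr_pdivlMr.
Unshelve. all: by end_near. Qed.

Lemma continuous_trmx m n : continuous (@trmx R m n).
Proof.
apply: (@lipschitz_continuous _ _ _ 1) => x y.
by rewrite mul1r -linearB norm_trmx_le.
Qed.

(** Transposition is 1-Lipschitz and carries compactness from row vectors to column vectors. *)
Lemma compact_cV (A : set 'cV[R]_p) (r : R) :
  closed A -> (forall x, A x -> `|x| <= r) -> compact A.
Proof.
move=> cA Ar.
have -> : A = trmx @` (trmx @^-1` A).
  apply/seteqP; split => [x Ax|_ [x Ax <-]//].
  by exists x^T; rewrite /= trmxK.
apply: continuous_compact.
  by apply: continuous_subspaceT; exact: continuous_trmx.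
apply: bounded_closed_compact.
  exists r; split; first exact: num_real.
  move=> s rs x /= /Ar; rewrite -{2}(trmxK x) => xr.
  by rewrite (le_trans (norm_trmx_le _))// (le_trans xr)// ltW.
by apply: closed_comp => // x _; exact: continuous_trmx.
Qed.

(** The constant is the minimum of the form on the unit sphere, positive because it is attained;
    homogeneity extends the bound. *)
Lemma pos_def_lower_bound M : pos_def M ->
  exists2 c : R, 0 < c & forall v, c * `|v| ^+ 2 <= quad M v.
Proof.
move=> [_ Mpos].
pose S := [set v : 'cV[R]_p | `|v| = 1].
have unit v : v != 0 -> S (`|v|^-1 *: v).
  by move=> v0; rewrite /S/= normrZ ger0_norm ?invr_ge0// mulVf// normr_eq0.
have [S0|/set0P/negP/negPn/eqP S0] := pselect (S !=set0).
  have cS : compact S.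
    apply: (@compact_cV _ 1) => [|x ->//].
    have -> : S = normr @^-1` [set 1] by [].
    by apply: closed_comp => [x _|]; [exact: norm_continuous|exact: closed_eq].
  have [c cS0 cmin] := @compact_EVT_min _ _ (quad M) _ S0 cS
    (continuous_subspaceT (@continuous_quad M)).
  rewrite inE in cS0.
  have c0 : c != 0 by apply/eqP => c0; move: cS0; rewrite /S/= c0 normr0 => /esym/eqP; rewrite oner_eq0.
  exists (quad M c); first exact: Mpos.
  move=> v; have [->|v0] := eqVneq v 0; first by rewrite normr0 expr0n mulr0 quad0.
  have := cmin _ (mem_set (unit v v0)); rewrite quadZ exprVn.
  by rewrite mulrC ler_pdivlMr ?exprn_gt0 ?normr_gt0.
(* The sphere is empty when p = 0; then 0 is the only vector. *)
exists 1 => // v; have [->|v0] := eqVneq v 0.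
  by rewrite normr0 expr0n mulr0 quad0.
by have := unit v v0; rewrite S0.
Qed.

End quadratic_forms.

(** * Growth, existence and stability of minimizers *)

Section strongly_convex_argmin.
Context {R : realType} {p : nat}.
Implicit Types (x y u v w : 'cV[R]_p) (M : 'M[R]_p) (D : 'cV[R]_p -> R).

Definition quad_objective M D w u : R := 2^-1 * quad M u - dot u w + D u.

Definition coercive M (c : R) := forall v, c * `|v| ^+ 2 <= quad M v.

Lemma argmin_growth M c D L w u0 u : coercive M c -> lipschitz_midconvex L D ->
  argmin (quad_objective M D w) u0 ->
  c / 4 * `|u - u0| ^+ 2 <= quad_objective M D w u - quad_objective M D w u0.
Proof.
move=> Mc [_ _ _ Dmid] u0min.
have := u0min (2^-1 *: (u + u0)); rewrite /quad_objective.
have := Dmid u u0; have := Mc (u - u0).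
rewrite quad_midpoint dotZl dotDl; lra.
Qed.

(** Growth at u = 0, where the objective vanishes, bounds c / 4 |u0|^2 by the terms of linear
    growth. The factor p appears because the norm is the maximum norm. *)
Lemma argmin_bound M c D L w u0 : 0 < c -> coercive M c -> lipschitz_midconvex L D ->
  argmin (quad_objective M D w) u0 -> `|u0| <= 4 * (p%:R * `|w| + L) / c.
Proof.
move=> c0 Mc DL u0min.
have := argmin_growth 0 Mc DL u0min; rewrite sub0r normrN.
have := u0min 0; case: DL => L0 D0 DL _.
have := DL u0 0; rewrite D0 !subr0 => h1.
have := norm_dot_le u0 w.
rewrite /quad_objective quad0 dot0l D0.
have := Mc u0.
have [->|u00] := eqVneq u0 0.
  move=> _ _ _ _; rewrite normr0; apply: divr_ge0; last exact: ltW.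
  by apply: mulr_ge0 => //; apply: addr_ge0 => //; exact: mulr_ge0.
have nu0 : 0 < `|u0| by rewrite normr_gt0.
rewrite ler_pdivlMr// => h2 h3 h4 h5.
rewrite -(ler_pM2r nu0).
move: h1 h3; rewrite !ler_norml => /andP[h1 _] /andP[_ h3].
have := mulr_ge0 (ltW c0) (sqr_ge0 `|u0|); lra.
Qed.

Lemma argmin_exists M c D L w : 0 < c -> coercive M c -> lipschitz_midconvex L D ->
  argmin (quad_objective M D w) !=set0.
Proof.
move=> c0 Mc [L0 D0 DL _].
(* Beyond this radius c / 2 |u|^2 outweighs (p |w| + L) |u|, so the objective exceeds its value 0 at
   the origin. *)
pose r := 2 * (p%:R * `|w| + L) / c.
have r0 : 0 <= r by rewrite divr_ge0 ?(ltW c0)// mulr_ge0// addr_ge0// mulr_ge0.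
pose S := [set u : 'cV[R]_p | `|u| <= r].
have cS : compact S.
  apply: (@compact_cV _ _ _ r) => //.
  have -> : S = normr @^-1` [set x | x <= r] by [].
  by apply: closed_comp => [x _|]; [exact: norm_continuous|exact: closed_le].
have cV : continuous (quad_objective M D w).
  move=> u; apply: (@continuousD _ _ _ (fun v => 2^-1 * quad M v - dot v w) D).
    apply: (@continuousB _ _ _ (fun v => 2^-1 * quad M v) (dot ^~ w)).
      apply: (@continuousM R _ (fun=> 2^-1) (quad M)); first exact: cst_continuous.
      exact: continuous_quad.
    exact: continuous_dot.
  exact: (lipschitz_continuous DL).
have S0 : S 0 by rewrite /S/= normr0.
have [u0 _ u0min] := @compact_EVT_min _ _ _ S (ex_intro _ 0 S0) cS
  (continuous_subspaceT cV).
exists u0 => u; have [ur|ur] := leP `|u| r; first by apply: u0min; rewrite inE.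
apply: le_trans (u0min 0 (mem_set S0)) _.
rewrite /quad_objective quad0 dot0l D0 mulr0 subr0 addr0.
move: ur; rewrite /r ltr_pdivrMr// => ur.
have nu0 : 0 <= `|u| by [].
have := Mc u; have := norm_dot_le u w; have := DL u 0; rewrite D0 !subr0.
rewrite !ler_norml => /andP[h1 _] /andP[_ h2] h3.
have : `|u| * (2 * (p%:R * `|w| + L)) <= `|u| * (`|u| * c) by rewrite ler_wpM2l// ltW.
lra.
Qed.

(** The growth of each objective is evaluated at the minimizer of the other. In the sum of the two
    inequalities the linear terms cancel and the objectives enter only through their difference at
    two points, at most 2 e in all. *)
Lemma argmin_stable M M' c D D' L L' w u0 u0' (r e : R) :
  0 < c -> coercive M c -> coercive M' c ->
  lipschitz_midconvex L D -> lipschitz_midconvex L' D' ->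
  argmin (quad_objective M D w) u0 -> argmin (quad_objective M' D' w) u0' ->
  `|u0| <= r -> `|u0'| <= r ->
  (forall u, `|u| <= r ->
     `|2^-1 * quad M u + D u - (2^-1 * quad M' u + D' u)| <= e) ->
  `|u0 - u0'| ^+ 2 <= 4 * e / c.
Proof.
move=> c0 Mc M'c DL DL' m m' r0 r0' He.
have := argmin_growth u0' Mc DL m; have := argmin_growth u0 M'c DL' m'.
have := He _ r0; have := He _ r0'; rewrite !ler_norml /quad_objective.
rewrite ler_pdivlMr// (distrC u0').
by move=> /andP[h1 h2] /andP[h3 h4] h5 h6; lra.
Qed.

(** In the sum of the two growth inequalities only [dot (u0 - u0') (w - w')] survives. *)
Lemma argmin_lipschitz M c D L w w' u0 u0' :
  0 < c -> coercive M c -> lipschitz_midconvex L D ->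
  argmin (quad_objective M D w) u0 -> argmin (quad_objective M D w') u0' ->
  `|u0 - u0'| <= 2 * p%:R / c * `|w - w'|.
Proof.
move=> c0 Mc DL m m'.
have := argmin_growth u0' Mc DL m; have := argmin_growth u0 Mc DL m'.
rewrite /quad_objective (distrC u0').
have := norm_dot_le (u0 - u0') (w - w'); rewrite dotBl !dotBr.
have [->|u00] := eqVneq u0 u0'.
  by move=> _ _ _; rewrite subrr normr0 !mulr_ge0// invr_ge0 ltW.
have nu0 : 0 < `|u0 - u0'| by rewrite normr_gt0 subr_eq0.
rewrite ler_norml => /andP[_ h1] h2 h3.
rewrite mulrAC ler_pdivlMr// -(ler_pM2r nu0).
lra.
Qed.

Lemma argmin_map M c D L : 0 < c -> coercive M c -> lipschitz_midconvex L D ->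
  exists F : 'cV[R]_p -> 'cV[R]_p,
    (forall w, argmin (quad_objective M D w) = [set F w]) /\ continuous F.
Proof.
move=> c0 Mc DL; pose F w := xget 0 (argmin (quad_objective M D w)).
have Fmin w : argmin (quad_objective M D w) (F w).
  by apply: xgetPex; exact: argmin_exists c0 Mc DL.
have FL w w' u u' : argmin (quad_objective M D w) u ->
    argmin (quad_objective M D w') u' -> _ := @argmin_lipschitz M c D L w w' u u' c0 Mc DL.
exists F; split => [w|]; last first.
  apply: (@lipschitz_continuous _ _ _ _ (2 * p%:R / c)) => w w'.
  exact: FL.
apply/seteqP; split => [u um|_ ->]; last exact: Fmin.
(* Uniqueness is the Lipschitz bound with equal linear terms. *)
have := FL w w u (F w) um (Fmin w).
by rewrite subrr normr0 mulr0 normr_le0 subr_eq0 => /eqP.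
Qed.

End strongly_convex_argmin.

(** * Independence *)

Section independent_sigma_algebras.
Context d (T : measurableType d) (R : realType) (P : probability T R).
Implicit Types G H : set_system T.

Lemma sub_g_sigma_measurable G : G `<=` measurable -> <<s G >> `<=` measurable.
Proof. by move=> Gm; apply: smallest_sub => //; exact: sigma_algebra_measurable. Qed.

(** For fixed [B], both sides are finite measures in [A] that agree on a generating family stable
    under intersection. *)
Lemma independent2_sigma_l G (B : set T) :
  setI_closed G -> G `<=` measurable -> G setT -> measurable B ->
  (forall A, G A -> P (A `&` B) = (P A * P B)%E) ->
  forall A, <<s G >> A -> P (A `&` B) = (P A * P B)%E.
Proof.
move=> GI Gm GT mB GB A sA.
have PB : P B = (fine (P B))%:E by rewrite fineK// fin_num_measure.
have PB0 : 0 <= fine (P B) by rewrite fine_ge0.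
have cover : \bigcup_(k : nat) [set: T] = setT.
  by rewrite bigcup_const//; exists 0%N.
have := @g_sigma_algebra_measure_unique _ R T G Gm (fun=> setT) (fun=> GT) cover
  (mrestr P mB) (mscale (NngNum PB0) P) GI.
move=> /(_ _ _ A sA).
rewrite /mrestr/= /mscale/= -PB muleC; apply => [A' GA'|_].
  by rewrite -[LHS]/(P (A' `&` B)) GB// muleC.
by rewrite -[X in (X < _)%E]/(P (setT `&` B)) setTI PB ltry.
Qed.

Lemma independent2_sigma G H :
  setI_closed G -> setI_closed H -> G `<=` measurable -> H `<=` measurable ->
  G setT -> H setT -> independent2 P G H -> independent2 P <<s G >> <<s H >>.
Proof.
move=> GI HI Gm Hm GT HT GH A B sA sB.
have mA := sub_g_sigma_measurable Gm sA.
rewrite setIC muleC; apply: independent2_sigma_l sB => // B' HB'.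
rewrite setIC muleC; apply: independent2_sigma_l sA => // [|A' GA'].
  exact: Hm.
exact: GH.
Qed.

End independent_sigma_algebras.

(** * Joint laws of independent variables *)

Section product_law.
Context d (T : measurableType d) (R : realType) (P : probability T R).
Context d1 (T1 : measurableType d1) d2 (T2 : measurableType d2).

Definition indep_fun (U : T -> T1) (V : T -> T2) := forall A B,
  measurable A -> measurable B ->
  P (U @^-1` A `&` V @^-1` B) = (P (U @^-1` A) * P (V @^-1` B))%E.

Variables (U : {mfun T >-> T1}) (V : {mfun T >-> T2}).
Hypothesis UV : indep_fun U V.

Lemma measurable_fun_joint : measurable_fun setT (fun w => (U w, V w)).
Proof. by apply/measurable_fun_pairP; split; exact: measurable_funPT. Qed.

Definition joint : {mfun T >-> (T1 * T2)%type} :=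
  mfun_Sub (mem_set measurable_fun_joint).

Lemma joint_law D : measurable D ->
  distribution P joint D = (distribution P U \x distribution P V)%E D.
Proof.
by move=> mD; rewrite (@product_measure_unique _ _ _ _ _ _ _ (distribution P joint)).
Qed.

Lemma integral_joint_law (f : T1 * T2 -> \bar R) :
  (\int[distribution P joint]_z f z =
   \int[distribution P U \x distribution P V]_z f z)%E.
Proof. by apply: eq_measure_integral => A mA _; exact: joint_law. Qed.

(** Tonelli on absolute values gives integrability under the product law and Fubini splits the
    integral; independence identifies the product law with the joint law. *)
Lemma indep_mul_integrable (f : T1 -> R) (g : T2 -> R) :
  measurable_fun setT f -> measurable_fun setT g ->
  P.-integrable setT (EFin \o (f \o U)) -> P.-integrable setT (EFin \o (g \o V)) ->
  P.-integrable setT (EFin \o (fun w => f (U w) * g (V w))) /\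
  \int[P]_w (f (U w) * g (V w)) = (\int[P]_w f (U w)) * \int[P]_w g (V w).
Proof.
move=> mf mg iU iV.
have mfg : measurable_fun [set: T1 * T2] (EFin \o (fun z => f z.1 * g z.2)).
  apply/measurable_EFinP; apply: measurable_funM.
    exact: (measurableT_comp mf measurable_fst).
  exact: (measurableT_comp mg measurable_snd).
pose a := (\int[P]_w `|(f (U w))%:E|)%E; pose b := (\int[P]_w `|(g (V w))%:E|)%E.
have aoo : (a < +oo)%E by case/integrableP : iU.
have boo : (b < +oo)%E by case/integrableP : iV.
have a_fin : a \is a fin_num by rewrite ge0_fin_numE// integral_ge0.
have b_fin : b \is a fin_num by rewrite ge0_fin_numE// integral_ge0.
have mf' : measurable_fun setT (EFin \o f) by exact/measurable_EFinP.
have mg' : measurable_fun setT (EFin \o g) by exact/measurable_EFinP.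
have mfa : measurable_fun setT (abse \o (EFin \o f)) by exact: measurableT_comp mf'.
have mga : measurable_fun setT (abse \o (EFin \o g)) by exact: measurableT_comp mg'.
have aE : (\int[distribution P U]_x `|(f x)%:E| = a)%E.
  by rewrite ge0_integral_distribution.
have bE : (\int[distribution P V]_x `|(g x)%:E| = b)%E.
  by rewrite ge0_integral_distribution.
have iterE : (\int[distribution P U]_x \int[distribution P V]_y
    `|(f x * g y)%:E| = a * b)%E.
  under eq_integral => x _.
    under eq_integral => y _ do rewrite EFinM abseM.
    rewrite ge0_integralZl//=.
    over.
  rewrite /= ge0_integralZr//=; last exact: integral_ge0.
  by rewrite aE bE.
have iprod : (distribution P U \x distribution P V)%E.-integrable setT
    (EFin \o (fun z => f z.1 * g z.2)).
  apply/integrable12ltyP => //.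
  by rewrite /= iterE -(fineK a_fin) -(fineK b_fin) -EFinM ltry.
have iUV : P.-integrable setT (EFin \o (fun w => f (U w) * g (V w))).
  apply/integrableP; split.
    exact: (measurableT_comp mfg measurable_fun_joint).
  have := @ge0_integral_distribution _ _ _ _ _ P joint
    (fun z => `|(f z.1 * g z.2)%:E|%E) (measurableT_comp _ mfg) _.
  rewrite integral_joint_law /= => <-//.
  by case/integrableP : iprod.
split=> //; rewrite /Rintegral.
have -> : (\int[P]_w (f (U w) * g (V w))%:E =
    \int[distribution P joint]_z (f z.1 * g z.2)%:E)%E.
  by rewrite integral_distribution.
rewrite integral_joint_law.
have iU' : (\int[distribution P U]_x (f x)%:E = \int[P]_w (f (U w))%:E)%E.
  by rewrite integral_distribution.
have iV' : (\int[distribution P V]_x (g x)%:E = \int[P]_w (g (V w))%:E)%E.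
  by rewrite integral_distribution.
have inU : (distribution P U).-integrable setT (EFin \o f).
  by apply/integrableP; split => //; rewrite aE.
have inV : (distribution P V).-integrable setT (EFin \o g).
  by apply/integrableP; split => //; rewrite bE.
rewrite -(integral12_prod_meas1 iprod) /fubini_F/=.
under eq_integral => x _.
  under eq_integral => y _ do rewrite EFinM.
  rewrite integralZl//=.
  rewrite iV' -(fineK (integrable_fin_num measurableT iV)).
  over.
rewrite integralZr//= iU' -{1}(fineK (integrable_fin_num measurableT iU)).
by rewrite -EFinM.
Qed.

End product_law.

Lemma eq_joint_law d (T : measurableType d) (R : realType) (P : probability T R)
    d1 (T1 : measurableType d1) d2 (T2 : measurableType d2)
    (U U' : {mfun T >-> T1}) (V V' : {mfun T >-> T2}) :
  indep_fun P U V -> indep_fun P U' V' ->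
  (forall A, measurable A -> distribution P U' A = distribution P U A) ->
  (forall A, measurable A -> distribution P V' A = distribution P V A) ->
  forall D, measurable D ->
    distribution P (joint U' V') D = distribution P (joint U V) D.
Proof.
move=> UV UV' eU eV D mD; rewrite (joint_law UV mD).
rewrite (@product_measure_unique _ _ _ _ _ _ _ (distribution P (joint U' V')))//.
move=> A B mA mB.
transitivity (distribution P U' A * distribution P V' B)%E; first exact: UV'.
by congr (_ * _)%E; [exact: eU|exact: eV].
Qed.

(** * Real integrals on a probability space *)

Section raw_laws.
Context d (T : measurableType d) (R : realType) (P : probability T R).

Lemma Rintegral_probability_cst (c : R) : \int[P]_(w in [set: T]) c = c.
Proof. by rewrite Rintegral_cst// [X in fine X](probability_setT P) mulr1. Qed.

Lemma bounded_integrable (f : T -> R) (M : R) : measurable_fun setT f ->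
  (forall w, `|f w| <= M) -> P.-integrable setT (EFin \o f).
Proof.
move=> mf fM; apply: measurable_bounded_integrable => //.
  by apply: le_lt_trans (probability_le1 P _) _ => //; exact: ltry.
by exists M; split; [exact: num_real|move=> x Mx y _; exact: le_trans (fM y) (ltW Mx)].
Qed.

Definition rint (f : T -> R) := P.-integrable setT (EFin \o f).

Lemma rint_measurable f : rint f -> measurable_fun setT f.
Proof. by move=> /measurable_int/measurable_EFinP. Qed.

Lemma rint_cst c : rint (fun=> c).
Proof. exact: (@bounded_integrable _ `|c|). Qed.

Lemma rintD f g : rint f -> rint g -> rint (fun w => f w + g w).
Proof. by move=> fi gi; have := integrableD measurableT fi gi. Qed.

Lemma rintB f g : rint f -> rint g -> rint (fun w => f w - g w).
Proof. by move=> fi gi; have := integrableB measurableT fi gi. Qed.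

Lemma rintZ a f : rint f -> rint (fun w => a * f w).
Proof. by move=> fi; have := integrableZl measurableT a fi. Qed.

Lemma rint_norm f : rint f -> rint (fun w => `|f w|).
Proof. by move=> fi; have := integrable_norm fi. Qed.

Lemma rint_sum (I : finType) (f : I -> T -> R) :
  (forall i, rint (f i)) -> rint (fun w => \sum_i f i w).
Proof.
move=> fi; rewrite (_ : (fun w => _) = (\sum_i f i)); last first.
  by apply/funext => w; rewrite fct_sumE.
elim/big_ind : _ => [|f1 f2 h1 h2|i _]; [exact: rint_cst|exact: rintD|exact: fi].
Qed.

Lemma Rintegral_add f g : rint f -> rint g ->
  \int[P]_w (f w + g w) = \int[P]_w f w + \int[P]_w g w.
Proof. by move=> fi gi; rewrite RintegralD. Qed.

Lemma Rintegral_sub f g : rint f -> rint g ->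
  \int[P]_w (f w - g w) = \int[P]_w f w - \int[P]_w g w.
Proof. by move=> fi gi; rewrite RintegralB. Qed.

Lemma Rintegral_scale a f : rint f -> \int[P]_w (a * f w) = a * \int[P]_w f w.
Proof. by move=> fi; rewrite RintegralZl. Qed.

Lemma Rintegral_finsum (I : finType) (f : I -> T -> R) :
  (forall i, rint (f i)) -> \int[P]_w (\sum_i f i w) = \sum_i \int[P]_w f i w.
Proof.
move=> fi; suff [] : rint (\sum_i f i) /\
    \int[P]_w (\sum_i f i) w = \sum_i \int[P]_w f i w.
  by move=> _ <-; apply: eq_Rintegral => w _; rewrite fct_sumE.
elim/big_ind2 : _ => [|f1 x1 f2 x2 [h1 <-] [h2 <-]|i _].
- by split; [exact: rint_cst|exact: Rintegral_probability_cst].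
- by split; [exact: rintD|exact: Rintegral_add].
- by split; [exact: fi|].
Qed.

Lemma Rintegral_le f g : rint f -> rint g -> (forall w, f w <= g w) ->
  \int[P]_w f w <= \int[P]_w g w.
Proof. by move=> fi gi fg; apply: le_Rintegral. Qed.

Lemma norm_Rintegral_le f g : rint f -> rint g -> (forall w, `|f w| <= g w) ->
  `|\int[P]_w f w| <= \int[P]_w g w.
Proof.
move=> fi gi fg; rewrite (le_trans (le_normr_Rintegral _ fi))//.
by apply: Rintegral_le => //; exact: rint_norm.
Qed.

Lemma indep_mul d1 (T1 : measurableType d1) d2 (T2 : measurableType d2)
    (U : T -> T1) (V : T -> T2) (f : T1 -> R) (g : T2 -> R) :
  measurable_fun setT U -> measurable_fun setT V -> indep_fun P U V ->
  measurable_fun setT f -> measurable_fun setT g ->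
  rint (fun w => f (U w)) -> rint (fun w => g (V w)) ->
  rint (fun w => f (U w) * g (V w)) /\
  \int[P]_w (f (U w) * g (V w)) = (\int[P]_w f (U w)) * \int[P]_w g (V w).
Proof.
move=> mU mV UV.
exact: (@indep_mul_integrable _ _ _ _ _ _ _ _
  (mfun_Sub (mem_set mU)) (mfun_Sub (mem_set mV)) UV).
Qed.

Lemma eq_law_integral d1 (T1 : measurableType d1) (U V : T -> T1) (f : T1 -> R) :
  measurable_fun setT U -> measurable_fun setT V ->
  (forall A, measurable A -> P (U @^-1` A) = P (V @^-1` A)) ->
  measurable_fun setT f -> rint (fun w => f (V w)) ->
  rint (fun w => f (U w)) /\
  \int[P]_w f (U w) = \int[P]_w f (V w).
Proof.
move=> mU mV UV mf iV.
pose U' : {mfun T >-> T1} := mfun_Sub (mem_set mU).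
pose V' : {mfun T >-> T1} := mfun_Sub (mem_set mV).
have UV' (g : T1 -> \bar R) :
    (\int[distribution P U']_x g x = \int[distribution P V']_x g x)%E.
  by apply: eq_measure_integral => A mA _; exact: UV.
have mf' : measurable_fun setT (EFin \o f) by exact/measurable_EFinP.
have mfa : measurable_fun setT (abse \o (EFin \o f)) by exact: measurableT_comp mf'.
have iU : P.-integrable setT (EFin \o (f \o U)).
  apply/integrableP; split; first exact: (measurableT_comp mf' mU).
  have := @ge0_integral_distribution _ _ _ _ _ P U' _ mfa (fun=> abse_ge0 _).
  rewrite UV' (ge0_integral_distribution _ mfa)//= => <-.
  by case/integrableP : iV.
split=> //; rewrite /Rintegral; congr fine.
have := @integral_distribution _ _ _ _ _ P U' _ mf' iU.
by rewrite UV' integral_distribution//= => ->.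
Qed.

Lemma Rintegral_cvg0 (g : nat -> T -> R) (G : T -> R) :
  (forall n, measurable_fun setT (g n)) ->
  rint G -> (forall n w, `|g n w| <= G w) ->
  (forall w, g ^~ w @ \oo --> (0 : R)) ->
  \int[P]_w g n w @[n --> \oo] --> (0 : R).
Proof.
move=> mg iG gG g0.
have mg' n : measurable_fun setT (EFin \o g n) by exact/measurable_EFinP.
have := @dominated_cvg _ _ _ P setT measurableT (fun n => EFin \o g n) (cst 0%E)
  (EFin \o G) mg'.
rewrite integral0 => /(_ _ _ iG _) h.
have {h} : (\int[P]_w (g n w)%:E)%E @[n --> \oo] --> 0%E.
  apply: h => //= [x _|n x _]; last by rewrite lee_fin.
  by apply: cvg_EFin; [exact: nearW|exact: g0].
move=> /fine_cvg; exact.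
Qed.

End raw_laws.

(** * The scalar central limit theorem and law of large numbers *)

Section trigonometric_bounds.
Context {R : realType}.
Implicit Types x : R.

Lemma norm_sin_le x : `|sin x| <= `|x|.
Proof.
wlog x0 : x / 0 <= x.
  move=> h; have [/h//|/ltW x0] := leP 0 x.
  by rewrite -normrN -sinN -(normrN x) h// oppr_ge0.
have [|c _] := @MVT_segment R sin cos 0 x x0 (fun y _ => is_derive_sin y).
  by apply: continuous_subspaceT; exact: continuous_sin.
by rewrite sin0 !subr0 => ->; rewrite normrM ler_piMl// cos_max.
Qed.

Lemma one_sub_cos x : 1 - cos x = 2 * sin (x / 2) ^+ 2.
Proof.
have {1}-> : x = (x / 2) *+ 2 by rewrite -mulr_natr; field.
by rewrite cos_mulr2n cos2sin2 -mulr_natr; ring.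
Qed.

Lemma one_sub_cos_ge0 x : 0 <= 1 - cos x.
Proof. by rewrite subr_ge0 cos_le1. Qed.

Lemma one_sub_cos_le_sqr x : 1 - cos x <= x ^+ 2 / 2.
Proof.
rewrite one_sub_cos.
have : sin (x / 2) ^+ 2 <= (x / 2) ^+ 2.
  by rewrite -real_normK ?num_real// -[leRHS]real_normK ?num_real// lerXn2r ?nnegrE// norm_sin_le.
by rewrite exprMn; lra.
Qed.

(** The minimum of 2 and x^2 / 2 is at most their geometric mean |x|. Linear growth is what a first
    moment can dominate. *)
Lemma one_sub_cos_le x : 1 - cos x <= `|x|.
Proof.
have := one_sub_cos_le_sqr x; have := cos_geN1 x.
rewrite -[x ^+ 2]real_normK ?num_real//.
by have : 0 <= `|x| by []; nra.
Qed.

Lemma norm_sin_sub_cube x : `|sin x - x| <= `|x| ^+ 3 / 2.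
Proof.
wlog x0 : x / 0 <= x.
  move=> h; have [/h//|/ltW x0] := leP 0 x.
  have -> : sin x - x = - (sin (- x) - - x) by rewrite sinN; ring.
  by rewrite normrN -(normrN x) h// oppr_ge0.
have der (y : R) : y \in `]0, x[ -> is_derive y 1 (fun z => sin z - z) (cos y - 1).
  by move=> _; apply: is_deriveB.
have cont : {within `[0, x], continuous (fun z : R => sin z - z)}.
  apply: continuous_subspaceT => y.
  by apply: (@continuousB _ _ _ sin id); [exact: continuous_sin|exact: cvg_id].
have [c] := MVT_segment x0 der cont.
rewrite in_itv/= => /andP[c0 cx].
rewrite sin0 !subr0 => ->; rewrite normrM exprSr mulrAC ler_wpM2r//.
rewrite -normrN opprB ger0_norm ?one_sub_cos_ge0//.
rewrite (le_trans (one_sub_cos_le_sqr c))// ler_pM2r// real_normK ?num_real//.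
by rewrite lerXn2r.
Qed.

Lemma norm_sin_sub_le x : `|sin x - x| <= 2 * `|x|.
Proof.
by rewrite (le_trans (ler_normB _ _))// mulrDl !mul1r lerD2r norm_sin_le.
Qed.

(** Interpolates between 2 |x| for large x and |x|^3 / 2 for small x. Quadratic growth is what a
    second moment can dominate. *)
Lemma norm_sin_sub_sqr x : `|sin x - x| <= x ^+ 2.
Proof.
have := norm_sin_sub_cube x; have := norm_sin_sub_le x.
rewrite -[x ^+ 2]real_normK ?num_real//.
have : 0 <= `|x| by [].
move: `|x| => y y0 h1 h2.
have [y2|y2] := leP 2 y.
  by rewrite (le_trans h1)// expr2 ler_wpM2r.
rewrite (le_trans h2)// exprS mulrAC ler_piMl ?exprn_ge0//.
by rewrite ler_pdivrMr// mul1r ltW.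
Qed.

Lemma cos_taylor2_ge0 x : 0 <= cos x - 1 + x ^+ 2 / 2.
Proof. by have := one_sub_cos_le_sqr x; lra. Qed.

Lemma cos_taylor2_le_sqr x : cos x - 1 + x ^+ 2 / 2 <= x ^+ 2 / 2.
Proof. by have := cos_le1 x; lra. Qed.

(** With h = x / 2 the left side factors as 2 (h - sin h) (h + sin h). *)
Lemma cos_taylor2_le x : cos x - 1 + x ^+ 2 / 2 <= x ^+ 4 / 8.
Proof.
pose h := x / 2; have xE : x = 2 * h by rewrite /h; field.
have -> : cos x - 1 + x ^+ 2 / 2 = 2 * ((h - sin h) * (h + sin h)).
  by have := one_sub_cos x; rewrite -/h xE; lra.
have -> : x ^+ 4 / 8 = 2 * ((`|h| ^+ 3 / 2) * (2 * `|h|)).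
  have -> : `|h| ^+ 3 / 2 * (2 * `|h|) = `|h| ^+ 2 * `|h| ^+ 2 by field.
  rewrite xE.
  by rewrite real_normK ?num_real//; field.
rewrite ler_wpM2l// (le_trans (ler_norm _))// normrM ler_pM//.
  by rewrite distrC norm_sin_sub_cube.
by rewrite (le_trans (ler_normD _ _))// mulrDl !mul1r lerD2l norm_sin_le.
Qed.

(** From below, exp(-x) >= 1 - x. From above, exp(-x) (1 + x) <= 1, whereas (1 - x + x^2) (1 + x) =
    1 + x^3 >= 1. *)
Lemma expRN_taylor x : 0 <= x -> `|expR (- x) - (1 - x)| <= x ^+ 2.
Proof.
move=> x0; have h1 := expR_ge1Dx (- x); have h2 := expR_ge1Dx x.
have e0 : 0 < expR (- x) := expR_gt0 _.
have e1 : expR (- x) * expR x = 1 by rewrite -expRD addNr expR0.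
have e2 : expR (- x) * (1 + x) <= 1 by rewrite -[leRHS]e1 ler_pM2l.
have x3 : 0 <= x ^+ 3 by rewrite exprn_ge0.
rewrite ger0_norm; last by lra.
have x1 : 0 < 1 + x by rewrite ltr_pwDl.
by rewrite -subr_le0 -(pmulr_lle0 _ x1); lra.
Qed.

End trigonometric_bounds.

Section real_sequences.
Context {R : realType}.

Lemma cvg_dominated (u e : nat -> R) (l : R) :
  (forall n, `|u n - l| <= e n) -> e @ \oo --> (0 : R) -> u @ \oo --> l.
Proof.
move=> ue e0; apply/cvgrPdist_le => eps eps0.
have E : \forall n \near \oo, `|e n| <= eps by exact: cvgr0_norm_le.
apply: filterS E => n en.
by rewrite distrC (le_trans (ue n))// (le_trans (ler_norm _)).
Qed.

Lemma cvg_harmonicM (C : R) : C * (n.+1)%:R^-1 @[n --> \oo] --> (0 : R).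
Proof.
by rewrite -[0](mulr0 C); apply: cvgM; [exact: cvg_cst|exact: cvg_harmonic].
Qed.

Lemma cvg_sum0 (I : Type) (r : seq I) (u : I -> nat -> R) :
  (forall i, u i n @[n --> \oo] --> (0 : R)) ->
  \sum_(i <- r) u i n @[n --> \oo] --> (0 : R).
Proof.
move=> u0; elim: r => [|i r IH].
  by under eq_fun do rewrite big_nil; exact: cvg_cst.
under eq_fun do rewrite big_cons.
by have := cvgD (u0 i) IH; rewrite addr0; exact.
Qed.

End real_sequences.

(** * Characteristic functions of sums *)

Section iid_sums.
Context d (T : measurableType d) (R : realType) (P : probability T R).
Variable Y : nat -> T -> R.
Hypothesis mY : forall n, measurable_fun setT (Y n).

Definition partial_sum (n : nat) (w : T) : R := \sum_(i < n) Y i w.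

Hypothesis indepY : forall n, indep_fun P (partial_sum n) (Y n).
Hypothesis identY : forall n A, measurable A -> P (Y n @^-1` A) = P (Y 0%N @^-1` A).

Lemma partial_sumS n w : partial_sum n.+1 w = partial_sum n w + Y n w.
Proof. by rewrite /partial_sum big_ord_recr. Qed.

Lemma measurable_partial_sum n : measurable_fun setT (partial_sum n).
Proof. by apply: measurable_sum => i; exact: mY. Qed.

Let mS := measurable_partial_sum.

Lemma measurable_cosM (a : R) : measurable_fun [set: R] (fun x : R => cos (a * x)).
Proof.
have mf : measurable_fun [set: R] (@cos R).
  by apply: continuous_measurable_fun; exact: continuous_cos.
by exact (measurableT_comp mf (mulrl_measurable a)).
Qed.

Lemma measurable_sinM (a : R) : measurable_fun [set: R] (fun x : R => sin (a * x)).
Proof.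
have mf : measurable_fun [set: R] (@sin R).
  by apply: continuous_measurable_fun; exact: continuous_sin.
by exact (measurableT_comp mf (mulrl_measurable a)).
Qed.

Lemma integrable_cosM (a : R) (U : T -> R) : measurable_fun setT U ->
  rint P (fun w => cos (a * U w)).
Proof.
move=> mU; apply: (@bounded_integrable _ _ _ _ _ 1) => [|w]; last exact: cos_max.
exact: (measurableT_comp (measurable_cosM a) mU).
Qed.

Lemma integrable_sinM (a : R) (U : T -> R) : measurable_fun setT U ->
  rint P (fun w => sin (a * U w)).
Proof.
move=> mU; apply: (@bounded_integrable _ _ _ _ _ 1) => [|w]; last exact: sin_max.
exact: (measurableT_comp (measurable_sinM a) mU).
Qed.

Lemma norm_Rintegral_le1 (f : T -> R) : measurable_fun setT f ->
  (forall w, `|f w| <= 1) -> `|\int[P]_w f w| <= 1.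
Proof.
move=> mf f1.
have if_ : P.-integrable setT (EFin \o f) by exact: bounded_integrable mf f1.
rewrite (le_trans (le_normr_Rintegral _ if_))//.
apply: le_trans (le_Rintegral _ _ _ (f2 := cst 1) _) _ => //=.
- exact: integrable_norm if_.
- by apply: (@bounded_integrable _ _ _ _ _ 1) => // w; rewrite normr1.
- by rewrite Rintegral_probability_cst.
Qed.

Section characteristic_function.
Variable a : R.
Let c := \int[P]_w cos (a * Y 0%N w).
Let s := \int[P]_w sin (a * Y 0%N w).
Let cS n := \int[P]_w cos (a * partial_sum n w).
Let sS n := \int[P]_w sin (a * partial_sum n w).

(** Real and imaginary parts of the multiplicativity of characteristic functions. *)
Lemma char_partial_sumS n :
  cS n.+1 = cS n * c - sS n * s /\ sS n.+1 = sS n * c + cS n * s.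
Proof.
have ec : \int[P]_w cos (a * Y n w) = c.
  exact: (eq_law_integral (mY n) (mY 0%N) (@identY n) (measurable_cosM a)
     (integrable_cosM a (mY 0%N))).2.
have es : \int[P]_w sin (a * Y n w) = s.
  exact: (eq_law_integral (mY n) (mY 0%N) (@identY n) (measurable_sinM a)
     (integrable_sinM a (mY 0%N))).2.
have mul := indep_mul (mS n) (mY n) (@indepY n).
have [icc ecc] := mul _ _ (measurable_cosM a) (measurable_cosM a)
  (integrable_cosM a (mS n)) (integrable_cosM a (mY n)).
have [iss ess] := mul _ _ (measurable_sinM a) (measurable_sinM a)
  (integrable_sinM a (mS n)) (integrable_sinM a (mY n)).
have [isc esc] := mul _ _ (measurable_sinM a) (measurable_cosM a)
  (integrable_sinM a (mS n)) (integrable_cosM a (mY n)).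
have [ics ecs] := mul _ _ (measurable_cosM a) (measurable_sinM a)
  (integrable_cosM a (mS n)) (integrable_sinM a (mY n)).
split; rewrite -ec -es /cS /sS.
  rewrite -ecc -ess -Rintegral_sub//; apply: eq_Rintegral => w _.
  by rewrite partial_sumS mulrDr cosD.
rewrite -esc -ecs -Rintegral_add//; apply: eq_Rintegral => w _.
by rewrite partial_sumS mulrDr sinD.
Qed.

(** As [cS], [sS] and [q] are at most 1 in absolute value, each step adds at most |c - q| + |s| to
    the error of either part; the two parts explain the 2. *)
Lemma char_partial_sum_dist (q : R) n : 0 <= q <= 1 ->
  `|cS n - q ^+ n| + `|sS n| <= 2 * n%:R * (`|c - q| + `|s|).
Proof.
move=> /andP[q0 q1]; elim: n => [|n IH].
  rewrite mulr0 mul0r /cS /sS.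
  under eq_Rintegral do rewrite /partial_sum big_ord0 mulr0 cos0.
  under [X in _ + `|X|]eq_Rintegral do rewrite /partial_sum big_ord0 mulr0 sin0.
  by rewrite !Rintegral_probability_cst expr0 subrr normr0 addr0.
have [-> ->] := char_partial_sumS n.
have cS1 : `|cS n| <= 1.
  apply: norm_Rintegral_le1 => [|w]; last exact: cos_max.
  exact: (measurableT_comp (measurable_cosM a) (mS n)).
have sS1 : `|sS n| <= 1.
  apply: norm_Rintegral_le1 => [|w]; last exact: sin_max.
  exact: (measurableT_comp (measurable_sinM a) (mS n)).
have -> : cS n * c - sS n * s - q ^+ n.+1 =
    (cS n - q ^+ n) * q + cS n * (c - q) - sS n * s by rewrite exprSr; ring.
have -> : sS n * c + cS n * s = sS n * q + sS n * (c - q) + cS n * s by ring.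
have h1 : `|(cS n - q ^+ n) * q + cS n * (c - q) - sS n * s| <=
    `|cS n - q ^+ n| + `|c - q| + `|s|.
  rewrite (le_trans (ler_normB _ _))// lerD//; last by rewrite normrM ler_piMl.
  rewrite (le_trans (ler_normD _ _))// lerD//; last by rewrite normrM ler_piMl.
  by rewrite normrM ler_piMr// ger0_norm.
have h2 : `|sS n * q + sS n * (c - q) + cS n * s| <= `|sS n| + `|c - q| + `|s|.
  rewrite (le_trans (ler_normD _ _))// lerD//; last by rewrite normrM ler_piMl.
  rewrite (le_trans (ler_normD _ _))// lerD//; last by rewrite normrM ler_piMl.
  by rewrite normrM ler_piMr// ger0_norm.
by move: IH; rewrite -natr1; lra.
Qed.

End characteristic_function.

(** It suffices that n times the distance between the characteristic function of Y / sqrt n and q =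
    exp(- v / (2 n)) tends to 0. The rescaled Taylor remainders [g] and [h] are dominated by
    multiples of Y^2 and vanish pointwise in the limit. *)
Lemma clt_char (v : R) : rint P (Y 0%N) -> \int[P]_w Y 0%N w = 0 ->
  rint P (fun w => Y 0%N w ^+ 2) -> \int[P]_w (Y 0%N w ^+ 2) = v ->
  (\int[P]_w cos ((Num.sqrt n%:R)^-1 * partial_sum n w) @[n --> \oo]
     --> expR (- (v / 2))) /\
  (\int[P]_w sin ((Num.sqrt n%:R)^-1 * partial_sum n w) @[n --> \oo] --> (0 : R)).
Proof.
move=> iY Y0 iY2 Yv.
have v0 : 0 <= v by rewrite -Yv; apply: Rintegral_ge0 => w _; exact: sqr_ge0.
(* The index is shifted by one so that the square root never vanishes. *)
pose a (n : nat) : R := (Num.sqrt n.+1%:R)^-1.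
have a2 n : n.+1%:R * a n ^+ 2 = 1.
  by rewrite /a exprVn sqr_sqrtr ?divff ?ler0n// pnatr_eq0.
have a2' n : a n ^+ 2 = n.+1%:R^-1.
  by apply: (mulfI (_ : n.+1%:R != 0)); rewrite ?pnatr_eq0// a2 divff ?pnatr_eq0.
have sqE n x : n.+1%:R * (a n * x) ^+ 2 = x ^+ 2 by rewrite exprMn mulrA a2 mul1r.
pose g n w := n.+1%:R * (cos (a n * Y 0%N w) - 1 + (a n * Y 0%N w) ^+ 2 / 2).
pose h n w := n.+1%:R * (sin (a n * Y 0%N w) - a n * Y 0%N w).
have ig n : rint P (g n) /\
    \int[P]_w g n w = n.+1%:R * (\int[P]_w cos (a n * Y 0%N w) - 1) + v / 2.
  have i1 : rint P (fun w => cos (a n * Y 0%N w) - 1).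
    by apply: rintB; [exact: integrable_cosM|exact: rint_cst].
  have -> : g n = fun w => n.+1%:R * (cos (a n * Y 0%N w) - 1) + 2^-1 * Y 0%N w ^+ 2.
    apply/funext => w; rewrite /g mulrDr; congr (_ + _).
    by rewrite mulrA sqE mulrC.
  split; first by apply: rintD; apply: rintZ.
  rewrite Rintegral_add; [|exact: rintZ|exact: rintZ].
  rewrite !Rintegral_scale// Yv Rintegral_sub.
  - by rewrite Rintegral_probability_cst; lra.
  - exact: integrable_cosM.
  - exact: rint_cst.
have ih n : rint P (h n) /\
    \int[P]_w h n w = n.+1%:R * \int[P]_w sin (a n * Y 0%N w).
  have i1 : rint P (fun w => sin (a n * Y 0%N w)) by exact: integrable_sinM.
  have i2 : rint P (fun w => a n * Y 0%N w) by exact: rintZ.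
  split; first by apply: rintZ; exact: rintB.
  by rewrite Rintegral_scale; [rewrite Rintegral_sub// Rintegral_scale// Y0 mulr0 subr0|exact: rintB].
have g0 : \int[P]_w g n w @[n --> \oo] --> (0 : R).
  apply: (Rintegral_cvg0 (G := fun w => 2^-1 * Y 0%N w ^+ 2)).
  - by move=> n; case: (ig n) => /rint_measurable.
  - exact: rintZ.
  - move=> n w; rewrite /g ger0_norm ?mulr_ge0 ?cos_taylor2_ge0//.
    apply: le_trans (ler_wpM2l _ (cos_taylor2_le_sqr _)) _ => //.
    by rewrite mulrA sqE mulrC.
  - move=> w; apply: cvg_dominated (cvg_harmonicM (Y 0%N w ^+ 4 / 8)) => n.
    rewrite subr0 /g ger0_norm ?mulr_ge0 ?cos_taylor2_ge0//.
    apply: le_trans (ler_wpM2l _ (cos_taylor2_le _)) _ => //.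
    rewrite [leLHS](_ : _ = (n.+1%:R * (a n * Y 0%N w) ^+ 2) * (a n * Y 0%N w) ^+ 2 / 8); last by field.
    by rewrite sqE exprMn a2' le_eqVlt; apply/orP; left; apply/eqP; field; rewrite nat1r pnatr_eq0.
have h0 : \int[P]_w h n w @[n --> \oo] --> (0 : R).
  apply: (Rintegral_cvg0 (G := fun w => Y 0%N w ^+ 2)).
  - by move=> n; case: (ih n) => /rint_measurable.
  - exact: iY2.
  - move=> n w; rewrite /h normrM ger0_norm//.
    apply: le_trans (ler_wpM2l _ (norm_sin_sub_sqr _)) _ => //.
    by rewrite sqE.
  - move=> w; have a0 : a n @[n --> \oo] --> (0 : R).
      apply/cvgrPdist_le => eps eps0.
      have : \forall n \near \oo, `|1 * n.+1%:R^-1| <= eps ^+ 2.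
        by apply: cvgr0_norm_le (cvg_harmonicM 1) _ _; rewrite exprn_gt0.
      apply: filterS => n; rewrite mul1r -a2' sub0r normrN ger0_norm ?sqr_ge0//.
      by rewrite -[a n ^+ 2]real_normK ?num_real// ler_sqr// nnegrE ltW.
    apply: cvg_dominated (_ : (`|Y 0%N w| ^+ 3 / 2) * a n @[n --> \oo] --> 0) => [n|].
      rewrite subr0 /h normrM ger0_norm//.
      apply: le_trans (ler_wpM2l _ (norm_sin_sub_cube _)) _ => //.
      have an : 0 <= a n by rewrite invr_ge0.
      rewrite normrM (ger0_norm an).
      rewrite [leLHS](_ : _ = (n.+1%:R * (a n * `|Y 0%N w|) ^+ 2) * (a n * `|Y 0%N w|) / 2); last by field.
      by rewrite sqE le_eqVlt; apply/orP; left; apply/eqP; field.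
    by rewrite -[0](mulr0 (`|Y 0%N w| ^+ 3 / 2)); apply: cvgM => //; exact: cvg_cst.
(* The middle term is (n + 1) x^2 with x = v / (2 (n + 1)), the cost of replacing exp(-x) by 1 -
   x. *)
pose e n := 2 * (`|\int[P]_w g n w| + v ^+ 2 / 4 * n.+1%:R^-1 + `|\int[P]_w h n w|).
have e0 : e @ \oo --> (0 : R).
  have -> : 0 = 2 * (0 + 0 + 0) :> R by ring.
  apply: cvgM; first exact: cvg_cst.
  apply: cvgD; last exact/norm_cvg0P.
  apply: cvgD; first exact/norm_cvg0P.
  exact: cvg_harmonicM.
have key n : `|\int[P]_w cos (a n * partial_sum n.+1 w) - expR (- (v / 2))| +
    `|\int[P]_w sin (a n * partial_sum n.+1 w)| <= e n.
  pose x : R := v / 2 / n.+1%:R; pose q := expR (- x).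
  have x0 : 0 <= x by rewrite !divr_ge0.
  have xn : n.+1%:R * x = v / 2 by rewrite /x mulrC divfK// pnatr_eq0.
  have q01 : 0 <= q <= 1 by rewrite expR_ge0 -expR0 ler_expR oppr_le0.
  have := char_partial_sum_dist (a n) n.+1 q01.
  rewrite -expRM_natl mulrN xn => /le_trans; apply.
  rewrite /e -mulrA ler_wpM2l// mulrDr lerD//; last first.
    by rewrite (ih n).2 normrM (ger0_norm (ler0n _ _)).
  rewrite -[X in X * _ <= _]ger0_norm// -normrM.
  have -> : n.+1%:R * (\int[P]_w cos (a n * Y 0%N w) - q) =
      \int[P]_w g n w - n.+1%:R * (q - (1 - x)).
    by rewrite (ig n).2 -xn; ring.
  rewrite (le_trans (ler_normB _ _))// lerD2l normrM ger0_norm//.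
  apply: le_trans (ler_wpM2l _ (expRN_taylor x0)) _ => //.
  by rewrite expr2 mulrA xn /x; rewrite le_eqVlt; apply/orP; left; apply/eqP; field.
split; rewrite -cvg_shiftS; apply: cvg_dominated e0 => n.
  by apply: le_trans (key n); rewrite lerDl.
by rewrite subr0; apply: le_trans (key n); rewrite lerDr.
Qed.

(** The comparison value is now q = 1, and both remainders are dominated by multiples of |Y|, so a
    first moment suffices. *)
Lemma lln_char (t : R) : rint P (Y 0%N) -> \int[P]_w Y 0%N w = 0 ->
  \int[P]_w cos (t * (n%:R^-1 * partial_sum n w)) @[n --> \oo] --> (1 : R).
Proof.
move=> iY Y0; pose a (n : nat) : R := t / n.+1%:R.
have an n : n.+1%:R * a n = t by rewrite /a mulrC divfK// pnatr_eq0.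
pose g n w := n.+1%:R * (cos (a n * Y 0%N w) - 1).
pose h n w := n.+1%:R * (sin (a n * Y 0%N w) - a n * Y 0%N w).
have i1 n : rint P (fun w => cos (a n * Y 0%N w)) by exact: integrable_cosM.
have ig n : rint P (g n) /\
    \int[P]_w g n w = n.+1%:R * (\int[P]_w cos (a n * Y 0%N w) - 1).
  have i2 : rint P (fun w => cos (a n * Y 0%N w) - 1).
    by apply: rintB => //; exact: rint_cst.
  split; first exact: rintZ.
  rewrite Rintegral_scale// Rintegral_sub//; last exact: rint_cst.
  by rewrite Rintegral_probability_cst.
have ih n : rint P (h n) /\
    \int[P]_w h n w = n.+1%:R * \int[P]_w sin (a n * Y 0%N w).
  have i3 : rint P (fun w => sin (a n * Y 0%N w)) by exact: integrable_sinM.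
  have i2 : rint P (fun w => a n * Y 0%N w) by exact: rintZ.
  split; first by apply: rintZ; exact: rintB.
  by rewrite Rintegral_scale; [rewrite Rintegral_sub// Rintegral_scale// Y0 mulr0 subr0|exact: rintB].
have sqE n w : n.+1%:R * (a n * Y 0%N w) ^+ 2 = (t * Y 0%N w) ^+ 2 * n.+1%:R^-1.
  by rewrite -(an n); field; rewrite nat1r pnatr_eq0.
have normE n w : n.+1%:R * `|a n * Y 0%N w| = `|t| * `|Y 0%N w|.
  by rewrite -(an n) [in LHS]normrM [in RHS]normrM (ger0_norm (ler0n R n.+1)) mulrA.
have g0 : \int[P]_w g n w @[n --> \oo] --> (0 : R).
  apply: (Rintegral_cvg0 (G := fun w => `|t| * `|Y 0%N w|)).
  - by move=> n; case: (ig n) => /rint_measurable.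
  - by apply: rintZ; exact: rint_norm.
  - move=> n w; rewrite /g normrM ger0_norm// -normrN opprB ger0_norm ?one_sub_cos_ge0//.
    by rewrite -(normE n w) ler_wpM2l// one_sub_cos_le.
  - move=> w; apply: cvg_dominated (cvg_harmonicM ((t * Y 0%N w) ^+ 2)) => n.
    rewrite subr0 /g normrM ger0_norm// -normrN opprB ger0_norm ?one_sub_cos_ge0//.
    rewrite -sqE ler_wpM2l// (le_trans (one_sub_cos_le_sqr _))//.
    by rewrite ler_pdivrMr// ler_peMr ?sqr_ge0// ler1n.
have h0 : \int[P]_w h n w @[n --> \oo] --> (0 : R).
  apply: (Rintegral_cvg0 (G := fun w => 2 * (`|t| * `|Y 0%N w|))).
  - by move=> n; case: (ih n) => /rint_measurable.
  - by apply: rintZ; apply: rintZ; exact: rint_norm.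
  - move=> n w; rewrite /h normrM ger0_norm// -(normE n w) mulrCA ler_wpM2l//.
    exact: norm_sin_sub_le.
  - move=> w; apply: cvg_dominated (cvg_harmonicM ((t * Y 0%N w) ^+ 2)) => n.
    by rewrite subr0 /h normrM ger0_norm// -sqE ler_wpM2l// norm_sin_sub_sqr.
pose e n := 2 * (`|\int[P]_w g n w| + `|\int[P]_w h n w|).
have e0 : e @ \oo --> (0 : R).
  have -> : 0 = 2 * (0 + 0) :> R by ring.
  apply: cvgM; first exact: cvg_cst.
  by apply: cvgD; exact/norm_cvg0P.
rewrite -cvg_shiftS; apply: cvg_dominated e0 => n.
  rewrite /=.
have -> : \int[P]_w cos (t * (n.+1%:R^-1 * partial_sum n.+1 w)) =
    \int[P]_w cos (a n * partial_sum n.+1 w).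
  by apply: eq_Rintegral => w _; rewrite mulrA.
have := char_partial_sum_dist (a n) n.+1 (q := 1).
rewrite ler01 lexx expr1n => /(_ isT).
rewrite -mulrA mulrDr /e (ig n).2 (ih n).2 !(normrM n.+1%:R) (ger0_norm (ler0n _ _)).
by apply: le_trans; rewrite lerDl.
Qed.

End iid_sums.

(** * Weak law of large numbers under a first moment *)

Section law_of_large_numbers.
Context d (T : measurableType d) (R : realType) (P : probability T R).

Lemma measurable_exceed (f : T -> R) (e : R) : measurable_fun setT f ->
  measurable_fun setT (fun w => (e < `|f w|)%R%:R : R).
Proof.
move=> mf; pose A := [set w | e < `|f w|].
have mA : measurable A.
  rewrite -[A]setTI (_ : A = (fun w => `|f w|) @^-1` `]e, +oo[); last first.
    by apply/seteqP; split => w; rewrite /= in_itv/= andbT.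
  have mn : measurable_fun setT (fun w => `|f w|).
    by exact (measurableT_comp (@normr_measurable R setT) mf).
  exact: mn.
rewrite (_ : (fun w => _) = \1_A); first exact: measurable_indic.
apply/funext => w; rewrite indicE.
by have -> : (w \in A) = (e < `|f w|) by apply/idP/idP; rewrite inE.
Qed.

Lemma rint_exceed (f : T -> R) (e : R) : measurable_fun setT f ->
  rint P (fun w => (e < `|f w|)%R%:R).
Proof.
move=> mf; apply: (@bounded_integrable _ _ _ _ _ 1); first exact: measurable_exceed.
by move=> w; case: (_ < _); rewrite ?normr1 ?normr0.
Qed.

Variable Y : nat -> T -> R.
Hypothesis mY : forall n, measurable_fun setT (Y n).
Hypothesis indepY : forall n, indep_fun P (partial_sum Y n) (Y n).
Hypothesis identY : forall n A, measurable A -> P (Y n @^-1` A) = P (Y 0%N @^-1` A).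

Let ident (f : R -> R) n : measurable_fun setT f -> rint P (fun w => f (Y 0%N w)) ->
  rint P (fun w => f (Y n w)) /\ \int[P]_w f (Y n w) = \int[P]_w f (Y 0%N w).
Proof. by move=> mf; exact: (eq_law_integral (mY n) (mY 0%N) (@identY n) mf). Qed.

Lemma measurable_sqr : measurable_fun [set: R] (fun x : R => x ^+ 2).
Proof. exact: exprn_measurable. Qed.

Lemma partial_sum_moments (v : R) : rint P (Y 0%N) -> \int[P]_w Y 0%N w = 0 ->
  rint P (fun w => Y 0%N w ^+ 2) -> \int[P]_w (Y 0%N w ^+ 2) = v ->
  forall n, [/\ rint P (partial_sum Y n), \int[P]_w partial_sum Y n w = 0,
    rint P (fun w => partial_sum Y n w ^+ 2) &
    \int[P]_w (partial_sum Y n w ^+ 2) = n%:R * v].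
Proof.
move=> iY Y0 iY2 Yv; elim => [|n [iS S0 iS2 Sv]].
  have E : partial_sum Y 0 = fun=> 0 by apply/funext => w; rewrite /partial_sum big_ord0.
  rewrite E Rintegral_probability_cst mul0r; split => //; first exact: rint_cst.
    by under eq_fun do rewrite expr0n; exact: rint_cst.
  by under eq_Rintegral do rewrite expr0n; rewrite Rintegral_probability_cst.
have [iYn Yn0] := ident n (@measurable_id _ _ setT) iY.
have [iYn2 Ynv] := ident n measurable_sqr iY2.
have [iSY SY] := indep_mul (measurable_partial_sum mY n) (mY n) (@indepY n)
  (@measurable_id _ _ setT) (@measurable_id _ _ setT) iS iYn.
have ES : partial_sum Y n.+1 = fun w => partial_sum Y n w + Y n w.
  by apply/funext => w; rewrite partial_sumS.
have ES2 : (fun w => partial_sum Y n.+1 w ^+ 2) = fun w =>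
    (partial_sum Y n w ^+ 2 + 2 * (partial_sum Y n w * Y n w)) + Y n w ^+ 2.
  by apply/funext => w; rewrite partial_sumS; ring.
have i2 : rint P (fun w => partial_sum Y n w ^+ 2 + 2 * (partial_sum Y n w * Y n w)).
  by apply: rintD => //; exact: rintZ.
rewrite ES2; split.
- by rewrite ES; exact: rintD.
- by rewrite ES Rintegral_add// S0 Yn0 Y0 addr0.
- exact: rintD.
- rewrite Rintegral_add// Rintegral_add//; last exact: rintZ.
  by rewrite Rintegral_scale// Sv SY S0 Ynv Yv -natr1; ring.
Qed.

Lemma abs_mean_le n : rint P (Y 0%N) ->
  rint P (fun w => n%:R^-1 * partial_sum Y n w) /\
  \int[P]_w `|n%:R^-1 * partial_sum Y n w| <= \int[P]_w `|Y 0%N w|.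
Proof.
move=> iY.
have iYi i := (ident i (@measurable_id _ _ setT) iY).1.
have aY i : \int[P]_w `|Y i w| = \int[P]_w `|Y 0%N w|.
  exact: (ident i (@normr_measurable R setT) (rint_norm iY)).2.
have iS : rint P (partial_sum Y n).
  by apply: (@rint_sum _ _ _ P _ (fun i : 'I_n => Y i)).
split; first exact: rintZ.
have sY : rint P (fun w => \sum_(i < n) `|Y i w|).
  by apply: (@rint_sum _ _ _ P _ (fun (i : 'I_n) w => `|Y i w|)) => i; exact: rint_norm.
apply: (@le_trans _ _ (\int[P]_w (n%:R^-1 * \sum_(i < n) `|Y i w|))).
  apply: Rintegral_le; [exact/rint_norm/rintZ|exact: rintZ|move=> w].
  rewrite normrM (ger0_norm (_ : 0 <= n%:R^-1)) ?invr_ge0//.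
  by rewrite ler_wpM2l ?invr_ge0// ler_norm_sum.
rewrite Rintegral_scale// (Rintegral_finsum (f := fun (i : 'I_n) w => `|Y i w|)); last first.
  by move=> i; exact: rint_norm.
under eq_bigr do rewrite aY.
rewrite sumr_const card_ord -[X in _ * X]mulr_natl mulrA.
(* For n = 0 the mean is 0, the inverse of 0 being 0. *)
have [->|n0] := eqVneq n 0%N; last by rewrite mulVf ?pnatr_eq0// mul1r.
by rewrite mulr0 mul0r Rintegral_ge0.
Qed.

(** Above L the first term is at least 1. Between e and L the second one is, because cosine
    decreases on [0, pi] and |x| / L <= 1. After integration the two terms are a first moment and a
    characteristic function. *)
Lemma exceed_le (e L x : R) : 0 < e -> e <= L ->
  (e < `|x|)%R%:R <= L^-1 * `|x| + (1 - cos (e / L))^-1 * (1 - cos (L^-1 * x)).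
Proof.
move=> e0 eL; have L0 : 0 < L by exact: lt_le_trans eL.
have eL1 : e / L <= 1 by rewrite ler_pdivrMr// mul1r.
have eL0 : 0 < e / L by rewrite divr_gt0.
have pi1 : 1 <= pi :> R by rewrite (le_trans _ (pi_ge2 _))// ler1n.
have c0 : 0 < 1 - cos (e / L).
  rewrite subr_gt0 -[ltRHS]cos0 ltr_cos// in_itv/= ?lexx ?pi_ge0//.
  by rewrite ltW//= (le_trans eL1).
have [ex|_] := ltP e `|x|; last first.
  by rewrite addr_ge0// mulr_ge0 ?invr_ge0 ?one_sub_cos_ge0// ltW.
have [xL|xL] := leP `|x| L; last first.
  apply: ler_wpDr; first by rewrite mulr_ge0 ?invr_ge0 ?one_sub_cos_ge0// ltW.
  by rewrite mulrC ler_pdivlMr// mul1r ltW.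
apply: ler_wpDl; first by rewrite mulr_ge0// invr_ge0 ltW.
rewrite mulrC ler_pdivlMr// mul1r lerD2l lerN2.
rewrite -(cos_norm (L^-1 * x)) normrM gtr0_norm ?invr_gt0// mulrC.
have xL1 : `|x| / L <= 1 by rewrite ler_pdivrMr// mul1r.
have hx : `|x| / L \in `[0, pi].
  by rewrite in_itv/= divr_ge0 ?(ltW L0)//= (le_trans xL1).
have he : e / L \in `[0, pi] by rewrite in_itv/= (ltW eL0)/= (le_trans eL1).
by apply/ltW; rewrite ltr_cos// ltr_pM2r ?invr_gt0.
Qed.

Lemma weak_lln (e : R) : 0 < e -> rint P (Y 0%N) -> \int[P]_w Y 0%N w = 0 ->
  \int[P]_w ((e < `|n%:R^-1 * partial_sum Y n w|)%R%:R : R) @[n --> \oo] --> (0 : R).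
Proof.
move=> e0 iY Y0; apply/cvgrPdist_le => eps eps0.
pose m := \int[P]_w `|Y 0%N w|.
have m0 : 0 <= m by exact: Rintegral_ge0.
(* This L keeps the first moment term below eps / 2 for all n; the cosine term is then treated at
   the fixed frequency 1 / L. *)
pose L := e + 2 * m / eps.
have eL : e <= L by rewrite lerDl divr_ge0 ?mulr_ge0// ltW.
have L0 : 0 < L by exact: lt_le_trans eL.
pose c := (1 - cos (e / L))^-1.
have c0 : 0 <= c by rewrite invr_ge0 one_sub_cos_ge0.
have mL : L^-1 * m <= eps / 2.
  rewrite mulrC ler_pdivrMr// /L mulrDr.
  have -> : eps / 2 * (2 * m / eps) = m by field; rewrite gt_eqF.
  by rewrite lerDr mulr_ge0// ?ltW// divr_gt0.
have E : \forall n \near \oo,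
    `|1 - \int[P]_w cos (L^-1 * (n%:R^-1 * partial_sum Y n w))| <= eps / 2 / (c + 1).
  have /cvgrPdist_le := lln_char mY indepY identY (L^-1) iY Y0.
  by apply; rewrite !divr_gt0// ltr_wpDl.
apply: filterS E => n En.
rewrite sub0r normrN ger0_norm; last by apply: Rintegral_ge0 => w _; rewrite ler0n.
have [iA A] := abs_mean_le n iY.
have mA := rint_measurable iA.
have iC := integrable_cosM P (L^-1) mA.
have iC1 : rint P (fun w => 1 - cos (L^-1 * (n%:R^-1 * partial_sum Y n w))).
  by apply: rintB => //; exact: rint_cst.
apply: (@le_trans _ _ (\int[P]_w (L^-1 * `|n%:R^-1 * partial_sum Y n w| +
    c * (1 - cos (L^-1 * (n%:R^-1 * partial_sum Y n w)))))).
  apply: Rintegral_le => [| |w]; last exact: exceed_le.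
    exact: rint_exceed.
  by apply: rintD; [apply: rintZ; exact: rint_norm|exact: rintZ].
rewrite Rintegral_add; [|by apply: rintZ; exact: rint_norm|exact: rintZ].
rewrite Rintegral_scale; last exact: rint_norm.
rewrite Rintegral_scale// Rintegral_sub//; last exact: rint_cst.
rewrite Rintegral_probability_cst [leRHS](_ : _ = eps / 2 + eps / 2); last by field.
rewrite lerD//.
  by rewrite (le_trans _ mL)// ler_wpM2l// invr_ge0 ltW.
apply: le_trans (_ : (c + 1) * (eps / 2 / (c + 1)) <= _); last first.
  by rewrite mulrC divfK// gt_eqF// ltr_wpDl.
apply: ler_pM => //.
- rewrite -[X in X - _](Rintegral_probability_cst P) -Rintegral_sub//.
    by apply: Rintegral_ge0 => w _; exact: one_sub_cos_ge0.
  exact: rint_cst.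
- by rewrite lerDl.
- exact: le_trans (ler_norm _) En.
Qed.

End law_of_large_numbers.

(** * The characteristic function of the normal law *)

Section normal_characteristic_function.
Context {R : realType}.
Variable s : R.
Hypothesis s_neq0 : s != 0.
Notation mu := (@lebesgue_measure R).
Let pdf := normal_pdf 0 s.

Lemma normal_pdf_expR (x : R) :
  pdf x = normal_peak s * expR (- (2 * s ^+ 2)^-1 * x ^+ 2).
Proof.
rewrite /pdf normal_pdfE//; congr (_ * expR _); rewrite subr0 -mulr_natl.
by rewrite mulrC mulNr mulrN.
Qed.

Lemma is_derive_normal_pdf (x : R) : is_derive x (1 : R) pdf (- (x / s ^+ 2) * pdf x).
Proof.
have -> : pdf = cst (normal_peak s) *
    (expR \o (cst (- (2 * s ^+ 2)^-1) * (@id R) ^+ 2)).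
  by apply/funext => y; rewrite normal_pdf_expR.
apply: is_derive_eq.
rewrite /= /GRing.scale/= !fctE/=.
by field.
Qed.

(** The phase treats both parts of the characteristic function at once: a = 0 gives the cosine and a
    = - pi / 2 the sine. *)
Definition phase_cos (t a : R) : R := \int[mu]_x (cos (t * x + a) * pdf x).

Lemma continuous_affine (t a : R) : continuous (fun x : R => t * x + a).
Proof.
move=> x; apply: (@continuousD _ _ _ (fun y : R => t * y) (fun=> a)).
  by apply: (@continuousM R _ (fun=> t) id); [exact: cst_continuous|exact: cvg_id].
exact: cst_continuous.
Qed.

Lemma measurable_cos_affine (t a : R) :
  measurable_fun [set: R] (fun x : R => cos (t * x + a)).
Proof.
apply: continuous_measurable_fun => x.
by apply: continuous_comp; [exact: continuous_affine|exact: continuous_cos].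
Qed.

Lemma measurable_sin_affine (t a : R) :
  measurable_fun [set: R] (fun x : R => sin (t * x + a)).
Proof.
apply: continuous_measurable_fun => x.
by apply: continuous_comp; [exact: continuous_affine|exact: continuous_sin].
Qed.

(** Dominated by a multiple of the density with twice the variance: with y = |x| / (2 |s|) the two
    exponentials differ by the factor exp(y^2), and y <= 1 + y^2 <= exp(y^2). *)
Lemma integrable_abs_normal_pdf :
  mu.-integrable [set: R] (EFin \o (fun x => `|x| * pdf x)).
Proof.
pose s' := Num.sqrt 2 * s.
have s'0 : s' != 0 by rewrite mulf_neq0// gt_eqF// sqrtr_gt0.
pose C := 2 * `|s| * (normal_peak s / normal_peak s').
have iC : mu.-integrable [set: R] (fun x => (C%:E * (normal_pdf 0 s' x)%:E)%E).
  by apply: integrableZl => //; exact: integrable_normal_pdf.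
apply: (le_integrable measurableT _ _ iC) => [|x _].
  apply/measurable_EFinP; apply: measurable_funM; first exact: normr_measurable.
  exact: measurable_normal_pdf.
rewrite /= lee_fin normrM normr_id ger0_norm ?normal_pdf_ge0//.
rewrite (le_trans _ (ler_norm _))// normal_pdf_expR normal_pdfE// /C.
pose y := `|x| / (2 * `|s|).
have s0 : 0 < `|s| by rewrite normr_gt0.
have peak0 : normal_peak s' != 0 by rewrite gt_eqF// normal_peak_gt0.
have -> : normal_fun 0 s' x = expR (- (2 * s ^+ 2)^-1 * x ^+ 2) * expR (y ^+ 2).
  rewrite -expRD; congr expR; rewrite subr0 /s' exprMn sqr_sqrtr// /y exprMn exprVn exprMn.
  rewrite !real_normK ?num_real// -mulr_natl.
  by field.
rewrite [leRHS](_ : _ = normal_peak s * expR (- (2 * s ^+ 2)^-1 * x ^+ 2) *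
    (2 * `|s| * expR (y ^+ 2))); last by field.
rewrite mulrC ler_wpM2l ?mulr_ge0 ?expR_ge0 ?normal_peak_ge0//.
rewrite -ler_pdivrMl ?mulr_gt0// mulrC -/y.
rewrite (le_trans _ (expR_ge1Dx _))//.
by have := sqr_ge0 (y - 1); have := sqr_ge0 y; nra.
Qed.

Lemma integrable_bounded_normal_pdf (f : R -> R) (M : R) :
  measurable_fun [set: R] f -> (forall x, `|f x| <= M) ->
  mu.-integrable [set: R] (EFin \o (fun x => f x * pdf x)).
Proof.
move=> mf fM.
have iM : mu.-integrable [set: R] (fun x => (M%:E * (pdf x)%:E)%E).
  by apply: integrableZl => //; exact: integrable_normal_pdf.
apply: (le_integrable measurableT _ _ iM) => [|x _].
  apply/measurable_EFinP; apply: measurable_funM => //.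
  exact: measurable_normal_pdf.
rewrite /= lee_fin !normrM ler_wpM2r//.
by rewrite (le_trans (fM x))// ler_norm.
Qed.

Lemma integrable_bounded_id_normal_pdf (f : R -> R) :
  measurable_fun [set: R] f -> (forall x, `|f x| <= 1) ->
  mu.-integrable [set: R] (EFin \o (fun x => f x * (x * pdf x))).
Proof.
move=> mf fM.
apply: (le_integrable measurableT _ _ integrable_abs_normal_pdf) => [|x _].
  apply/measurable_EFinP; apply: measurable_funM => //.
  by apply: measurable_funM => //; exact: measurable_normal_pdf.
rewrite /= lee_fin !normrM normr_id.
by rewrite ler_piMl// mulr_ge0.
Qed.

Lemma phase_cos_is_derive (t a : R) :
  is_derive t 1 (phase_cos ^~ a) (- \int[mu]_x (sin (t * x + a) * (x * pdf x))).
Proof.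
pose f t x := cos (t * x + a) * pdf x.
have derf (u x : R) : is_derive u (1 : R) (f ^~ x) (- (sin (u * x + a) * (x * pdf x))).
  rewrite (_ : f ^~ x = (cos \o ((@id R) * cst x + cst a)) * cst (pdf x)).
    apply: is_derive_eq.
    by rewrite /= /GRing.scale/= !fctE/=; ring.
  by apply/funext.
have G0 x : 0 <= `|x| * pdf x by rewrite mulr_ge0 ?normal_pdf_ge0.
have t01 : `]t - 1, t + 1[%classic t by rewrite /= in_itv/= ltrBlDr ltrDl ltr01.
have intf u : `]t - 1, t + 1[%classic u -> mu.-integrable [set: R] (EFin \o f u).
  move=> _; apply: integrable_bounded_normal_pdf 1 _ _.
    exact: measurable_cos_affine.
  by move=> x; exact: cos_max.
have d1f u x : partial1of2 f u x = - (sin (u * x + a) * (x * pdf x)).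
  by rewrite partial1of2E; apply: derive_val.
have derf' u x : `]t - 1, t + 1[%classic u -> [set: R] x -> derivable (f ^~ x) u 1.
  by move=> _ _; apply: ex_derive.
have Gub u x : `]t - 1, t + 1[%classic u -> [set: R] x ->
    `|partial1of2 f u x| <= `|x| * pdf x.
  move=> _ _; rewrite d1f normrN !normrM (ger0_norm (normal_pdf_ge0 _ _ _)).
  by rewrite ler_piMl ?mulr_ge0 ?normal_pdf_ge0// sin_max.
have h1 := derivable_under_integral measurableT t01 intf derf' G0
  integrable_abs_normal_pdf Gub.
have h2 := differentiation_under_integral measurableT t01 intf derf' G0
  integrable_abs_normal_pdf Gub.
apply: DeriveDef; first exact: h1.
rewrite -derive1E h2.
under eq_Rintegral do rewrite d1f -mulN1r.
rewrite RintegralZl//; first by rewrite mulN1r.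
apply: integrable_bounded_id_normal_pdf; first exact: measurable_sin_affine.
by move=> x; exact: sin_max.
Qed.

(* Integration by parts over the whole line: the derivative of
   [sin (t x + a) pdf x] has integral 0. *)
Lemma Rintegral_sin_normal_pdf (t a : R) :
  \int[mu]_x (sin (t * x + a) * (x * pdf x)) = s ^+ 2 * t * phase_cos t a.
Proof.
pose H x := sin (t * x + a) * pdf x.
pose h x := t * (cos (t * x + a) * pdf x) - (s ^+ 2)^-1 * (sin (t * x + a) * (x * pdf x)).
have s2 : s ^+ 2 != 0 by rewrite expf_neq0.
have i1 : mu.-integrable setT (EFin \o (fun x => cos (t * x + a) * pdf x)).
  apply: (@integrable_bounded_normal_pdf _ 1); first exact: measurable_cos_affine.
  by move=> x; exact: cos_max.
have i2 : mu.-integrable setT (EFin \o (fun x => sin (t * x + a) * (x * pdf x))).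
  apply: integrable_bounded_id_normal_pdf; first exact: measurable_sin_affine.
  by move=> x; exact: sin_max.
have i1' : mu.-integrable setT (EFin \o (fun x => t * (cos (t * x + a) * pdf x))).
  by have := integrableZl measurableT t i1.
have i2' : mu.-integrable setT
    (EFin \o (fun x => (s ^+ 2)^-1 * (sin (t * x + a) * (x * pdf x)))).
  by have := integrableZl measurableT (s ^+ 2)^-1 i2.
have ih : mu.-integrable setT (EFin \o h).
  by have := integrableB measurableT i1' i2'.
suff h0 : \int[mu]_x h x = 0.
  move: h0; rewrite /h RintegralB// !RintegralZl// -/(phase_cos t a) => /eqP.
  rewrite subr_eq0 => /eqP; rewrite -mulrA => ->.
  by rewrite mulrA divff// mul1r.
have dH (x : R) : is_derive x (1 : R) H (h x).
  rewrite (_ : H = (sin \o (cst t * (@id R) + cst a)) * pdf)//.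
  have dp := is_derive_normal_pdf x.
  apply: is_derive_eq.
  by rewrite /= /GRing.scale/= !fctE/= /h; field.
have cp : continuous pdf by exact: continuous_normal_pdf.
have cH : continuous H.
  by move=> x; apply/differentiable_continuous/derivable1_diffP; apply: ex_derive.
have ch : continuous h.
  move=> x; apply: (@continuousB _ _ _ (fun x => t * (cos (t * x + a) * pdf x))
     (fun x => (s ^+ 2)^-1 * (sin (t * x + a) * (x * pdf x)))).
    apply: (@continuousM R _ (fun=> t) (fun x => cos (t * x + a) * pdf x)).
      exact: cst_continuous.
    apply: (@continuousM R _ (fun x => cos (t * x + a)) pdf); last exact: cp.
    by apply: continuous_comp; [exact: continuous_affine|exact: continuous_cos].
  apply: (@continuousM R _ (fun=> (s ^+ 2)^-1) (fun x => sin (t * x + a) * (x * pdf x))).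
    exact: cst_continuous.
  apply: (@continuousM R _ (fun x => sin (t * x + a)) (fun x => x * pdf x)).
    by apply: continuous_comp; [exact: continuous_affine|exact: continuous_sin].
  by apply: (@continuousM R _ id pdf); [exact: cvg_id|exact: cp].
pose D (n : nat) : set R := `[- (n.+1%:R : R), n.+1%:R]%classic.
have FTC n : (\int[mu]_(x in D n) (h x)%:E = (H n.+1%:R)%:E - (H (- n.+1%:R))%:E)%E.
  apply: continuous_FTC2.
  - by rewrite -subr_gt0 opprK addr_gt0.
  - exact: continuous_subspaceT.
  - split.
    + by move=> x _; apply: ex_derive.
    + by apply: cvg_at_right_filter; exact: cH.
    + by apply: cvg_at_left_filter; exact: cH.
  - by move=> x _; rewrite derive1E; apply: derive_val.
have lim0 : (H n.+1%:R - H (- n.+1%:R)) @[n --> \oo] --> (0 : R).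
  pose c := (2 * s ^+ 2)^-1.
  have c0 : 0 < c by rewrite invr_gt0 mulr_gt0// exprn_even_gt0.
  apply: cvg_dominated (cvg_harmonicM (2 * normal_peak s / c)) => n.
  rewrite subr0.
  have Hle x : `|H x| <= pdf x.
    by rewrite /H normrM (ger0_norm (normal_pdf_ge0 _ _ _)) ler_piMl ?normal_pdf_ge0// sin_max.
  have pdfN : pdf (- n.+1%:R) = pdf n.+1%:R by rewrite !normal_pdf_expR sqrrN.
  rewrite (le_trans (ler_normB _ _))//.
  rewrite (le_trans (lerD (Hle _) (Hle _)))// pdfN normal_pdf_expR -/c.
  (* Crude decay is enough: exp(c m^2) >= c m^2 >= c m for m = n + 1. *)
  have : expR (- c * n.+1%:R ^+ 2) <= (c * n.+1%:R)^-1.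
    rewrite mulNr expRN lef_pV2 ?posrE ?expR_gt0 ?mulr_gt0//.
    apply: le_trans (expR_ge1Dx _); apply: ler_wpDl => //.
    by rewrite ler_pM2l// ler_eXnr ?ler1n.
  move=> e1; have {}e1 := ler_wpM2l (normal_peak_ge0 s) e1.
  rewrite (le_trans (lerD e1 e1))// le_eqVlt; apply/orP; left; apply/eqP; field.
  by rewrite nat1r pnatr_eq0 (gt_eqF c0).
(* Integrals over growing segments tend to the integral over the line; they also equal the boundary
   terms, which tend to 0. *)
have limh : (\int[mu]_x ((EFin \o h) \_ (D n)) x)%E @[n --> \oo] -->
    (\int[mu]_x (h x)%:E)%E.
  apply: (@dominated_cvg _ _ _ mu setT measurableT (fun n => (EFin \o h) \_ (D n))
    (EFin \o h) (abse \o (EFin \o h))).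
  - move=> n; apply/(measurable_restrictT _ _).1; first exact: measurable_itv.
    by apply: measurable_funTS; exact: measurable_int ih.
  - move=> x _; apply: cvg_near_cst.
    have [N xN] : exists N : nat, `|x| <= N%:R.
      exists (Num.bound `|x|); apply: ltW.
      exact: archi_boundP.
    exists N => // n /= Nn; rewrite patchE ifT// inE /D/= in_itv/=.
    rewrite -ler_norml (le_trans xN)// ler_nat.
    exact: leq_trans Nn (leqnSn _).
  - by [].
  - exact: integrable_abse.
  - move=> n x _; rewrite patchE; case: ifP => // _.
    by rewrite abse0; exact: abse_ge0.
have lim0' : (\int[mu]_x ((EFin \o h) \_ (D n)) x)%E @[n --> \oo] --> (0%:E : \bar R).
  under eq_fun do rewrite -integral_mkcond FTC -EFinB.
  by apply: cvg_EFin; [exact: nearW|exact: lim0].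
rewrite /Rintegral.
by rewrite (cvg_unique _ limh lim0').
Qed.

(** Integration by parts makes the derivative in t equal to - s^2 t times the function itself, so
    its product with exp(s^2 t^2 / 2) is constant. *)
Lemma phase_cosE (t a : R) :
  phase_cos t a = cos a * expR (- (s ^+ 2 * t ^+ 2 / 2)).
Proof.
pose g u := phase_cos u a * expR (s ^+ 2 * u ^+ 2 / 2).
have dg (u : R) : is_derive u (1 : R) g 0.
  have h1 := phase_cos_is_derive u a.
  have h2 : is_derive u (1 : R) (fun v => expR (s ^+ 2 * v ^+ 2 / 2))
      (s ^+ 2 * u * expR (s ^+ 2 * u ^+ 2 / 2)).
    rewrite (_ : (fun v => _) = expR \o (cst (s ^+ 2 / 2) * (@id R) ^+ 2)).
      apply: is_derive_eq.
      rewrite /= /GRing.scale/= !fctE/= (_ : s ^+ 2 / 2 * u ^+ 2 = s ^+ 2 * u ^+ 2 / 2); last by ring.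
      by field.
    by apply/funext => v; rewrite /= !fctE mulrAC.
  rewrite (_ : g = (phase_cos ^~ a) * (fun v => expR (s ^+ 2 * v ^+ 2 / 2)))//.
  apply: is_derive_eq.
  by rewrite Rintegral_sin_normal_pdf /GRing.scale/=; ring.
have := is_derive_0_is_cst t 0 dg.
rewrite /g expr0n mulr0 mul0r expR0 mulr1.
have -> : phase_cos 0 a = cos a.
  rewrite /phase_cos; under eq_Rintegral do rewrite mul0r add0r.
  rewrite RintegralZl//; last exact: integrable_normal_pdf.
  by rewrite /Rintegral integral_normal_pdf mulr1.
by move=> <-; rewrite -mulrA -expRD subrr expR0 mulr1.
Qed.

Lemma Rintegral_normal_prob (f : R -> R) (M : R) :
  measurable_fun [set: R] f -> (forall x, `|f x| <= M) ->
  \int[normal_prob 0 s]_x f x = \int[mu]_x (f x * pdf x).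
Proof.
move=> mf fM; rewrite /Rintegral; congr fine.
have dom := normal_prob_dominates 0 s.
have mf' : measurable_fun setT (EFin \o f) by exact/measurable_EFinP.
rewrite -(Radon_Nikodym_change_of_variables dom measurableT (f := EFin \o f)); last first.
  exact (@bounded_integrable _ _ R (normal_prob 0 s) f M mf fM).
under [RHS]eq_integral do rewrite EFinM.
apply: ae_eq_integral => //.
- exact: emeasurable_funM.
- apply: emeasurable_funM => //.
  by apply/measurable_EFinP; exact: measurable_normal_pdf.
- apply: ae_eqe_mul2l => /=.
  rewrite Radon_NikodymE//=.
  case: cid => /= h [h1 h2 h3].
  apply: integral_ae_eq => //=.
  + by apply/measurable_EFinP; exact: measurable_normal_pdf.
  + by move=> E E01 mE; rewrite -h3.
Qed.

End normal_characteristic_function.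

(** * Trigonometric approximation and convergence in distribution *)

Section trigonometric_polynomials.
Context {R : realType} {p : nat}.
Implicit Types (x y t u : 'cV[R]_p) (f g h : 'cV[R]_p -> R).

(** The linear span, to which convergence of characteristic functions extends by linearity. Closure
    under products is derived from the product-to-sum formulas. *)
Inductive trig : ('cV[R]_p -> R) -> Prop :=
| trig_cos t : trig (fun x => cos (dot t x))
| trig_sin t : trig (fun x => sin (dot t x))
| trig_scale a f : trig f -> trig (fun x => a * f x)
| trig_add f g : trig f -> trig g -> trig (fun x => f x + g x).

Lemma trig_ext f g : f =1 g -> trig f -> trig g.
Proof. by move=> /funext ->. Qed.

Lemma trig_cst (a : R) : trig (fun=> a).
Proof.
apply: trig_ext (trig_scale a (trig_cos 0)) => x.
by rewrite dot0l cos0 mulr1.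
Qed.

Lemma trig_mul_cos t g : trig g -> trig (fun x => cos (dot t x) * g x).
Proof.
elim=> [u|u|a f _ IH|f f' _ IH _ IH'].
- apply: trig_ext (trig_scale 2^-1 (trig_add (trig_cos (t + u)) (trig_cos (t - u)))) => x.
  by rewrite dotBl dotDl cosB cosD; field.
- apply: trig_ext (trig_scale 2^-1 (trig_add (trig_sin (t + u))
    (trig_scale (-1) (trig_sin (t - u))))) => x.
  by rewrite dotBl dotDl sinB sinD; field.
- by apply: trig_ext (trig_scale a IH) => x; rewrite mulrCA.
- by apply: trig_ext (trig_add IH IH') => x; rewrite mulrDr.
Qed.

Lemma trig_mul_sin t g : trig g -> trig (fun x => sin (dot t x) * g x).
Proof.
elim=> [u|u|a f _ IH|f f' _ IH _ IH'].
- apply: trig_ext (trig_scale 2^-1 (trig_add (trig_sin (t + u)) (trig_sin (t - u)))) => x.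
  by rewrite dotBl dotDl sinB sinD; field.
- apply: trig_ext (trig_scale 2^-1 (trig_add (trig_cos (t - u))
    (trig_scale (-1) (trig_cos (t + u))))) => x.
  by rewrite dotBl dotDl cosB cosD; field.
- by apply: trig_ext (trig_scale a IH) => x; rewrite mulrCA.
- by apply: trig_ext (trig_add IH IH') => x; rewrite mulrDr.
Qed.

Lemma trig_mul f g : trig f -> trig g -> trig (fun x => f x * g x).
Proof.
move=> + tg; elim=> [t|t|a f' _ IH|f1 f2 _ IH1 _ IH2].
- exact: trig_mul_cos.
- exact: trig_mul_sin.
- by apply: trig_ext (trig_scale a IH) => x; rewrite mulrA.
- by apply: trig_ext (trig_add IH1 IH2) => x; rewrite mulrDl.
Qed.

Lemma trig_bounded f : trig f -> exists2 B : R, 1 <= B & forall x, `|f x| <= B.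
Proof.
elim=> [t|t|a {}f _ [B B0 fB]|{}f g _ [B B0 fB] _ [B' B'0 gB]].
- by exists 1 => // x; exact: cos_max.
- by exists 1 => // x; exact: sin_max.
- exists (`|a| * B + 1) => [|x]; first by rewrite lerDr mulr_ge0// (le_trans _ B0).
  by rewrite normrM ler_wpDr// ler_wpM2l.
- exists (B + B') => [|x]; first by rewrite ler_wpDr// (le_trans _ B'0).
  by rewrite (le_trans (ler_normD _ _))// lerD.
Qed.

(* The Newton-type iteration computing [`|y|] from polynomials in [y]. *)
Fixpoint abs_iter (k : nat) (y : R) : R :=
  if k is k'.+1 then abs_iter k' y + 2^-1 * (y ^+ 2 - abs_iter k' y ^+ 2) else 0.

(** One step sends the error r to r (1 - (|y| + abs_iter k y) / 2) <= r (1 - r / 2), a recursion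
    that keeps r below 2 / (k + 2). *)
Lemma abs_iter_bound k (y : R) : `|y| <= 1 ->
  0 <= abs_iter k y <= `|y| /\ k.+2%:R * (`|y| - abs_iter k y) <= 2.
Proof.
move=> y1; have y0 : 0 <= `|y| by [].
elim: k => [|k [/andP[q0 qy] IH]] /=.
  by rewrite lexx y0 subr0; split => //; lra.
have yE : y ^+ 2 = `|y| ^+ 2 by rewrite real_normK ?num_real.
move: (abs_iter k y) q0 qy IH => q q0 qy; rewrite yE.
have k0 : 0 <= k%:R :> R by [].
rewrite -[k.+3]addn3 -[k.+2]addn2 !natrD => IH.
move: (`|y|) y0 y1 qy IH => z z0 z1 qz IH.
set r := z - q in IH *.
have r0 : 0 <= r by rewrite subr_ge0.
have r1 : r <= 1 by rewrite /r; lra.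
have rE : z - (q + 2^-1 * (z ^+ 2 - q ^+ 2)) = r * (1 - 2^-1 * (z + q)).
  by rewrite /r; field.
split.
  apply/andP; split.
    by rewrite addr_ge0// mulr_ge0// subr_ge0 lerXn2r// nnegrE.
  rewrite -subr_ge0 rE mulr_ge0// /r; lra.
rewrite rE.
apply: (@le_trans _ _ ((k%:R + 3) * (r * (1 - 2^-1 * r)))).
  rewrite ler_wpM2l ?addr_ge0// ler_wpM2l// lerD2l lerN2 ler_pM2l//.
  by rewrite /r; lra.
pose v := (k%:R + 2) * r.
have v2 : v <= 2 by [].
nra.
Qed.

Lemma trig_abs_iter k f : trig f -> trig (fun x => abs_iter k (f x)).
Proof.
move=> tf; elim: k => [|k IH] /=; first exact: trig_cst.
apply: trig_ext (trig_add IH (trig_scale 2^-1 (trig_add (trig_mul tf tf)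
  (trig_scale (-1) (trig_mul IH IH))))) => x.
by rewrite mulN1r !expr2.
Qed.

(** Uniform closure over the whole space: absolute values, maxima and minima may leave [trig] but
    not its closure. *)
Definition utrig f := forall e : R, 0 < e ->
  exists2 h, trig h & forall x, `|f x - h x| <= e.

Lemma utrig_trig f : trig f -> utrig f.
Proof. by move=> tf e e0; exists f => // x; rewrite subrr normr0 ltW. Qed.

Lemma utrig_ext f g : f =1 g -> utrig f -> utrig g.
Proof. by move=> /funext ->. Qed.

Lemma utrig_add f g : utrig f -> utrig g -> utrig (fun x => f x + g x).
Proof.
move=> uf ug e e0; have e2 : 0 < e / 2 by rewrite divr_gt0.
have [f' tf ff] := uf _ e2; have [g' tg gg] := ug _ e2.
exists (fun x => f' x + g' x); first exact: trig_add.
move=> x; rewrite opprD addrACA (le_trans (ler_normD _ _))//.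
by rewrite (splitr e) lerD.
Qed.

Lemma utrig_scale (a : R) f : utrig f -> utrig (fun x => a * f x).
Proof.
move=> uf e e0; have a1 : 0 < `|a| + 1 by rewrite ltr_wpDl.
have [f' tf ff] := uf _ (divr_gt0 e0 a1).
exists (fun x => a * f' x); first exact: trig_scale.
move=> x; rewrite -mulrBr normrM.
have -> : e = (`|a| + 1) * (e / (`|a| + 1)) by rewrite mulrC divfK// gt_eqF.
by rewrite ler_pM// lerDl.
Qed.

Lemma utrig_abs f : utrig f -> utrig (fun x => `|f x|).
Proof.
move=> uf e e0; have e2 : 0 < e / 2 by rewrite divr_gt0.
have [h th fh] := uf _ e2; have [B B1 hB] := trig_bounded th.
have B0 : 0 < B by exact: lt_le_trans B1.
(* The iteration runs on h / B, of absolute value at most 1; its error 2 / (k + 2), multiplied by B,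
   must stay below e / 2. *)
have [k kB] : exists k : nat, 2 * B / (e / 2) <= k%:R.
  exists (Num.bound (2 * B / (e / 2))); apply: ltW; apply: archi_boundP.
  by rewrite divr_ge0 ?mulr_ge0// ltW.
exists (fun x => B * abs_iter k (B^-1 * h x)).
  by apply: trig_scale; apply: trig_abs_iter; exact: trig_scale.
move=> x.
have y1 : `|B^-1 * h x| <= 1.
  by rewrite normrM gtr0_norm ?invr_gt0// mulrC ler_pdivrMr// mul1r.
have [/andP[q0 qy] kq] := abs_iter_bound k y1.
have -> : `|f x| - B * abs_iter k (B^-1 * h x) =
   (`|f x| - `|h x|) + B * (`|B^-1 * h x| - abs_iter k (B^-1 * h x)).
  by rewrite normrM gtr0_norm ?invr_gt0//; field; rewrite gt_eqF.
rewrite (le_trans (ler_normD _ _))// (splitr e) lerD//.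
  exact: le_trans (ler_dist_dist _ _) (fh x).
rewrite normrM gtr0_norm// ger0_norm ?subr_ge0//.
move: (`|_| - _) kq => r kr.
have k0 : 0 < k.+2%:R :> R by rewrite ltr0n.
rewrite -(ler_pM2l k0) mulrCA.
apply: (@le_trans _ _ (B * 2)); first by rewrite ler_pM2l.
move: kB; rewrite ler_pdivrMr// mulrC => /le_trans; apply.
by rewrite ler_pM2r// ler_nat (leq_trans (leqnSn k)).
Qed.

Lemma utrig_max f g : utrig f -> utrig g -> utrig (fun x => Num.max (f x) (g x)).
Proof.
move=> uf ug.
apply: utrig_ext (utrig_scale 2^-1 (utrig_add (utrig_add uf ug)
  (utrig_abs (utrig_add uf (utrig_scale (-1) ug))))) => x.
by rewrite mulN1r maxr_absE mulrC.
Qed.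

Lemma utrig_min f g : utrig f -> utrig g -> utrig (fun x => Num.min (f x) (g x)).
Proof.
move=> uf ug.
apply: utrig_ext (utrig_scale 2^-1 (utrig_add (utrig_add uf ug)
  (utrig_scale (-1) (utrig_abs (utrig_add uf (utrig_scale (-1) ug)))))) => x.
by rewrite !mulN1r minr_absE mulrC.
Qed.

Lemma utrig_bigmin (I : Type) (s : seq I) (F : I -> 'cV[R]_p -> R) (M : R) :
  (forall i, utrig (F i)) -> utrig (fun x => \big[Num.min/M]_(i <- s) F i x).
Proof.
move=> uF; elim: s => [|i s IH].
  by apply: utrig_ext (utrig_trig (trig_cst M)) => x; rewrite big_nil.
by apply: utrig_ext (utrig_min (uF i) IH) => x; rewrite big_cons.
Qed.

Lemma utrig_sum (I : Type) (s : seq I) (F : I -> 'cV[R]_p -> R) :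
  (forall i, utrig (F i)) -> utrig (fun x => \sum_(i <- s) F i x).
Proof.
move=> uF; elim: s => [|i s IH].
  by apply: utrig_ext (utrig_trig (trig_cst 0)) => x; rewrite big_nil.
by apply: utrig_ext (utrig_add (uF i) IH) => x; rewrite big_cons.
Qed.

Lemma trig_sin_coord (e : R) (j : 'I_p) : trig (fun x => e^-1 * sin (e * x j 0)).
Proof.
apply: trig_ext (trig_scale e^-1 (trig_sin (e *: delta_mx j 0))) => x.
congr (_ * sin _); rewrite dotZl; congr (_ * _).
by rewrite dotE (bigD1 j)//= big1 ?addr0 => [|i /negbTE ij]; rewrite !mxE ?eqxx ?mul1r// ij mul0r.
Qed.

Lemma compact_cball (K : R) : compact [set x : 'cV[R]_p | `|x| <= K].
Proof.
apply: (@compact_cV _ _ _ K) => //.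
rewrite (_ : mkset _ = normr @^-1` [set r : R | r <= K])//.
by apply: closed_comp => [x _|]; [exact: norm_continuous|exact: closed_le].
Qed.

(** Only [x] is confined to the ball: points of a net, and later the rescaled estimator, may lie
    outside it. *)
Lemma uniform_continuity (h : 'cV[R]_p -> R) (K e : R) : continuous h -> 0 < e ->
  exists2 r : R, 0 < r & forall x y, `|x| <= K -> `|x - y| <= r -> `|h x - h y| <= e.
Proof.
move=> ch e0.
have near0 : \forall r \near 0^'+, [set x | `|x| <= K] `<=`
    (fun x => forall y, `|x - y| <= r -> `|h x - h y| <= e).
  apply: (compact_near_coveringP _).1 (@compact_cball K) _ _ _ _ _ => x _.
  have e2 : 0 < e / 2 by rewrite divr_gt0.
  have := ch x => /cvgrPdist_le /(_ _ e2) /nbhs_ballP[r /= r0 rP].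
  have r2 : 0 < r / 2 by rewrite divr_gt0.
  exists (ball x (r / 2), [set r' | r' < r / 2]).
    by split => /=; [exact: nbhsx_ballx|exact: nbhs_right_lt].
  move=> [x' r'] /= []; rewrite -ball_normE /= => xx' rr' y xy.
  have h1 : `|h x - h x'| <= e / 2.
    by apply: rP; rewrite -ball_normE /= (lt_le_trans xx')// ler_pdivrMr// ler_pMr// ler1n.
  have h2 : `|h x - h y| <= e / 2.
    apply: rP; rewrite -ball_normE /=.
    rewrite (_ : x - y = (x - x') + (x' - y)); last by rewrite addrA subrK.
    by rewrite (le_lt_trans (ler_normD _ _))// (splitr r) ltrD// (le_lt_trans xy).
  rewrite (_ : h x' - h y = - (h x - h x') + (h x - h y)); last by ring.
  by rewrite (le_trans (ler_normD _ _))// normrN (splitr e) lerD.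
have [r [rP r0]] := @filter_ex _ _ _ _ (filterI near0 (nbhs_right_gt (0 : R))).
by exists r => // x y xK; exact: rP.
Qed.

Lemma finite_net (K r : R) : 0 < r -> exists s : seq 'cV[R]_p,
  forall x, `|x| <= K -> exists2 y, y \in s & `|x - y| <= r.
Proof.
move=> r0; have := @compact_cball K; rewrite compact_cover.
move=> /(_ _ setT (fun y => ball y r)) [].
- by move=> y _; exact: ball_open.
- by move=> x _; exists x => //; exact: ballxx.
move=> D _ cov; exists (finmap.enum_fset D) => x xK.
have [y yD xy] := cov x xK; exists y => //.
by move: xy; rewrite -ball_normE /= distrC => /ltW.
Qed.

End trigonometric_polynomials.

(** * Approximation of continuous functions on a ball *)

Section approximation.
Context {R : realType} {p : nat}.
Implicit Types (x y t u : 'cV[R]_p) (f g h : 'cV[R]_p -> R).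

Lemma norm_le_l1 x : `|x| <= \sum_(j < p) `|x j 0|.
Proof.
apply: norm_cV_le => [|i]; first by apply: sumr_ge0.
by rewrite (bigD1 i)//= lerDl sumr_ge0.
Qed.

Lemma l1_le_norm x : \sum_(j < p) `|x j 0| <= p%:R * `|x|.
Proof.
rewrite -[p in p%:R]card_ord -sumr_const mulr_suml.
by apply: ler_sum => i _; rewrite mul1r ler_coord_norm.
Qed.

(* On the ball of radius [K], [h] is close to the minimum over a finite net of
   the cones [h y + L * |x - y|_1]; replacing each coordinate by
   [sin (a x_j) / a] with [a] small makes the cones trigonometric up to the
   lattice operations. *)
Lemma trig_approx h (M K e : R) : continuous h -> (forall x, `|h x| <= M) ->
  0 < K -> 0 < e ->
  exists g, [/\ trig g, forall x, `|g x| <= M + e &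
    forall x, `|x| <= K -> `|g x - h x| <= e].
Proof.
move=> ch hM K0 e0; pose e1 := e / 4.
have e10 : 0 < e1 by rewrite divr_gt0.
have M0 : 0 <= M by exact: le_trans (hM 0).
have [r r0 rP] := uniform_continuity K ch e10.
(* As L r >= 2 M, a cone whose apex is farther than r from x lies above h x at x. *)
pose L := 2 * M / r + 1.
have L0 : 0 < L by rewrite ltr_wpDl// divr_ge0 ?mulr_ge0// ltW.
have Lr : 2 * M <= L * r.
  by rewrite /L [leRHS]mulrDl divfK ?gt_eqF// lerDl mul1r ltW.
have pp0 : 0 < p%:R + 1 :> R by rewrite ltr_wpDl.
(* The nearest apex of the net is then so close that L times the l1 distance is at most e1. *)
pose rho := Num.min r (e1 / (L * (p%:R + 1))).
have rho0 : 0 < rho by rewrite lt_min r0 divr_gt0// mulr_gt0.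
have rhor : rho <= r by rewrite ge_min lexx.
have Lrho : L * (p%:R * rho) <= e1.
  have : rho <= e1 / (L * (p%:R + 1)) by rewrite ge_min lexx orbT.
  rewrite ler_pdivlMr ?mulr_gt0//; apply: le_trans.
  have -> : L * (p%:R * rho) = rho * (L * p%:R) by ring.
  by rewrite ler_pM2l// ler_pM2l// lerDl.
have [s sP] := @finite_net R p K rho rho0.
(* Since |sin z - z| <= z^2, the substitute sin(a z) / a is within a K^2 of z for |z| <= K; summed
   over coordinates and times L this is at most e1. *)
pose a := e1 / (L * (p%:R + 1) * K ^+ 2).
have K2 : 0 < K ^+ 2 by rewrite exprn_gt0.
have a0 : 0 < a by rewrite divr_gt0// !mulr_gt0.
have LaK : L * (p%:R * (a * K ^+ 2)) <= e1.
  have -> : e1 = L * ((p%:R + 1) * (a * K ^+ 2)).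
    by rewrite /a; field; rewrite (gt_eqF K0) (gt_eqF pp0) (gt_eqF L0).
  apply: ler_wpM2l; first exact: ltW.
  apply: ler_wpM2r; first by rewrite mulr_ge0 ?(ltW a0) ?(ltW K2).
  by rewrite lerDl.
pose sc (z : R) := a^-1 * sin (a * z).
have scP z : `|z| <= K -> `|sc z - z| <= a * K ^+ 2.
  move=> zK; have -> : sc z - z = a^-1 * (sin (a * z) - a * z).
    by rewrite /sc mulrBr mulKf// gt_eqF.
  rewrite normrM gtr0_norm ?invr_gt0// ler_pdivrMl//.
  apply: le_trans (norm_sin_sub_sqr _) _.
  have -> : a * (a * K ^+ 2) = a ^+ 2 * K ^+ 2 by ring.
  rewrite exprMn ler_wpM2l ?sqr_ge0//.
  by rewrite -[z ^+ 2]real_normK ?num_real// lerXn2r// ?nnegrE// ltW.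
pose D y x := \sum_(j < p) `|sc (x j 0) - y j 0|.
have DP x y : `|x| <= K ->
    `|D y x - \sum_(j < p) `|(x - y) j 0| | <= p%:R * (a * K ^+ 2).
  move=> xK; rewrite -sumrB (le_trans (ler_norm_sum _ _ _))//.
  rewrite -[p in p%:R]card_ord -sumr_const mulr_suml; apply: ler_sum => j _.
  rewrite mul1r !mxE (le_trans (ler_dist_dist _ _))//.
  rewrite opprB addrA subrK.
  by apply: scP; rewrite (le_trans (ler_coord_norm _ _)).
(* The start value M and the maximum with - M in [g1] are the clipping: they bound [g1] by M
   everywhere and, as |h| <= M, do not increase the error on the ball. *)
pose g0 x := \big[Num.min/M]_(y <- s) (h y + L * D y x).
pose g1 x := Num.max (- M) (g0 x).
have ug1 : utrig g1.
  apply: utrig_max; first exact: utrig_trig (trig_cst _).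
  apply: utrig_bigmin => y; apply: utrig_add; first exact: utrig_trig (trig_cst _).
  apply: utrig_scale; apply: utrig_sum => j; apply: utrig_abs.
  apply: utrig_add; first exact: utrig_trig (trig_sin_coord _ _).
  exact: utrig_trig (trig_cst _).
have g0M x : g0 x <= M by exact: bigmin_le_id.
have g1M x : `|g1 x| <= M.
  by rewrite ler_norml /g1 le_max lexx ge_max g0M andbT /=; lra.
have g0h x : `|x| <= K -> `|g0 x - h x| <= 3 * e1.
  move=> xK; rewrite ler_norml; apply/andP; split.
    rewrite lerBrDr /g0; elim/big_ind : _ => [|b c bx cx|y _].
    - by have := hM x; rewrite ler_norml => /andP[_ ?]; lra.
    - by rewrite le_min bx cx.
    have := DP x y xK; rewrite ler_norml => /andP[d1 _].
    have d2 := norm_le_l1 (x - y).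
    have Ld : L * (D y x) >= L * `|x - y| - e1.
      rewrite -(lerD2r e1) subrK.
      apply: (@le_trans _ _ (L * D y x + L * (p%:R * (a * K ^+ 2)))).
        by rewrite -mulrDr ler_pM2l//; lra.
      by rewrite lerD2l.
    have [xy|/ltW xy] := leP `|x - y| r.
      have := rP x y xK xy; rewrite ler_norml => /andP[_ h1].
      have : 0 <= L * `|x - y| by rewrite mulr_ge0// ltW.
      lra.
    have : L * r <= L * `|x - y| by rewrite ler_pM2l.
    have := hM x; have := hM y; rewrite !ler_norml => /andP[h1 h2] /andP[h3 h4].
    lra.
  rewrite lerBlDr; have [y ys xy] := sP x xK.
  apply: (@le_trans _ _ (h y + L * D y x)).
    exact: (@ge_bigmin_seq _ _ _ s M y predT (fun y => h y + L * D y x) ys).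
  have := rP x y xK (le_trans xy rhor); rewrite ler_norml => /andP[h1 _].
  have := DP x y xK; rewrite ler_norml => /andP[_ d1].
  have d2 := l1_le_norm (x - y).
  have d3 : p%:R * `|x - y| <= p%:R * rho by rewrite ler_wpM2l.
  have d4 : L * D y x <= L * (p%:R * rho) + L * (p%:R * (a * K ^+ 2)).
    by rewrite -mulrDr ler_pM2l//; lra.
  lra.
have [g tg gg1] := ug1 _ e10; exists g; split => // [x|x xK].
  have -> : g x = g1 x - (g1 x - g x) by ring.
  rewrite (le_trans (ler_normB _ _))// lerD//.
  by rewrite (le_trans (gg1 x))// /e1; lra.
have g1h : `|g1 x - h x| <= 3 * e1.
  rewrite /g1; have [g0x|g0x] := leP (- M) (g0 x); first exact: g0h.
  have := g0h x xK; have := hM x; rewrite !ler_norml => /andP[h1 h2] /andP[h3 h4].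
  by apply/andP; split; lra.
have -> : g x - h x = - (g1 x - g x) + (g1 x - h x) by ring.
rewrite (le_trans (ler_normD _ _))// normrN.
have -> : e = e1 + 3 * e1 by rewrite /e1; field.
by rewrite lerD.
Qed.

End approximation.

Section vector_valued.
Context {R : realType} {p : nat} d (T : measurableType d).
Variable U : T -> 'cV[R]_p.
Hypothesis mU : forall j, measurable_fun setT (fun w => U w j 0).
Implicit Types (h : 'cV[R]_p -> R).

Lemma measurable_dot (t : 'cV[R]_p) : measurable_fun setT (fun w => dot t (U w)).
Proof.
rewrite (_ : (fun w => _) = fun w => \sum_(j < p) t j 0 * U w j 0).
  by apply: measurable_sum => j; apply: measurable_funM.
by apply/funext => w; rewrite dotE.
Qed.

Lemma measurable_sqnorm2 : measurable_fun setT (fun w => sqnorm2 (U w)).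
Proof.
by apply: measurable_sum => j; exact (measurableT_comp (@measurable_sqr R) (mU j)).
Qed.

Lemma measurable_trig h : trig h -> measurable_fun setT (h \o U).
Proof.
elim=> [t|t|a f _ IH|f g _ IH _ IH'].
- have mc : measurable_fun [set: R] (@cos R).
    by apply: continuous_measurable_fun; exact: continuous_cos.
  by exact (measurableT_comp mc (measurable_dot t)).
- have mc : measurable_fun [set: R] (@sin R).
    by apply: continuous_measurable_fun; exact: continuous_sin.
  by exact (measurableT_comp mc (measurable_dot t)).
- exact: measurable_funM.
- exact: measurable_funD.
Qed.

(** Pointwise limit of trigonometric polynomials in [U], with error 1 / (k + 1) on the ball of
    radius k + 1, so measurable coordinates suffice. *)
Lemma measurable_continuous_comp h (M : R) : continuous h ->
  (forall x, `|h x| <= M) -> measurable_fun setT (h \o U).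
Proof.
move=> ch hM.
have k0 (k : nat) : 0 < k.+1%:R :> R by rewrite ltr0n.
have /choice[g gP] : forall k : nat, exists g, trig g /\
    forall x, `|x| <= k.+1%:R -> `|g x - h x| <= k.+1%:R^-1.
  move=> k; have [|g [tg _ gh]] := trig_approx ch hM (k0 k) (e := k.+1%:R^-1).
    by rewrite invr_gt0.
  by exists g.
apply: (measurable_fun_cvg (h := fun k => g k \o U)).
  by move=> k; apply: measurable_trig; case: (gP k).
move=> w _; apply/cvgrPdist_le => e e0.
have [N NP] : exists N : nat, Num.max `|U w| e^-1 <= N%:R.
  exists (Num.bound (Num.max `|U w| e^-1)); apply: ltW; apply: archi_boundP.
  by rewrite le_max normr_ge0.
exists N => // k /= Nk.
have kN : N%:R <= k.+1%:R :> R by rewrite ler_nat (leq_trans Nk).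
move: NP; rewrite ge_max => /andP[/le_trans /(_ kN) Uk /le_trans /(_ kN) ek].
rewrite distrC; have [_ /(_ _ Uk)] := gP k; move/le_trans; apply.
by rewrite -[leRHS]invrK lef_pV2 ?posrE ?invr_gt0.
Qed.

End vector_valued.

(** * From characteristic functions to convergence in law *)

Section convergence_in_law.
Context {R : realType} {p : nat}.
Context d (T : measurableType d) (P : probability T R).
Context d' (T' : measurableType d') (Q : probability T' R).
Variables (U : nat -> T -> 'cV[R]_p) (V : T' -> 'cV[R]_p).
Hypothesis mU : forall n j, measurable_fun setT (fun w => U n w j 0).
Hypothesis mV : forall j, measurable_fun setT (fun w => V w j 0).
Hypothesis cos_cvg : forall t,
  \int[P]_w cos (dot t (U n w)) @[n --> \oo] --> \int[Q]_w cos (dot t (V w)).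
Hypothesis sin_cvg : forall t,
  \int[P]_w sin (dot t (U n w)) @[n --> \oo] --> \int[Q]_w sin (dot t (V w)).

Lemma trig_cvg h : trig h ->
  \int[P]_w h (U n w) @[n --> \oo] --> \int[Q]_w h (V w).
Proof.
have ti d0 (T0 : measurableType d0) (P0 : probability T0 R) (U0 : T0 -> 'cV[R]_p) f :
    (forall j, measurable_fun setT (fun w => U0 w j 0)) -> trig f ->
    rint P0 (fun w => f (U0 w)).
  move=> mU0 tf; have [B _ fB] := trig_bounded tf.
  exact: bounded_integrable (measurable_trig mU0 tf) (fun w => fB (U0 w)).
elim=> [t|t|a f tf IH|f g tf IH tg IH'].
- exact: cos_cvg.
- exact: sin_cvg.
- rewrite Rintegral_scale; last exact: ti.
  have E n : \int[P]_w (a * f (U n w)) = a * \int[P]_w f (U n w).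
    by rewrite Rintegral_scale//; exact: ti.
  rewrite (funext E).
  by apply: cvgM; [exact: cvg_cst|exact: IH].
- rewrite Rintegral_add; [|exact: ti|exact: ti].
  have E n : \int[P]_w (f (U n w) + g (U n w)) =
      \int[P]_w f (U n w) + \int[P]_w g (U n w).
    by rewrite Rintegral_add//; exact: ti.
  by rewrite (funext E); exact: cvgD.
Qed.

(** A single real variable is tight: the indicators tend to 0 at every point. *)
Lemma exceed_cvg0 (f : T' -> R) : measurable_fun setT f ->
  \int[Q]_w ((n%:R < `|f w|)%R%:R : R) @[n --> \oo] --> (0 : R).
Proof.
move=> mf; apply: (Rintegral_cvg0 (G := fun=> 1)).
- by move=> n; exact: measurable_exceed.
- exact: rint_cst.
- by move=> n w; case: (_ < _); rewrite ?normr1 ?normr0.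
- move=> w; apply: cvg_near_cst.
  have [N NP] : exists N : nat, `|f w| <= N%:R.
    by exists (Num.bound `|f w|); apply: ltW; apply: archi_boundP.
  exists N => // k /= Nk; rewrite ltNge (le_trans NP)// ler_nat//.
Qed.

Lemma norm_le_sqnorm2 (x : 'cV[R]_p) : `|x| ^+ 2 <= sqnorm2 x.
Proof.
have [->|x0] := eqVneq x 0.
  by rewrite normr0 expr0n /=; apply: sumr_ge0 => i _; exact: sqr_ge0.
have : `|x| <= Num.sqrt (sqnorm2 x).
  apply: norm_cV_le => [|i]; first exact: sqrtr_ge0.
  rewrite -sqrtr_sqr ler_wsqrtr// /sqnorm2 (bigD1 i)//= lerDl.
  by apply: sumr_ge0 => j _; exact: sqr_ge0.
have s0 : 0 <= sqnorm2 x by apply: sumr_ge0 => i _; exact: sqr_ge0.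
rewrite -(ler_sqr (x := `|x|)) ?nnegrE ?sqrtr_ge0//.
by rewrite sqr_sqrtr.
Qed.

(* Levy's continuity theorem for tight sequences. *)
Lemma cvg_of_char (B : R) h (M : R) :
  (forall n, rint P (fun w => sqnorm2 (U n w))) ->
  (forall n, \int[P]_w sqnorm2 (U n w) <= B) ->
  continuous h -> (forall x, `|h x| <= M) ->
  \int[P]_w h (U n w) @[n --> \oo] --> \int[Q]_w h (V w).
Proof.
move=> iU UB ch hM; apply/cvgrPdist_le => eps eps0.
pose e := Num.min 1 (eps / 8).
have e0 : 0 < e by rewrite lt_min ltr01 divr_gt0.
have e1 : e <= 1 by rewrite ge_min lexx.
have e8 : 8 * e <= eps.
  have : e <= eps / 8 by rewrite ge_min lexx orbT.
  by lra.
have M0 : 0 <= M by exact: le_trans (hM 0).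
have B0 : 0 <= B.
  apply: le_trans (UB 0%N); apply: Rintegral_ge0 => w _.
  by apply: sumr_ge0 => i _; exact: sqr_ge0.
(* Where the approximation is not controlled, |h - g| <= M + (M + e) <= A, because e <= 1. *)
pose A := 2 * M + 1.
have A0 : 0 < A by rewrite ltr_wpDl// mulr_ge0.
have eA : 0 < e / A by rewrite divr_gt0.
have [N1 _ N1P] := cvgr0_norm_le _ (exceed_cvg0 (measurable_sqnorm2 mV)) _ eA.
(* The first bound controls the tail of V, the second, by Markov's inequality, the tails of all U
   n. *)
pose n1 := maxn N1 (Num.bound (A * B / e)).+1.
pose c : R := n1%:R.
(* [c] bounds the squared norm and is also the radius of the ball: for c >= 1, |x|^2 <= c implies
   |x| <= c. *)
have c1 : 1 <= c by rewrite ler1n /n1 leq_max orbT.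
have c0 : 0 < c by exact: lt_le_trans c1.
have cB : A * (c^-1 * B) <= e.
  rewrite mulrCA mulrC ler_pdivrMr//.
  have /archi_boundP : 0 <= A * B / e by apply: divr_ge0; [apply: mulr_ge0 => //|]; exact: ltW.
  rewrite ltr_pdivrMr// => /ltW /le_trans; apply.
  by rewrite mulrC ler_pM2l// ler_nat /n1 leq_max leqnSn orbT.
have tailV : A * \int[Q]_w ((c < `|sqnorm2 (V w)|)%R%:R : R) <= e.
  rewrite -ler_pdivlMl// mulrC (le_trans (ler_norm _))//.
  by apply: N1P; rewrite /= /n1 leq_maxl.
have mq n := measurable_sqnorm2 (mU n).
have tailU n : A * \int[P]_w ((c < `|sqnorm2 (U n w)|)%R%:R : R) <= e.
  apply: le_trans cB; rewrite ler_pM2l//.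
  apply: (@le_trans _ _ (\int[P]_w (c^-1 * sqnorm2 (U n w)))).
    apply: Rintegral_le; [exact: rint_exceed|exact: rintZ|move=> w].
    have s0 : 0 <= sqnorm2 (U n w) by apply: sumr_ge0 => i _; exact: sqr_ge0.
    rewrite (ger0_norm s0); case: ltP => [cs|_]; last by rewrite mulr_ge0// invr_ge0 ltW.
    by rewrite mulrC ler_pdivlMr// mul1r ltW.
  by rewrite Rintegral_scale// ler_pM2l// invr_gt0.
have [g [tg gM gh]] := trig_approx ch hM c0 e0.
have hg x : `|h x - g x| <= e + A * (c < `|sqnorm2 x|)%R%:R.
  have s0 : 0 <= sqnorm2 x by apply: sumr_ge0 => i _; exact: sqr_ge0.
  rewrite (ger0_norm s0); case: ltP => [_|sc].
    rewrite mulr1 (le_trans (ler_normB _ _))// (le_trans (lerD (hM x) (gM x)))//.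
    by rewrite /A; lra.
  rewrite mulr0 addr0 distrC; apply: gh.
  have := norm_le_sqnorm2 x => /le_trans /(_ sc) xc.
  rewrite -ler_sqr ?nnegrE ?(ltW c0)// (le_trans xc)//.
  by rewrite expr2 ler_peMr// ltW.
have close d0 (T0 : measurableType d0) (P0 : probability T0 R) (U0 : T0 -> 'cV[R]_p) :
    (forall j, measurable_fun setT (fun w => U0 w j 0)) ->
    A * \int[P0]_w ((c < `|sqnorm2 (U0 w)|)%R%:R : R) <= e ->
    `|\int[P0]_w h (U0 w) - \int[P0]_w g (U0 w)| <= 2 * e.
  move=> mU0 tail.
  have ih : rint P0 (fun w => h (U0 w)).
    exact: bounded_integrable (measurable_continuous_comp mU0 ch hM) (fun w => hM (U0 w)).
  have ig : rint P0 (fun w => g (U0 w)).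
    exact: bounded_integrable (measurable_trig mU0 tg) (fun w => gM (U0 w)).
  have it : rint P0 (fun w => (c < `|sqnorm2 (U0 w)|)%R%:R).
    exact: rint_exceed (measurable_sqnorm2 mU0).
  rewrite -Rintegral_sub//.
  apply: (@le_trans _ _ (\int[P0]_w (e + A * (c < `|sqnorm2 (U0 w)|)%R%:R))).
    apply: norm_Rintegral_le => [||w]; last exact: hg.
      exact: rintB.
    by apply: rintD; [exact: rint_cst|exact: rintZ].
  rewrite Rintegral_add; [|exact: rint_cst|exact: rintZ].
  by rewrite Rintegral_probability_cst Rintegral_scale//; lra.
have := trig_cvg tg => /cvgrPdist_le /(_ _ e0); apply: filterS => n gn.
have h1 := close _ _ _ _ mV tailV; have h2 := close _ _ _ _ (mU n) (tailU n).
move: h1 h2 gn; rewrite !ler_norml => /andP[? ?] /andP[? ?] /andP[? ?].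
by apply/andP; split; lra.
Qed.

End convergence_in_law.

(** * The rescaled SLOPE objective *)

Section scaled_weights.
Context {R : realType} {p : nat}.
Variables (lam_ : nat -> 'cV[R]_p) (lam : 'cV[R]_p).
Hypothesis lam_weights : forall n, slope_weights (lam_ n).
Hypothesis lam_cvg : (Num.sqrt n%:R)^-1 *: lam_ n @[n --> \oo] --> lam.

Definition scaled_weights n := (Num.sqrt n%:R)^-1 *: lam_ n.

Lemma slope_weights_scaled n : slope_weights (scaled_weights n).
Proof.
have [ldec l0] := lam_weights n; split => [i j ij|i]; rewrite !mxE.
  by rewrite ler_wpM2l ?invr_ge0 ?sqrtr_ge0// ldec.
by rewrite mulr_ge0 ?invr_ge0 ?sqrtr_ge0.
Qed.

Lemma scaled_weights_near (e : R) : 0 < e ->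
  exists N : nat, forall n, (N <= n)%N -> `|scaled_weights n - lam| <= e.
Proof.
move=> e0; have /cvgrPdist_le /(_ _ e0)[N _ NP] := lam_cvg.
by exists N => n Nn; rewrite distrC; exact: NP.
Qed.

Lemma slope_weights_lim : slope_weights lam.
Proof.
have near (e : R) : 0 < e -> exists n, forall i, `|scaled_weights n i 0 - lam i 0| <= e.
  move=> e0; have [N NP] := scaled_weights_near e0; exists N => i.
  by have := ler_coord_norm (scaled_weights N - lam) i; rewrite !mxE => /le_trans; apply; exact: NP.
split => [i j ij|i]; apply/ler_addgt0Pr => e e0.
  have e2 : 0 < e / 2 by rewrite divr_gt0.
  have [n nP] := near _ e2; have [/(_ i j ij) dec _] := slope_weights_scaled n.
  have := nP i; have := nP j; rewrite !ler_norml => /andP[? ?] /andP[? ?]; lra.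
have [n nP] := near _ e0; have [_ /(_ i) l0] := slope_weights_scaled n.
have := nP i; rewrite !ler_norml => /andP[? ?]; lra.
Qed.

Variable beta0 : 'cV[R]_p.

Definition scaled_increment n (u : 'cV[R]_p) : R := Num.sqrt n%:R *
  (slope_norm (scaled_weights n) (beta0 + (Num.sqrt n%:R)^-1 *: u)
   - slope_norm (scaled_weights n) beta0).

Let D := dir_deriv (slope_norm lam) beta0.

Lemma quad_coercive_near (C M : 'M[R]_p) (c e : R) : coercive C c ->
  (forall i j, `|(M - C) i j| <= e) -> coercive M (c - p%:R ^+ 2 * e).
Proof.
move=> Cc MC v; have := Cc v; have := norm_quad_le v MC.
by rewrite quadB ler_norml => /andP[? ?]; lra.
Qed.

(** The choice of [e] and [N] precedes [w] and [Cn], so the lemma can be applied sample by sample.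
    Both minimizers lie in one ball, on which the objectives are uniformly close. *)
Lemma argmin_close (C : 'M[R]_p) (F : 'cV[R]_p -> 'cV[R]_p) (K r : R) :
  pos_def C -> (forall w, argmin (quad_objective C D w) (F w)) ->
  0 <= K -> 0 < r ->
  exists2 e : R, 0 < e & exists N : nat, forall n Cn w u, (N <= n)%N ->
    (forall i j, `|(Cn - C) i j| <= e) -> `|w| <= K ->
    argmin (quad_objective Cn (scaled_increment n) w) u -> `|F w - u| <= r.
Proof.
move=> Cpos Fmin K0 r0.
have [c0 c00 Cc0] := pos_def_lower_bound Cpos.
have lw := slope_weights_lim.
have DL : lipschitz_midconvex _ D := dir_deriv_lipschitz_midconvex beta0 lw.
(* Half of the constant of C, still valid for every Cn within [e] of C. *)
pose c := c0 / 2; have c_gt0 : 0 < c by rewrite divr_gt0.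
have Cc : coercive C c.
  move=> v; apply: le_trans (Cc0 v); rewrite ler_wpM2r ?sqr_ge0//.
  by rewrite /c; lra.
have [g g0 gP] := slope_increment_cvg beta0.
(* The extra 1 lets L also bound the sum of the scaled weights at large n. *)
pose L := \sum_(i < p) lam i 0 + 1.
have L0 : 0 <= L by rewrite addr_ge0// sumr_ge0// => i _; case: lw => _; exact.
have pK : 0 <= p%:R * K by rewrite mulr_ge0.
pose R0 := 4 * (p%:R * K + L) / c.
have R00 : 0 <= R0 by apply: divr_ge0; [apply: mulr_ge0 => //; exact: addr_ge0|exact: ltW].
have pp : 0 <= p%:R ^+ 2 :> R by exact: sqr_ge0.
(* Chosen so that [argmin_stable] with error 2 tau returns exactly r ^+ 2. *)
pose tau := r ^+ 2 * c / 8.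
have tau0 : 0 < tau by rewrite divr_gt0// mulr_gt0// exprn_gt0.
pose e := Num.min (c / (p%:R ^+ 2 + 1)) (tau / (p%:R ^+ 2 * R0 ^+ 2 + 1)).
have pp1 : 0 < p%:R ^+ 2 + 1 :> R by rewrite ltr_wpDl.
have pR1 : 0 < p%:R ^+ 2 * R0 ^+ 2 + 1 by rewrite ltr_wpDl// mulr_ge0// sqr_ge0.
have e0 : 0 < e by rewrite lt_min (divr_gt0 c_gt0 pp1) (divr_gt0 tau0 pR1).
have ec : p%:R ^+ 2 * e <= c.
  have : e <= c / (p%:R ^+ 2 + 1) by rewrite ge_min lexx.
  by rewrite ler_pdivlMr//; lra.
have etau : p%:R ^+ 2 * e * R0 ^+ 2 <= tau.
  have : e <= tau / (p%:R ^+ 2 * R0 ^+ 2 + 1) by rewrite ge_min lexx orbT.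
  by rewrite ler_pdivlMr//; lra.
have boundR (l w u : _) (D' : 'cV[R]_p -> R) (M : 'M[R]_p) : coercive M c ->
    lipschitz_midconvex l D' -> l <= L -> `|w| <= K ->
    argmin (quad_objective M D' w) u -> `|u| <= R0.
  move=> Mc Dl lL wK um; apply: le_trans (argmin_bound c_gt0 Mc Dl um) _.
  rewrite /R0 ler_pM2r ?invr_gt0// ler_pM2l// lerD// ler_wpM2l//.
exists e => //.
(* The first bound makes the penalties differ by at most tau on the ball of radius R0, the second
   keeps the sum of the weights below L. *)
pose kap := Num.min (tau / (p%:R * R0 + 1)) (p%:R + 1)^-1.
have pR : 0 < p%:R * R0 + 1 by rewrite ltr_wpDl// mulr_ge0.
have p1 : 0 < p%:R + 1 :> R by rewrite ltr_wpDl.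
have kap0 : 0 < kap by rewrite lt_min divr_gt0// invr_gt0.
have [N1 N1P] := scaled_weights_near kap0.
have [N2 N20 N2P] := nat_sqrt_large (g^-1 * R0).
exists (maxn N1 N2) => n Cn w u; rewrite geq_max => /andP[Nn1 Nn2] CnC wK um.
have n0 : (0 < n)%N by exact: leq_trans Nn2.
have rn0 : 0 < Num.sqrt n%:R :> R by rewrite sqrtr_gt0 ltr0n.
have lk : \sum_(i < p) `|(scaled_weights n - lam) i 0| <= p%:R * kap.
  by apply: le_trans (l1_le_norm _) _; rewrite ler_wpM2l// N1P.
have kap1 : p%:R * kap <= 1.
  have : kap <= (p%:R + 1)^-1 by rewrite ge_min lexx orbT.
  by rewrite -[leRHS]mul1r ler_pdivlMr//; lra.
have kapt : p%:R * kap * R0 <= tau.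
  have : kap <= tau / (p%:R * R0 + 1) by rewrite ge_min lexx.
  by rewrite ler_pdivlMr//; lra.
have Ln : \sum_(i < p) scaled_weights n i 0 <= L.
  rewrite /L -lerBlDl -sumrB (le_trans _ kap1)// (le_trans _ lk)//.
  by apply: ler_sum => i _; rewrite !mxE ler_norm.
have Gn : lipschitz_midconvex _ (scaled_increment n) :=
  increment_lipschitz_midconvex beta0 (slope_weights_scaled n) rn0.
have Cnc : coercive Cn c.
  move=> v; apply: le_trans (quad_coercive_near Cc0 CnC v).
  by rewrite ler_wpM2r ?sqr_ge0// lerBrDr /c; move: ec; rewrite /c; lra.
have uR := boundR _ w u _ Cn Cnc Gn Ln wK um.
have FR : `|F w| <= R0.
  by apply: (boundR _ w (F w) D C Cc DL _ wK (Fmin w)); rewrite /L lerDl.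
have := argmin_stable c_gt0 Cc Cnc DL Gn (Fmin w) um FR uR (e := 2 * tau) _.
have -> : 4 * (2 * tau) / c = r ^+ 2 by rewrite /tau; field; rewrite gt_eqF.
rewrite ler_sqr ?nnegrE ?(ltW r0)//; apply => v vR.
have vg : `|v| <= g * Num.sqrt n%:R.
  by rewrite (le_trans vR)// -ler_pdivrMl// N2P.
have h1 := gP lam (scaled_weights n) v n n0 vg; rewrite -/(scaled_increment n v) -/(D v) in h1.
have h2 : `|scaled_increment n v - D v| <= tau.
  apply: le_trans h1 _; apply: le_trans kapt.
  by rewrite ler_pM// sumr_ge0.
have h3 : `|quad (Cn - C) v| <= tau.
  apply: le_trans (norm_quad_le v CnC) _; apply: le_trans etau.
  by rewrite ler_wpM2l ?mulr_ge0 ?(ltW e0)// lerXn2r ?nnegrE.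
move: h2 h3; rewrite quadB !ler_norml => /andP[? ?] /andP[? ?].
by apply/andP; split; lra.
Qed.

End scaled_weights.

(** * Sequences of independent pairs *)

Section independent_pairs.
Context d (T : measurableType d) (R : realType) (P : probability T R).
Context d1 (T1 : measurableType d1) d2 (T2 : measurableType d2).
Variables (X : nat -> {RV P >-> T1}) (Z : nat -> {RV P >-> T2}).
Hypothesis X_iid : iid X.
Hypothesis Z_iid : iid Z.
Hypothesis XZ : independent2 P (sigma_of_seq X) (sigma_of_seq Z).

Lemma sigma_of_measurable d' (S : measurableType d') (V : {mfun T >-> S}) :
  sigma_of V `<=` measurable.
Proof. by move=> _ [B mB <-]; exact: (measurable_funPT V). Qed.

Lemma sigma_ofT d' (S : measurableType d') (V : T -> S) : sigma_of V setT.
Proof. by exists setT => //; rewrite preimage_setT setTI. Qed.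

Lemma sigma_ofI d' (S : measurableType d') (V : T -> S) : setI_closed (sigma_of V).
Proof.
move=> _ _ [A mA <-] [B mB <-]; exists (A `&` B); first exact: measurableI.
by rewrite preimage_setI !setTI.
Qed.

Lemma sigma_of_preimage d' (S : measurableType d') (V : T -> S) (B : set S) :
  measurable B -> sigma_of V (V @^-1` B).
Proof. by move=> mB; exists B => //; rewrite setTI. Qed.

Lemma sigma_of_seq_bigcap d' (S : measurableType d') (V : nat -> T -> S)
    (s : seq nat) (E : nat -> set T) : (forall i, sigma_of (V i) (E i)) ->
  sigma_of_seq V (\bigcap_(i in [set` s]) E i).
Proof.
move=> VE; rewrite bigcap_seq; elim/big_ind : _ => [|A B hA hB|i _].
- by apply: sub_sigma_algebra; exists 0%N => //; exact: sigma_ofT.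
- have := @measurableI _ (g_sigma_algebraType (\bigcup_i sigma_of (V i))) A B.
  by apply.
- by apply: sub_sigma_algebra; exists i => //; exact: VE.
Qed.

(** A family stable under intersection that generates the events decided by the pairs with index in
    [s]. Assigning events to all indices makes intersections componentwise. *)
Definition cylinders (s : seq nat) : set_system T := [set A |
  exists E F : nat -> set T, [/\ forall i, sigma_of (X i) (E i),
    forall i, sigma_of (Z i) (F i) &
    A = (\bigcap_(i in [set` s]) E i) `&` (\bigcap_(i in [set` s]) F i)]].

Lemma cylinders_prob s E F : uniq s -> (forall i, sigma_of (X i) (E i)) ->
  (forall i, sigma_of (Z i) (F i)) ->
  P ((\bigcap_(i in [set` s]) E i) `&` (\bigcap_(i in [set` s]) F i)) =
  (\prod_(i <- s) P (E i) * \prod_(i <- s) P (F i))%E.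
Proof.
move=> us sE sF; rewrite XZ; [|exact: sigma_of_seq_bigcap|exact: sigma_of_seq_bigcap].
by rewrite X_iid.1// Z_iid.1.
Qed.

Lemma cylindersI s : setI_closed (cylinders s).
Proof.
move=> _ _ [E [F [sE sF ->]]] [E' [F' [sE' sF' ->]]].
exists (fun i => E i `&` E' i), (fun i => F i `&` F' i); split.
- by move=> i; exact: sigma_ofI.
- by move=> i; exact: sigma_ofI.
- by rewrite !bigcapI setIACA.
Qed.

Lemma cylindersT s : cylinders s setT.
Proof.
exists (fun=> setT), (fun=> setT); split; try by move=> i; exact: sigma_ofT.
by apply/seteqP; split.
Qed.

Lemma cylinders_measurable s : cylinders s `<=` measurable.
Proof.
move=> _ [E [F [sE sF ->]]]; rewrite !bigcap_seq.
apply: measurableI; apply: bigsetI_measurable => i _.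
  exact: (sigma_of_measurable (sE i)).
exact: (sigma_of_measurable (sF i)).
Qed.

(** Gluing the events along the concatenated index list turns the intersection into a single
    cylinder, whose probability factors. *)
Lemma cylinders_independent s s' : uniq (s ++ s') ->
  independent2 P (cylinders s) (cylinders s').
Proof.
move=> us _ _ [E [F [sE sF ->]]] [E' [F' [sE' sF' ->]]].
have /andP[us1 /andP[hss us2]] : [&& uniq s, ~~ has (mem s) s' & uniq s'].
  by rewrite -cat_uniq.
rewrite (cylinders_prob us1 sE sF) (cylinders_prob us2 sE' sF').
pose glue (A B : nat -> set T) i := if i \in s then A i else B i.
have glueP A B : \bigcap_(i in [set` s ++ s']) glue A B i =
    (\bigcap_(i in [set` s]) A i) `&` (\bigcap_(i in [set` s']) B i).
  apply/seteqP; split => [w ABw|w [Aw Bw] i /=].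
    split=> i /= si; have := ABw i; rewrite /= mem_cat si ?orbT /glue => /(_ isT).
      by rewrite si.
    by rewrite ifN//; apply: contra hss => ss; apply/hasP; exists i.
  by rewrite mem_cat /glue; case: ifP => [si _|_ /= si]; [exact: Aw|exact: Bw].
rewrite setIACA -!glueP cylinders_prob//; last 2 first.
- by move=> i; rewrite /glue; case: ifP.
- by move=> i; rewrite /glue; case: ifP.
have glueM A B : (\prod_(i <- s ++ s') P (glue A B i) =
    \prod_(i <- s) P (A i) * \prod_(i <- s') P (B i))%E.
  rewrite big_cat; congr (_ * _)%E; apply: eq_big_seq => i si; rewrite /glue.
    by rewrite si.
  by rewrite ifN//; apply: contra hss => ss; apply/hasP; exists i.
by rewrite !glueM muleACA.
Qed.

Lemma measurable_pair_cylinders s i (f : T1 * T2 -> R) : i \in s ->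
  measurable_fun setT f ->
  measurable_fun [set: g_sigma_algebraType (cylinders s)]
    (fun w : g_sigma_algebraType (cylinders s) => f (X i w, Z i w)).
Proof.
move=> si mf.
(* The other indices receive the full event. *)
have single (A B : set T) : sigma_of (X i) A -> sigma_of (Z i) B ->
    cylinders s (A `&` B).
  move=> sA sB; exists (fun j => if j == i then A else setT),
    (fun j => if j == i then B else setT); split.
  - by move=> j; case: eqP => [->//|_]; exact: sigma_ofT.
  - by move=> j; case: eqP => [->//|_]; exact: sigma_ofT.
  - apply/seteqP; split => w.
      by move=> [Aw Bw]; split => j _ /=; case: eqP.
    by move=> [/(_ i si) + /(_ i si)]; rewrite /= eqxx.
have mXi : measurable_fun [set: g_sigma_algebraType (cylinders s)]
    (X i : g_sigma_algebraType (cylinders s) -> T1).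
  move=> _ B mB; rewrite setTI; apply: sub_sigma_algebra.
  rewrite -[X in cylinders s X]setIT; apply: single; last exact: sigma_ofT.
  exact: sigma_of_preimage.
have mZi : measurable_fun [set: g_sigma_algebraType (cylinders s)]
    (Z i : g_sigma_algebraType (cylinders s) -> T2).
  move=> _ B mB; rewrite setTI; apply: sub_sigma_algebra.
  rewrite -[X in cylinders s X]setTI; apply: single; first exact: sigma_ofT.
  exact: sigma_of_preimage.
have mXZ : measurable_fun [set: g_sigma_algebraType (cylinders s)]
    (fun w : g_sigma_algebraType (cylinders s) => (X i w, Z i w)).
  by apply/measurable_fun_pairP; split.
exact (measurableT_comp mf mXZ).
Qed.

Variable f : T1 * T2 -> R.
Hypothesis mf : measurable_fun setT f.
Let Y n w := f (X n w, Z n w).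

Lemma indep_XZ n : indep_fun P (X n) (Z n).
Proof.
move=> A B mA mB; apply: XZ; apply: sub_sigma_algebra; exists n => //.
  exact: sigma_of_preimage.
exact: sigma_of_preimage.
Qed.

Lemma measurable_pairs n : measurable_fun setT (Y n).
Proof.
have mXZ : measurable_fun setT (fun w => (X n w, Z n w)).
  by apply/measurable_fun_pairP; split; exact: measurable_funPT.
exact (measurableT_comp mf mXZ).
Qed.

(** The partial sum is decided by the pairs 0, ..., n - 1 and the new term by the pair n. *)
Lemma indep_pairs n : indep_fun P (partial_sum Y n) (Y n).
Proof.
move=> A B mA mB.
have ind : independent2 P <<s cylinders (iota 0 n) >> <<s cylinders [:: n] >>.
  apply: independent2_sigma; try exact: cylindersI; try exact: cylinders_measurable;
    try exact: cylindersT.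
  apply: cylinders_independent.
  by rewrite cats1 rcons_uniq iota_uniq mem_iota add0n ltnn andbF.
apply: ind.
  have mS : measurable_fun [set: g_sigma_algebraType (cylinders (iota 0 n))]
      (partial_sum Y n : g_sigma_algebraType (cylinders (iota 0 n)) -> R).
    apply: measurable_sum => i; apply: measurable_pair_cylinders => //.
    by rewrite mem_iota add0n ltn_ord.
  by have := mS measurableT A mA; rewrite setTI.
have mYn : measurable_fun [set: g_sigma_algebraType (cylinders [:: n])]
    (Y n : g_sigma_algebraType (cylinders [:: n]) -> R).
  by apply: measurable_pair_cylinders => //; rewrite mem_seq1.
by have := mYn measurableT B mB; rewrite setTI.
Qed.

Lemma ident_pairs n A : measurable A -> P (Y n @^-1` A) = P (Y 0%N @^-1` A).
Proof.
move=> mA.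
have mfA : measurable (f @^-1` A) by rewrite -[X in measurable X]setTI; exact: mf.
exact: (eq_joint_law (@indep_XZ 0) (@indep_XZ n) (X_iid.2 n) (Z_iid.2 n) mfA).
Qed.

End independent_pairs.

(** * Score vectors, Gram matrices and the limit law *)

Section borel_vectors.
Context {R : realType} {p : nat}.

Lemma borel_measurable_continuous (f : 'cV[R]_p -> R) : continuous f ->
  measurable_fun [set: borel_cV R p] (f : borel_cV R p -> R).
Proof.
move=> cf; apply: (measurability _ (RGenOInfty.measurableE R)).
move=> _ [_ [a ->] <-]; rewrite setTI; apply: sub_sigma_algebra.
by apply: open_comp; [move=> x _; exact: cf|exact: interval_open].
Qed.

Lemma borel_measurable_continuous_vector q (f : 'cV[R]_p -> 'cV[R]_q) : continuous f ->
  measurable_fun [set: borel_cV R p] (f : borel_cV R p -> borel_cV R q).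
Proof.
move=> cf; apply: (@measurability _ _ _ (borel_cV R q) _ _ (@open 'cV[R]_q)) => //.
move=> _ [B oB <-]; rewrite setTI; apply: sub_sigma_algebra.
by apply: open_comp => // x _; exact: cf.
Qed.

Lemma dotC (u w : 'cV[R]_p) : dot u w = dot w u.
Proof. by rewrite !dotE; apply: eq_bigr => i _; rewrite mulrC. Qed.

Lemma continuous_dotr (t : 'cV[R]_p) : continuous (dot t).
Proof. by rewrite (_ : dot t = dot ^~ t); [exact: continuous_dot|apply/funext => x; rewrite dotC]. Qed.

End borel_vectors.

(** * Rescaling the least squares objective *)

Section design_algebra.
Context {R : realType} {p n : nat}.
Variables (A : 'M[R]_(n, p)) (err : 'cV[R]_n) (lam beta0 : 'cV[R]_p).

Lemma sqnorm2E m (v : 'cV[R]_m) : sqnorm2 v = (v^T *m v) 0 0.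
Proof. by rewrite mxE; apply: eq_bigr => i _; rewrite mxE expr2. Qed.

(** The first two terms are free of [u], so minimizers correspond. The factor sqrt n in the
    increment undoes the division of the weights. *)
Lemma slope_objective_rescaled (u : 'cV[R]_p) : (0 < n)%N ->
  slope_objective lam A (A *m beta0 + err) (beta0 + (Num.sqrt n%:R)^-1 *: u) =
  2^-1 * sqnorm2 err + slope_norm lam beta0 +
  quad_objective (n%:R^-1 *: (A^T *m A))
    (fun v => Num.sqrt n%:R *
      (slope_norm ((Num.sqrt n%:R)^-1 *: lam) (beta0 + (Num.sqrt n%:R)^-1 *: v)
       - slope_norm ((Num.sqrt n%:R)^-1 *: lam) beta0))
    ((Num.sqrt n%:R)^-1 *: (A^T *m err)) u.
Proof.
move=> n0; have rn0 : 0 < Num.sqrt n%:R :> R by rewrite sqrtr_gt0 ltr0n.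
rewrite /slope_objective /quad_objective !slope_norm_weightsZ.
set r := Num.sqrt n%:R in rn0 *.
have r2 : r^-1 ^+ 2 = n%:R^-1 by rewrite exprVn sqr_sqrtr.
have -> : A *m beta0 + err - A *m (beta0 + r^-1 *: u) = err - r^-1 *: (A *m u).
  by rewrite mulmxDr -scalemxAr opprD addrACA subrr add0r.
have -> : quad (n%:R^-1 *: (A^T *m A)) u = n%:R^-1 * sqnorm2 (A *m u).
  by rewrite /quad sqnorm2E trmx_mul -scalemxAr -scalemxAl !mulmxA mxE.
have -> : dot u (r^-1 *: (A^T *m err)) = r^-1 * dot (A *m u) err.
  by rewrite /dot trmx_mul -scalemxAr mulmxA mxE.
have -> : sqnorm2 (err - r^-1 *: (A *m u)) =
    sqnorm2 err - 2 * (r^-1 * dot (A *m u) err) + n%:R^-1 * sqnorm2 (A *m u).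
  rewrite dotE /sqnorm2 -r2 !mulr_sumr -sumrB -big_split; apply: eq_bigr => i _.
  by rewrite /= !mxE; ring.
have E (a b : R) : r * (r^-1 * a - r^-1 * b) = a - b by field; rewrite gt_eqF.
rewrite E; move: (r^-1 * _) (n%:R^-1 * _) => a b.
by field.
Qed.

Lemma argmin_rescaled (b : 'cV[R]_p) : (0 < n)%N ->
  argmin (slope_objective lam A (A *m beta0 + err)) b ->
  argmin (quad_objective (n%:R^-1 *: (A^T *m A))
    (fun v => Num.sqrt n%:R *
      (slope_norm ((Num.sqrt n%:R)^-1 *: lam) (beta0 + (Num.sqrt n%:R)^-1 *: v)
       - slope_norm ((Num.sqrt n%:R)^-1 *: lam) beta0))
    ((Num.sqrt n%:R)^-1 *: (A^T *m err))) (Num.sqrt n%:R *: (b - beta0)).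
Proof.
move=> n0 bmin u.
have rn0 : Num.sqrt n%:R != 0 :> R by rewrite gt_eqF// sqrtr_gt0 ltr0n.
have := bmin (beta0 + (Num.sqrt n%:R)^-1 *: u).
have bE : b = beta0 + (Num.sqrt n%:R)^-1 *: (Num.sqrt n%:R *: (b - beta0)).
  by rewrite scalerA mulVf// scale1r addrC subrK.
by rewrite {1}bE !slope_objective_rescaled// lerD2l.
Qed.

End design_algebra.

Section moments.
Context d (T : measurableType d) (R : realType) (P : probability T R).

Lemma expectation_Rintegral (f : T -> R) : rint P f -> ('E_P[f] = (\int[P]_w f w)%:E)%E.
Proof.
by move=> fi; rewrite unlock /Rintegral fineK//; exact: integrable_fin_num.
Qed.

Lemma Lfun2_moments (U V : T -> R) (c : R) :
  U \in Lfun P 2%:E -> V \in Lfun P 2%:E ->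
  ('E_P[U] = 0)%E -> ('E_P[V] = 0)%E -> covariance P U V = c%:E ->
  [/\ rint P U, \int[P]_w U w = 0, rint P (fun w => U w * V w) &
    \int[P]_w (U w * V w) = c].
Proof.
move=> U2 V2 U0 V0 UV.
have fP : P setT \is a fin_num by rewrite fin_num_measure.
have U1 := Lfun_subset12 fP U2; have V1 := Lfun_subset12 fP V2.
have UV1 := Lfun2_mul_Lfun1 U2 V2.
have iU : rint P U by exact/Lfun1_integrable.
have iUV : rint P (fun w => U w * V w) by exact/Lfun1_integrable.
split => //; first by have := expectation_Rintegral iU; rewrite U0 => -[] <-.
move: UV; rewrite covarianceE// U0 V0 mul0e sube0.
by rewrite (expectation_Rintegral iUV) => -[].
Qed.

End moments.

(** * Characteristic function of a Gaussian vector *)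

Section gaussian_characteristic_function.
Context {R : realType} {p : nat}.
Context d (T : measurableType d) (Q : probability T R).

Lemma normal_law_integral (v : R) (Z : {mfun T >-> measurableTypeR R}) (f : R -> R) (M : R) :
  0 <= v -> (forall A, measurable A -> distribution Q Z A = normal_law 0 v A) ->
  measurable_fun setT f -> (forall x, `|f x| <= M) ->
  \int[Q]_w f (Z w) = if v == 0 then f 0 else
    \int[lebesgue_measure]_x (f x * normal_pdf 0 (Num.sqrt v) x).
Proof.
move=> v0 Zlaw mf fM.
have mf' : measurable_fun setT (EFin \o f) by exact/measurable_EFinP.
have E : (\int[Q]_w (f (Z w))%:E = \int[distribution Q Z]_x (f x)%:E)%E.
  rewrite integral_distribution//.
  apply: (@bounded_integrable _ _ _ _ _ M) => //.
  by exact (measurableT_comp mf (measurable_funPT Z)).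
move: Zlaw; rewrite /normal_law; have [_|vn0] := eqVneq v 0 => Zlaw.
  rewrite /Rintegral E (eq_measure_integral (\d_(0 : measurableTypeR R))) => [|A mA _]; last exact: Zlaw.
  by rewrite integral_dirac// diracT mul1e.
rewrite -(Rintegral_normal_prob (Num.sqrt v) mf fM) /Rintegral E; congr fine.
by apply: eq_measure_integral => A mA _; exact: Zlaw.
Qed.

Lemma gaussian_char (W : {RV Q >-> borel_cV R p}) (S : 'M[R]_p) (t : 'cV[R]_p) :
  gaussian_vector W 0 S -> 0 <= quad S t ->
  \int[Q]_w cos (dot t (W w)) = expR (- (quad S t / 2)) /\
  \int[Q]_w sin (dot t (W w)) = 0.
Proof.
move=> WG v0.
have mZ : @measurable_fun _ _ T (measurableTypeR R) setT (fun w => dot t (W w)).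
  exact (measurableT_comp (borel_measurable_continuous (@continuous_dotr _ _ t))
    (measurable_funPT W)).
pose Z : {mfun T >-> measurableTypeR R} :=
  @mfun_Sub _ _ T (measurableTypeR R) _ (mem_set mZ).
have Zlaw A : measurable A -> distribution Q Z A = normal_law 0 (quad S t) A.
  by move=> mA; have := WG t A mA; rewrite mulmx0 mxE.
have mc : measurable_fun [set: R] (@cos R).
  by apply: continuous_measurable_fun; exact: continuous_cos.
have ms : measurable_fun [set: R] (@sin R).
  by apply: continuous_measurable_fun; exact: continuous_sin.
have hc := normal_law_integral v0 Zlaw mc (@cos_max R).
have hs := normal_law_integral v0 Zlaw ms (@sin_max R).
rewrite -[\int[Q]_w cos _]/(\int[Q]_w cos (Z w)) -[\int[Q]_w sin _]/(\int[Q]_w sin (Z w)).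
rewrite hc hs; have [->|vn0] := eqVneq (quad S t) 0.
  by rewrite cos0 sin0 mul0r oppr0 expR0.
have s0 : Num.sqrt (quad S t) != 0 by rewrite gt_eqF// sqrtr_gt0 lt_neqAle eq_sym vn0.
split.
  rewrite (_ : \int[_]_x _ = phase_cos (Num.sqrt (quad S t)) 1 0).
    by rewrite phase_cosE// cos0 mul1r expr1n mulr1 sqr_sqrtr.
  by apply: eq_Rintegral => x _; rewrite mul1r addr0.
(* The sine is the cosine with phase - pi / 2, and cos(- pi / 2) = 0. *)
rewrite (_ : \int[_]_x _ = phase_cos (Num.sqrt (quad S t)) 1 (- (pi / 2))).
  by rewrite phase_cosE// cosN cos_pihalf mul0r.
by apply: eq_Rintegral => x _; rewrite mul1r cosBpihalf.
Qed.

End gaussian_characteristic_function.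

(** * Limits of the score and of the Gram matrix *)

Section score_and_gram.
Context (R : realType) (p : nat) (d : measure_display) (T : measurableType d).
Variables (P : probability T R) (C : 'M[R]_p) (sigma : R).
Variables (X : nat -> {RV P >-> borel_cV R p}) (eps : nat -> {RV P >-> R}).
Hypothesis X_iid : iid X.
Hypothesis X_L2 : forall i j, coord (X i) j \in Lfun P 2%:E.
Hypothesis X_centered : forall i j, ('E_P[coord (X i) j] = 0)%E.
Hypothesis X_cov : forall i j k,
  covariance P (coord (X i) j) (coord (X i) k) = (C j k)%:E.
Hypothesis eps_iid : iid eps.
Hypothesis eps_L2 : forall i, (eps i : T -> R) \in Lfun P 2%:E.
Hypothesis eps_centered : forall i, ('E_P[eps i] = 0)%E.
Hypothesis eps_var : forall i, ('V_P[eps i] = (sigma ^+ 2)%:E)%E.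
Hypothesis X_eps_indep : independent2 P (sigma_of_seq X) (sigma_of_seq eps).

Definition noise (n : nat) (w : T) : 'cV[R]_n := \col_(i < n) eps i w.

Definition score (n : nat) (w : T) : 'cV[R]_p :=
  (Num.sqrt n%:R)^-1 *: ((design X n w)^T *m noise n w).

Definition gram (n : nat) (w : T) : 'M[R]_p :=
  n%:R^-1 *: ((design X n w)^T *m design X n w).

(** Score and Gram summands are both written as functions of the pair [(X i, eps i)], so one set of
    independence results for pairs serves both. *)
Let score_fun (t : 'cV[R]_p) (z : borel_cV R p * R) : R := dot t z.1 * z.2.
Let score_term t i w := score_fun t (X i w, eps i w).
Let gram_fun (j k : 'I_p) (z : borel_cV R p * R) : R :=
  (z.1 : 'cV[R]_p) j 0 * (z.1 : 'cV[R]_p) k 0 - C j k.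
Let gram_term j k i w := gram_fun j k (X i w, eps i w).

Lemma measurable_coord_fun (j : 'I_p) :
  measurable_fun [set: borel_cV R p] (fun x : borel_cV R p => (x : 'cV[R]_p) j 0).
Proof. by apply: borel_measurable_continuous; exact: coord_continuous. Qed.

Lemma measurable_score_fun t : measurable_fun setT (score_fun t).
Proof.
apply: measurable_funM; last exact: measurable_snd.
exact (measurableT_comp (borel_measurable_continuous (@continuous_dotr _ _ t)) measurable_fst).
Qed.

Lemma measurable_gram_fun j k : measurable_fun setT (gram_fun j k).
Proof.
apply: measurable_funB => //; apply: measurable_funM.
  exact (measurableT_comp (measurable_coord_fun j) measurable_fst).
exact (measurableT_comp (measurable_coord_fun k) measurable_fst).
Qed.

(** Reduces the vector central limit theorem to the scalar one, a linear functional at a time. *)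
Lemma dot_score t n w :
  dot t (score n w) = (Num.sqrt n%:R)^-1 * partial_sum (score_term t) n w.
Proof.
rewrite /score dotZr; congr (_ * _); rewrite dotE /partial_sum.
transitivity (\sum_(j < p) \sum_(i < n) t j 0 * (X i w : 'cV[R]_p) j 0 * eps i w).
  apply: eq_bigr => j _; rewrite mxE mulr_sumr; apply: eq_bigr => i _.
  by rewrite !mxE /coord mulrA.
rewrite exchange_big; apply: eq_bigr => i _.
by rewrite /score_term /score_fun/= dotE mulr_suml.
Qed.

Lemma gram_entry j k n w : (0 < n)%N ->
  (gram n w - C) j k = n%:R^-1 * partial_sum (gram_term j k) n w.
Proof.
move=> n0; have nn : n%:R != 0 :> R by rewrite pnatr_eq0 -lt0n.
rewrite /partial_sum sumrB sumr_const card_ord mulrBr -[X in _ - _ * X]mulr_natl.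
rewrite mulrA mulVf// mul1r !mxE; congr (_ * _ - _).
by apply: eq_bigr => i _; rewrite !mxE.
Qed.

Lemma coord_moments j k : [/\ rint P (coord (X 0) j), \int[P]_w coord (X 0) j w = 0,
  rint P (fun w => coord (X 0) j w * coord (X 0) k w) &
  \int[P]_w (coord (X 0) j w * coord (X 0) k w) = C j k].
Proof. exact: Lfun2_moments. Qed.

Lemma eps_moments : [/\ rint P (eps 0), \int[P]_w eps 0 w = 0,
  rint P (fun w => eps 0 w * eps 0 w) & \int[P]_w (eps 0 w * eps 0 w) = sigma ^+ 2].
Proof. by apply: Lfun2_moments => //; exact: eps_var. Qed.

Lemma dot_moments t : [/\ rint P (fun w => dot t (X 0 w)),
  \int[P]_w dot t (X 0 w) = 0, rint P (fun w => dot t (X 0 w) ^+ 2) &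
  \int[P]_w (dot t (X 0 w) ^+ 2) = quad C t].
Proof.
have E1 : (fun w => dot t (X 0 w)) = fun w => \sum_(j < p) t j 0 * coord (X 0) j w.
  by apply/funext => w; rewrite dotE.
have E2 : (fun w => dot t (X 0 w) ^+ 2) = fun w => \sum_(j < p) \sum_(k < p)
    (t j 0 * t k 0) * (coord (X 0) j w * coord (X 0) k w).
  apply/funext => w; rewrite dotE expr2 mulr_suml; apply: eq_bigr => j _.
  by rewrite mulr_sumr; apply: eq_bigr => k _; rewrite mulrACA.
have i1 j : rint P (fun w => t j 0 * coord (X 0) j w).
  by apply: rintZ; case: (coord_moments j j).
have i2 j k : rint P (fun w => (t j 0 * t k 0) * (coord (X 0) j w * coord (X 0) k w)).
  by apply: rintZ; case: (coord_moments j k).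
have i2' j : rint P (fun w => \sum_(k < p)
    (t j 0 * t k 0) * (coord (X 0) j w * coord (X 0) k w)).
  by apply: rint_sum => k; exact: i2.
rewrite E1 E2; split.
- exact: rint_sum.
- rewrite Rintegral_finsum// big1// => j _.
  by rewrite Rintegral_scale; case: (coord_moments j j) => // _ -> _ _; rewrite mulr0.
- exact: rint_sum.
- rewrite Rintegral_finsum// quadE; apply: eq_bigr => j _.
  rewrite Rintegral_finsum//; apply: eq_bigr => k _.
  case: (coord_moments j k) => _ _ i3 e3.
  by rewrite Rintegral_scale// e3 mulrAC.
Qed.

(** By independence the second moment of the product factors, so second moments of [X 0] and [eps 0]
    make it finite. *)
Lemma score_term_moments t : [/\ rint P (score_term t 0), \int[P]_w score_term t 0 w = 0,
  rint P (fun w => score_term t 0 w ^+ 2) &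
  \int[P]_w (score_term t 0 w ^+ 2) = sigma ^+ 2 * quad C t].
Proof.
have [d1 d0 d2 dv] := dot_moments t; have [e1 e0 e2 ev] := eps_moments.
have mdot := borel_measurable_continuous (@continuous_dotr _ _ t).
have mul := @indep_mul _ _ _ P _ _ _ _ (X 0) (eps 0) _ _ (measurable_funPT _)
  (measurable_funPT _) (indep_XZ X_eps_indep 0).
have [i1 E1] := mul _ _ mdot (@measurable_id _ _ setT) d1 e1.
have mdot2 : measurable_fun [set: borel_cV R p] (fun x : borel_cV R p => dot t x ^+ 2).
  exact (measurableT_comp (@measurable_sqr R) mdot).
have e2' : rint P (fun w => eps 0 w ^+ 2) by [].
have [i2 E2] := mul _ _ mdot2 (@measurable_sqr R) d2 e2'.
have E : (fun w => score_term t 0 w ^+ 2) = fun w => dot t (X 0 w) ^+ 2 * eps 0 w ^+ 2.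
  by apply/funext => w; rewrite /score_term /score_fun exprMn.
split => //.
- by rewrite [LHS]E1 d0 mul0r.
- by rewrite E.
- by rewrite E [LHS]E2 dv mulrC; congr (_ * _); exact: ev.
Qed.

Lemma score_char t :
  (\int[P]_w cos (dot t (score n w)) @[n --> \oo] -->
     expR (- (sigma ^+ 2 * quad C t / 2))) /\
  (\int[P]_w sin (dot t (score n w)) @[n --> \oo] --> (0 : R)).
Proof.
have [i1 e1 i2 e2] := score_term_moments t.
have mf := measurable_score_fun t.
have [hc hs] := clt_char (measurable_pairs X eps mf)
  (indep_pairs X_iid eps_iid X_eps_indep mf)
  (ident_pairs X_iid eps_iid X_eps_indep mf) i1 e1 i2 e2.
split.
  rewrite (_ : (fun n => _) = fun n => \int[P]_w cos ((Num.sqrt n%:R)^-1 *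
    partial_sum (score_term t) n w)); first exact: hc.
  by apply/funext => n; apply: eq_Rintegral => w _; rewrite dot_score.
rewrite (_ : (fun n => _) = fun n => \int[P]_w sin ((Num.sqrt n%:R)^-1 *
  partial_sum (score_term t) n w)); first exact: hs.
by apply/funext => n; apply: eq_Rintegral => w _; rewrite dot_score.
Qed.

Let unit_vec (j : 'I_p) : 'cV[R]_p := delta_mx j 0.

Lemma dot_unit_vec j x : dot (unit_vec j) x = x j 0.
Proof.
rewrite dotE (bigD1 j)//= big1 ?addr0 => [|i /negbTE ij]; rewrite !mxE ?eqxx ?mul1r//.
by rewrite ij mul0r.
Qed.

Lemma measurable_score n j : measurable_fun setT (fun w => score n w j 0).
Proof.
rewrite (_ : (fun w => _) = fun w => (Num.sqrt n%:R)^-1 *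
    partial_sum (score_term (unit_vec j)) n w).
  apply: measurable_funM => //; apply: measurable_partial_sum => i.
  exact: (measurable_pairs X eps (measurable_score_fun _)).
by apply/funext => w; rewrite -dot_score dot_unit_vec.
Qed.

Definition score_bound : R := \sum_(j < p) sigma ^+ 2 * quad C (unit_vec j).

(** The variance of each coordinate sum is proportional to n and is divided by n. Uniformity in n
    yields tightness. *)
Lemma score_second_moment n : rint P (fun w => sqnorm2 (score n w)) /\
  \int[P]_w sqnorm2 (score n w) <= score_bound.
Proof.
have mom j := let: And4 i1 e1 i2 e2 := score_term_moments (unit_vec j) in
  partial_sum_moments (measurable_pairs X eps (measurable_score_fun _))
    (indep_pairs X_iid eps_iid X_eps_indep (measurable_score_fun _))
    (ident_pairs X_iid eps_iid X_eps_indep (measurable_score_fun _)) i1 e1 i2 e2 n.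
have E : (fun w => sqnorm2 (score n w)) = fun w => \sum_(j < p)
    (Num.sqrt n%:R)^-1 ^+ 2 * partial_sum (score_term (unit_vec j)) n w ^+ 2.
  apply/funext => w; apply: eq_bigr => j _.
  by rewrite -exprMn -dot_score dot_unit_vec.
have ij j : rint P (fun w =>
    (Num.sqrt n%:R)^-1 ^+ 2 * partial_sum (score_term (unit_vec j)) n w ^+ 2).
  by apply: rintZ; case: (mom j).
rewrite E; split; first exact: rint_sum.
rewrite Rintegral_finsum//; apply: ler_sum => j _.
case: (mom j) => _ _ i2 e2; rewrite Rintegral_scale// [X in _ * X]e2.
rewrite exprVn sqr_sqrtr// mulrA.
have v0 : 0 <= sigma ^+ 2 * quad C (unit_vec j).
  case: (score_term_moments (unit_vec j)) => _ _ _ <-.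
  by apply: Rintegral_ge0 => w _; exact: sqr_ge0.
have [->|n0] := eqVneq n 0%N; first by rewrite mulr0 mul0r.
by rewrite mulVf ?pnatr_eq0// mul1r.
Qed.

Lemma gram_cvg (e : R) j k : 0 < e ->
  (forall n, rint P (fun w => (e < `|(gram n w - C) j k|)%R%:R)) /\
  \int[P]_w ((e < `|(gram n w - C) j k|)%R%:R : R) @[n --> \oo] --> (0 : R).
Proof.
move=> e0; have mf := measurable_gram_fun j k.
have [_ _ i2 e2] := coord_moments j k.
have i0 : rint P (gram_term j k 0) by apply: rintB => //; exact: rint_cst.
have z0 : \int[P]_w gram_term j k 0 w = 0.
  by rewrite [LHS]Rintegral_sub//; [rewrite e2 Rintegral_probability_cst subrr|exact: rint_cst].
split=> [n|].
  apply: rint_exceed.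
  rewrite (_ : (fun w => _) = fun w =>
    n%:R^-1 * \sum_(i < n) ((X i w : 'cV[R]_p) j 0 * (X i w : 'cV[R]_p) k 0) - C j k).
    apply: measurable_funB => //; apply: measurable_funM => //.
    apply: measurable_sum => i; apply: measurable_funM.
      exact (measurableT_comp (measurable_coord_fun j) (measurable_funPT (X i))).
    exact (measurableT_comp (measurable_coord_fun k) (measurable_funPT (X i))).
  apply/funext => w; rewrite !mxE; congr (_ * _ - _).
  by apply: eq_bigr => i _; rewrite !mxE.
have := weak_lln (measurable_pairs X eps mf) (indep_pairs X_iid eps_iid X_eps_indep mf)
  (ident_pairs X_iid eps_iid X_eps_indep mf) e0 i0 z0.
(* [gram_entry] asks for n > 0, and the term n = 0 does not affect the limit. *)
apply: cvg_trans; apply: near_eq_cvg; exists 1%N => // n /= n0.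
by apply: eq_Rintegral => w _; rewrite gram_entry.
Qed.

End score_and_gram.

(** * Limit law of the rescaled estimator *)

Theorem theorem2p2 (R : realType) (p : nat)
    (d : measure_display) (T : measurableType d) (P : probability T R)
    (beta0 : 'cV[R]_p) (C : 'M[R]_p) (sigma : R)
    (X : nat -> {RV P >-> borel_cV R p}) (eps : nat -> {RV P >-> R})
    (X_iid : iid X)
    (X_L2 : forall i j, coord (X i) j \in Lfun P 2%:E)
    (X_centered : forall i j, ('E_P[coord (X i) j] = 0)%E)
    (X_cov : forall i j k,
       covariance P (coord (X i) j) (coord (X i) k) = (C j k)%:E)
    (eps_iid : iid eps)
    (eps_L2 : forall i, (eps i : T -> R) \in Lfun P 2%:E)
    (eps_centered : forall i, ('E_P[eps i] = 0)%E)
    (eps_var : forall i, ('V_P[eps i] = (sigma ^+ 2)%:E)%E)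
    (X_eps_indep : independent2 P (sigma_of_seq X) (sigma_of_seq eps))
    (lam_ : nat -> 'cV[R]_p) (lam : 'cV[R]_p)
    (lam_weights : forall n, slope_weights (lam_ n))
    (betahat : nat -> {RV P >-> borel_cV R p})
    (betahat_argmin : forall n w,
       argmin (slope_objective (lam_ n) (design X n w)
                               (response X eps beta0 n w))
              (betahat n w))
    (lam_ge0 : forall i, 0 <= lam i 0)
    (lam_cvg : (Num.sqrt n%:R)^-1 *: lam_ n @[n --> \oo] --> lam)
    (C_pos_def : pos_def C) :
  (forall (d' : measure_display) (T' : measurableType d')
     (Q : probability T' R) (W : {RV Q >-> borel_cV R p}),
     gaussian_vector W 0 (sigma ^+ 2 *: C) ->
     exists uhat : {RV Q >-> borel_cV R p},
       (forall w, argmin (limit_objective C lam beta0 (W w))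
                  = [set (uhat w : 'cV[R]_p)]) /\
       cvg_in_distribution P Q
         (fun n w => Num.sqrt n%:R *: ((betahat n w : 'cV[R]_p) - beta0))
         uhat) /\
  (forall u : 'cV[R]_p,
     (exists s : 'S_p, eventually_sorts_abs s beta0 u) /\
     (forall s : 'S_p, eventually_sorts_abs s beta0 u ->
        cvg (diff_quotient (slope_norm lam) beta0 u t @[t --> 0^'+]) /\
        dir_deriv (slope_norm lam) beta0 u = slope_dir_formula lam beta0 u s)).

Proof.
have lw := slope_weights_lim lam_weights lam_cvg.
split; last first.
  move=> u; split; first exact: ex_eventually_sorts_abs.
  move=> s su; split; last exact: dir_derivE.
  by apply/cvg_ex; exists (slope_dir_formula lam beta0 u s); exact: diff_quotient_cvg.
move=> d' T' Q W WG.
pose D := dir_deriv (slope_norm lam) beta0.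
have DL : lipschitz_midconvex _ D := dir_deriv_lipschitz_midconvex beta0 lw.
have [c c0 Cc] := pos_def_lower_bound C_pos_def.
have [F [Fmin cF]] := argmin_map c0 Cc DL.
have Fmin' w : argmin (quad_objective C D w) (F w) by rewrite Fmin.
(* The limit variable is F(W), measurable because F is continuous. *)
have mFW : measurable_fun setT ((F : borel_cV R p -> borel_cV R p) \o W).
  exact (measurableT_comp (borel_measurable_continuous_vector cF) (measurable_funPT W)).
pose uhat : {RV Q >-> borel_cV R p} := @mfun_Sub _ _ T' (borel_cV R p) _ (mem_set mFW).
exists uhat; split; first by move=> w; exact: Fmin.
pose Wn := score X eps; pose Cn := gram X.
have mW j : measurable_fun setT (fun w => (W w : 'cV[R]_p) j 0).
  exact (measurableT_comp (measurable_coord_fun j) (measurable_funPT W)).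
have quadS t : quad (sigma ^+ 2 *: C) t = sigma ^+ 2 * quad C t.
  by rewrite /quad -scalemxAr -scalemxAl mxE.
have quadC0 t : 0 <= quad C t.
  by apply: le_trans (Cc t); rewrite mulr_ge0 ?sqr_ge0// ltW.
have Wchar t : \int[Q]_w cos (dot t (W w)) = expR (- (sigma ^+ 2 * quad C t / 2)) /\
    \int[Q]_w sin (dot t (W w)) = 0.
  have := gaussian_char (t := t) WG; rewrite quadS; apply.
  by rewrite mulr_ge0 ?sqr_ge0.
have schar := score_char X_iid X_L2 X_centered X_cov eps_iid eps_L2 eps_centered
  eps_var X_eps_indep.
have mWn : forall n j, measurable_fun setT (fun w => Wn n w j 0) :=
  measurable_score X eps.
have ssm := score_second_moment X_iid X_L2 X_centered X_cov eps_iid eps_L2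
  eps_centered eps_var X_eps_indep.
have weak h M : continuous h -> (forall x, `|h x| <= M) ->
    \int[P]_w h (Wn n w) @[n --> \oo] --> \int[Q]_w h (W w).
  have hcos t : \int[P]_w cos (dot t (Wn n w)) @[n --> \oo] -->
      \int[Q]_w cos (dot t (W w)) by rewrite (Wchar t).1; exact: (schar t).1.
  have hsin t : \int[P]_w sin (dot t (Wn n w)) @[n --> \oo] -->
      \int[Q]_w sin (dot t (W w)) by rewrite (Wchar t).2; exact: (schar t).2.
  move=> ch hM.
  exact: (cvg_of_char mWn mW hcos hsin (fun n => (ssm n).1) (fun n => (ssm n).2) ch hM).
move=> f cf [M fM].
have M0 : 0 <= M by exact: le_trans (fM 0).
pose un n w : 'cV[R]_p := Num.sqrt n%:R *: ((betahat n w : 'cV[R]_p) - beta0).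
have mfu n : measurable_fun setT (fun w => f (un n w)).
  have cg : continuous (fun b : 'cV[R]_p => f (Num.sqrt n%:R *: (b - beta0))).
    have cs : continuous (fun b : 'cV[R]_p => Num.sqrt n%:R *: (b - beta0)).
      apply: (@lipschitz_continuous _ _ _ _ (Num.sqrt n%:R)) => x y.
      by rewrite -scalerBr opprB addrA subrK normrZ ger0_norm// sqrtr_ge0.
    by move=> b; exact (continuous_comp (cs b) (cf _)).
  exact (measurableT_comp (borel_measurable_continuous cg) (measurable_funPT (betahat n))).
have ifu n : rint P (fun w => f (un n w)) by exact: bounded_integrable (mfu n) (fun w => fM _).
have cfF : continuous (f \o F) by move=> x; apply: continuous_comp; [exact: cF|exact: cf].
have fFM x : `|(f \o F) x| <= M by exact: fM.
have ifW n : rint P (fun w => f (F (Wn n w))).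
  by exact: bounded_integrable (measurable_continuous_comp (mWn n) cfF fFM) (fun w => fM _).
have ifQ : rint Q (fun w => f (F (W w))).
  by exact: bounded_integrable (measurable_continuous_comp mW cfF fFM) (fun w => fM _).
suff lim : \int[P]_w f (un n w) @[n --> \oo] --> \int[Q]_w f (F (W w)).
  rewrite (expectation_Rintegral ifQ).
  rewrite (_ : (fun n => 'E_P[f \o _])%E = fun n => (\int[P]_w f (un n w))%:E).
    by apply: cvg_EFin; [exact: nearW|exact: lim].
  by apply/funext => n; rewrite -(expectation_Rintegral (ifu n)).
apply/cvgrPdist_le => e e0.
pose B := score_bound C sigma.
have B0 : 0 <= B.
  apply: le_trans (ssm 0%N).2; apply: Rintegral_ge0 => w _.
  by apply: sumr_ge0 => i _; exact: sqr_ge0.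
pose e1 := e / 4; have e10 : 0 < e1 by rewrite divr_gt0.
(* By Markov's inequality the event that the squared norm of W_n exceeds K2 costs at most e1, the
   factor 2 M included. *)
pose K2 := 2 * M * B / e1 + 1.
have K20 : 0 < K2 by rewrite ltr_wpDl// divr_ge0 ?(ltW e10)// mulr_ge0// mulr_ge0.
have KB : 2 * M * (K2^-1 * B) <= e1.
  rewrite mulrCA mulrC ler_pdivrMr// /K2 mulrDr [e1 * _]mulrC divfK ?gt_eqF//.
  by rewrite mulr1 lerDl ltW.
pose K := Num.sqrt K2.
have Kle x : sqnorm2 x <= K2 -> `|x : 'cV[R]_p| <= K.
  move=> xK; rewrite -(ler_sqr (x := `|x|)) ?nnegrE ?sqrtr_ge0// (sqr_sqrtr (ltW K20)).
  exact: le_trans (norm_le_sqnorm2 x) xK.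
pose R0 := 4 * (p%:R * K + \sum_(i < p) lam i 0) / c.
have FR w : `|w| <= K -> `|F w| <= R0.
  move=> wK; apply: le_trans (argmin_bound c0 Cc DL (Fmin' w)) _.
  by rewrite /R0 ler_pM2r ?invr_gt0// ler_pM2l// lerD2r ler_wpM2l.
have [r r0 rP] := uniform_continuity R0 cf e10.
have [del del0 [N NP]] := argmin_close lam_weights lam_cvg C_pos_def Fmin'
  (sqrtr_ge0 K2) r0.
(* At least 1 as soon as one entry of C_n is farther than [del] from that of C. *)
pose tail n w : R := \sum_(jk : 'I_p * 'I_p) (del < `|(Cn n w - C) jk.1 jk.2|)%R%:R.
have itail n : rint P (tail n).
  apply: rint_sum => jk.
  exact: (gram_cvg X_iid X_L2 X_centered X_cov eps_iid X_eps_indep jk.1 jk.2 del0).1.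
have tail0 : \int[P]_w tail n w @[n --> \oo] --> (0 : R).
  rewrite (_ : (fun n => _) = fun n => \sum_(jk : 'I_p * 'I_p)
      \int[P]_w (del < `|(Cn n w - C) jk.1 jk.2|)%R%:R).
    apply: cvg_sum0 => jk.
    exact: (gram_cvg X_iid X_L2 X_centered X_cov eps_iid X_eps_indep jk.1 jk.2 del0).2.
  apply/funext => n; rewrite Rintegral_finsum// => jk.
  exact: (gram_cvg X_iid X_L2 X_centered X_cov eps_iid X_eps_indep jk.1 jk.2 del0).1.
have tail_ge0 n w : 0 <= tail n w by apply: sumr_ge0 => jk _; rewrite ler0n.
(* If W_n is large or C_n is far from C, the bracket is at least 1 and the trivial bound 2 M
   suffices. Otherwise [argmin_close] puts u_n within r of F(W_n), and uniform continuity gives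
   e1. *)
have pointwise n w : (maxn N 1 <= n)%N -> `|f (F (Wn n w)) - f (un n w)| <=
    e1 + 2 * M * (K2^-1 * sqnorm2 (Wn n w) + tail n w).
  rewrite geq_max => /andP[Nn n0].
  have s0 : 0 <= sqnorm2 (Wn n w) by apply: sumr_ge0 => i _; exact: sqr_ge0.
  have s0' : 0 <= K2^-1 * sqnorm2 (Wn n w) by rewrite mulr_ge0// invr_ge0 ltW.
  have crude : 1 <= K2^-1 * sqnorm2 (Wn n w) + tail n w ->
      `|f (F (Wn n w)) - f (un n w)| <= e1 + 2 * M * (K2^-1 * sqnorm2 (Wn n w) + tail n w).
    move=> h1; apply: le_trans (ler_normB _ _) _.
    have := fM (F (Wn n w)); have := fM (un n w).
    have : 2 * M * 1 <= 2 * M * (K2^-1 * sqnorm2 (Wn n w) + tail n w).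
      by rewrite ler_wpM2l// mulr_ge0.
    lra.
  have [WK|/ltW WK] := leP (sqnorm2 (Wn n w)) K2; last first.
    by apply: crude; rewrite ler_wpDr// mulrC ler_pdivlMr// mul1r.
  have [/forallP small|/forallPn[jk]] := boolP [forall jk : 'I_p * 'I_p,
      `|(Cn n w - C) jk.1 jk.2| <= del]; last first.
    rewrite -ltNge => big; apply: crude; apply: ler_wpDl => //.
    by rewrite /tail (bigD1 jk)//= big lerDl sumr_ge0.
  apply: ler_wpDr; first by rewrite mulr_ge0 ?mulr_ge0// addr_ge0.
  apply: rP; first by apply: FR; exact: Kle.
  apply: (NP n (Cn n w) (Wn n w)) => //; last first.
  - exact: argmin_rescaled n0 (betahat_argmin n w).
  - exact: Kle.
  - by move=> i j; exact: (small (i, j)).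
have e1' : 0 < e1 / (2 * M + 1) by rewrite divr_gt0// ltr_wpDl// mulr_ge0.
have := weak _ _ cfF fFM => /cvgrPdist_le /(_ _ e10) near1.
have near2 : \forall n \near \oo, `|\int[P]_w tail n w| <= e1 / (2 * M + 1).
  exact: cvgr0_norm_le.
have near3 : \forall n \near \oo, (maxn N 1 <= n)%N by exists (maxn N 1).
near=> n.
have h1 : `|\int[Q]_w (f \o F) (W w) - \int[P]_w (f \o F) (Wn n w)| <= e1.
  by near: n.
have h2 : \int[P]_w tail n w <= e1 / (2 * M + 1).
  by apply: le_trans (ler_norm _) _; near: n; exact: near2.
have h3 : `|\int[P]_w f (F (Wn n w)) - \int[P]_w f (un n w)| <=
    e1 + 2 * M * (K2^-1 * B + e1 / (2 * M + 1)).
  have [isq sB] := ssm n.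
  have iK : rint P (fun w => K2^-1 * sqnorm2 (Wn n w)) by exact: rintZ.
  have iKt : rint P (fun w => K2^-1 * sqnorm2 (Wn n w) + tail n w) by exact: rintD.
  rewrite -Rintegral_sub//.
  apply: (@le_trans _ _ (\int[P]_w (e1 + 2 * M * (K2^-1 * sqnorm2 (Wn n w) + tail n w)))).
    apply: norm_Rintegral_le => [||w].
    - exact: rintB.
    - by apply: rintD; [exact: rint_cst|exact: rintZ].
    - by apply: pointwise; near: n.
  rewrite Rintegral_add; [|exact: rint_cst|exact: rintZ].
  rewrite Rintegral_probability_cst Rintegral_scale// Rintegral_add//.
  rewrite Rintegral_scale// lerD2l ler_wpM2l ?mulr_ge0// lerD//.
  by rewrite ler_wpM2l// invr_ge0 ltW.
have h4 : 2 * M * (e1 / (2 * M + 1)) <= e1.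
  have A0 : 0 < 2 * M + 1 by rewrite ltr_wpDl// mulr_ge0.
  rewrite mulrCA ger_pMr// ler_pdivrMr// mul1r lerDl//.
(* One e1 each for the weak limit, uniform continuity, the tail of W_n and the deviation of C_n. *)
have -> : e = e1 + (e1 + e1 + e1) by rewrite /e1; field.
rewrite -(subrKA (\int[P]_w f (F (Wn n w)))) (le_trans (ler_normD _ _))// lerD//.
rewrite (le_trans h3)// -addrA lerD2l mulrDr.
exact: lerD.
Unshelve. all: by end_near. Qed.
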